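(* Let $s\ge 2/3$. Then unconditional uniqueness holds in $H^s(\mathbb{T}^2)$ for the Cauchy problem for the cubic nonlinear Schrödinger equation $$i\partial_tu+\Delta u=\pm|u|^2u,\quad (t,x)\in[0,T]\times\mathbb{T}^2,\qquad u(0,x)=u_0(x)$$ (either choice of sign). That is, for any $T>0$ and any $u_0\in H^s(\mathbb{T}^2)$ there is at most one distributional solution $u\in C([0,T];H^s(\mathbb{T}^2))$ with $u(0)=u_0$.
   Context: $\mathbb{T}=\mathbb{R}/2\pi\mathbb{Z}$; $H^s(\mathbb{T}^2)$ is the usual $L^2$-based Sobolev space of complex-valued functions. For $s\ge 2/3$ the nonlinearity $|u|^2u$ is a well-defined $L^2$ function in $x$ for each $t$ by the Sobolev embedding; a distributional solution is $u\in C([0,T];H^s)$ satisfying the equation in $\mathcal{D}'((0,T)\times\mathbb{T}^2)$. *)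

(* Defs.v *)
From HB Require Import structures.
From mathcomp Require Import all_boot all_order all_algebra.
From mathcomp Require Import complex.
From mathcomp Require Import all_classical all_reals all_analysis.

Set Implicit Arguments.
Unset Strict Implicit.
Unset Printing Implicit Defensive.

Import Order.TTheory GRing.Theory Num.Theory.
Import numFieldNormedType.Exports.
Import Normc.

Local Open Scope classical_set_scope.
Local Open Scope ring_scope.
Local Open Scope complex_scope.

Section nls.
Context {R : realType}.

Local Notation leb := (@lebesgue_measure R).
Local Notation leb2 := (leb \x leb)%E.

Definition cintegral d (X : measurableType d)
    (mu : {measure set X -> \bar R}) (D : set X) (f : X -> R[i]) : R[i] :=
  Rintegral mu D (fun x => complex.Re (f x)) +i*
  Rintegral mu D (fun x => complex.Im (f x)).

(* A function on the torus (R/2piZ)^2 is a 2pi-periodic function on R^2, and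
   integration over the torus is integration over the fundamental cell. *)
Definition periodic2 (f : R * R -> R[i]) : Prop :=
  forall x y : R,
    f (x + 2 * pi, y) = f (x, y) /\ f (x, y + 2 * pi) = f (x, y).

Definition cell : set (R * R) := `[0, 2 * pi[ `*` `[0, 2 * pi[.

(* Equality of (classes of) functions on the torus. *)
Definition torus_eq (f g : R * R -> R[i]) : Prop :=
  f = g %[ae leb2 in cell].

Definition in_L2 (f : R * R -> R[i]) : Prop :=
  [/\ measurable_fun setT (fun x => complex.Re (f x)),
      measurable_fun setT (fun x => complex.Im (f x)) &
      (\int[leb2]_(x in cell) ((normc (f x)) ^+ 2)%:E < +oo)%E].

(* The factor is exp (- i k.x). *)
Definition fourier (f : R * R -> R[i]) (k : int * int) : R[i] :=
  ((2 * pi) ^- 2)%:C *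
  cintegral leb2 cell (fun x =>
    let kx := k.1%:~R * x.1 + k.2%:~R * x.2 in
    f x * (cos kx -i* sin kx)).

Definition Hs_norm (s : R) (f : R * R -> R[i]) : \bar R :=
  sqrte (\esum_(k in [set: int * int])
    ((1 + k.1%:~R ^+ 2 + k.2%:~R ^+ 2) `^ s *
     (normc (fourier f k)) ^+ 2)%:E).

(* Meant for 0 <= s, where H^s is a subspace of L^2. *)
Definition in_Hs (s : R) (f : R * R -> R[i]) : Prop :=
  [/\ periodic2 f, in_L2 f & (Hs_norm s f < +oo)%E].

(* Only the values u t with 0 <= t <= T are relevant. *)
Definition in_C_Hs (s T : R) (u : R -> R * R -> R[i]) : Prop :=
  (forall t : R, t \in `[0, T] -> in_Hs s (u t)) /\
  (forall t : R, t \in `[0, T] ->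
     Hs_norm s (fun x => u t' x - u t x)
       @[t' --> within `[0, T]%classic (nbhs t)] --> 0%E).

Fixpoint iter_derive (V : normedModType R) (vs : seq V) (f : V -> R) : V -> R :=
  if vs is v :: vs' then (fun z => 'D_v (iter_derive vs' f) z) else f.

Definition smooth (V : normedModType R) (f : V -> R) : Prop :=
  forall vs : seq V,
    continuous (iter_derive vs f) /\
    forall v z, derivable (iter_derive vs f) z v.

Local Notation spacetime := (R * (R * R))%type.

Definition cderive (v : spacetime) (phi : spacetime -> R[i]) (z : spacetime)
    : R[i] :=
  'D_v (fun w => complex.Re (phi w)) z +i* 'D_v (fun w => complex.Im (phi w)) z.

Definition dt : (spacetime -> R[i]) -> spacetime -> R[i] :=
  cderive (1, (0, 0)).

Definition laplacian (phi : spacetime -> R[i]) (z : spacetime) : R[i] :=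
  cderive (0, (1, 0)) (cderive (0, (1, 0)) phi) z +
  cderive (0, (0, 1)) (cderive (0, (0, 1)) phi) z.

(* Test functions on (0,T) x torus, extended by zero to all times.  The torus
   being compact, compact support only constrains the time variable. *)
Definition test_function (T : R) (phi : spacetime -> R[i]) : Prop :=
  [/\ smooth (fun z => complex.Re (phi z)),
      smooth (fun z => complex.Im (phi z)),
      (forall t, periodic2 (fun x => phi (t, x))) &
      exists a b : R, [/\ 0 < a, b < T &
        forall t x, t \notin `[a, b] -> phi (t, x) = 0]].

(* The distribution on (0,T) x torus defined by f.  An iterated integral,
   because for f in C([0,T]; L^2) the representatives f t are chosen separately
   for each t and f need not be jointly measurable, whereas the inner integral
   depends only on the class of f t and is continuous in t. *)
Definition pairing (T : R) (f : R -> R * R -> R[i]) (phi : spacetime -> R[i])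
    : R[i] :=
  cintegral leb `[0, T] (fun t =>
    cintegral leb2 cell (fun x => f t x * phi (t, x))).

Definition cubic (u : R -> R * R -> R[i]) (t : R) (x : R * R) : R[i] :=
  ((normc (u t x)) ^+ 2)%:C * u t x.

(* i u_t + Laplacian u = (-1)^b |u|^2 u in D'((0,T) x torus), the derivatives
   being transposed onto the test function.  For u in C([0,T]; H^s) with
   s >= 2/3, cubic u is in C([0,T]; L^2), so every integral converges. *)
Definition NLS_distr (b : bool) (T : R) (u : R -> R * R -> R[i]) : Prop :=
  forall phi, test_function T phi ->
    'i%C * - pairing T u (dt phi) + pairing T u (laplacian phi) =
    (-1) ^+ b * pairing T (cubic u) phi.

Definition NLS_solution (b : bool) (s T : R) (u0 : R * R -> R[i])
    (u : R -> R * R -> R[i]) : Prop :=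
  [/\ in_C_Hs s T u, NLS_distr b T u & torus_eq (u 0) u0].

End nls.

(* Main.v *)
(* Only regularity 2/3 is used.  Testing the equation against
   psi(t) exp(i(|k|^2 t - k.x)) shows that the profile
   exp(i|k|^2 t) u^(t)(k) of every Fourier mode is the integral of a continuous
   function (Duhamel's formula).  Cut u into Fourier blocks of size N = 2^(12 j).
   On a time interval of length at most 1/(4N) the exponential sums over
   |k| < N decay like those of the Schroedinger flow on R^2, and a TT* argument
   bounds the L^2_t L^infty_x norm of a block with a logarithmic loss only; by
   Duhamel the data contribute N^(-4/3) and the forcing, whose coefficients up to
   N have square sum O(N^(2/3)), contributes N^(-2) N^(2/3).  Adding up the O(N)
   short intervals leaves N^(-1/3) log^2 N, which is summable over the blocks:
   every solution lies in L^2_t L^infty_x.  The difference w of two solutions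
   then satisfies d/dt |w|^2 <= C (sup |u|^2 + sup |v|^2) |w|^2 in L^2, and
   Gronwall's argument gives w = 0. *)
Require Import Defs.
From HB Require Import structures.
From mathcomp Require Import all_boot all_order all_algebra.
From mathcomp Require Import complex.
From mathcomp Require Import all_classical all_reals all_analysis.
From mathcomp Require Import measurable_realfun.
From mathcomp Require Import ring lra zify.

Set Implicit Arguments.
Unset Strict Implicit.
Unset Printing Implicit Defensive.

Import Order.TTheory GRing.Theory Num.Theory.
Import numFieldNormedType.Exports.
Import Normc.

Local Open Scope classical_set_scope.
Local Open Scope ring_scope.
Local Open Scope complex_scope.

(** * Complex numbers in real coordinates, and the unit circle *)

Section complex_numbers.
Context {R : realType}.
Implicit Types (x y z : R[i]) (a b : R).

(** Each [u t] is a representative chosen for its own time, so nothing may be integrated jointly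
    over space-time. Time integrals are taken of Fourier coefficients, of finite expressions in
    them, of suprema of finite blocks, or of series of such suprema, all built from functions
    continuous in time. Functions are recovered from coefficients at a fixed time only, through
    uniqueness of Fourier coefficients and almost everywhere convergence of block sums.

    The decay 1/|t| just fails to be integrable: this is the forbidden endpoint of the Strichartz
    estimates in dimension two. Sampling one time per cell of length about N^(-2) replaces the
    singularity by the trivial kernel bound N^2 and costs one logarithm; the kernel bound itself
    costs another. The limit |t| <= 1/(4N) stays clear of the nonzero rational multiples of 2 pi
    with denominator up to N, near which Weyl sums are large again.

    The function dominating |u|^2 and |v|^2 is only integrable in time, so Gronwall's argument is
    run as a contraction on intervals where its integral is at most 1/16. *)

Lemma ReD x y : complex.Re (x + y) = complex.Re x + complex.Re y.
Proof. by case: x => ? ?; case: y => ? ?. Qed.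

Lemma ImD x y : complex.Im (x + y) = complex.Im x + complex.Im y.
Proof. by case: x => ? ?; case: y => ? ?. Qed.

Lemma ReM x y : complex.Re (x * y) =
  complex.Re x * complex.Re y - complex.Im x * complex.Im y.
Proof. by case: x => ? ?; case: y => ? ?. Qed.

Lemma ImM x y : complex.Im (x * y) =
  complex.Re x * complex.Im y + complex.Im x * complex.Re y.
Proof. by case: x => ? ?; case: y => ? ?. Qed.

Lemma Re_sum I (s : seq I) (P : pred I) (F : I -> R[i]) :
  complex.Re (\sum_(i <- s | P i) F i) = \sum_(i <- s | P i) complex.Re (F i).
Proof. by apply: (big_morph _ ReD). Qed.

Lemma Im_sum I (s : seq I) (P : pred I) (F : I -> R[i]) :
  complex.Im (\sum_(i <- s | P i) F i) = \sum_(i <- s | P i) complex.Im (F i).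
Proof. by apply: (big_morph _ ImD). Qed.

Lemma ReN z : complex.Re (- z) = - complex.Re z.
Proof. by case: z. Qed.

Lemma ImN z : complex.Im (- z) = - complex.Im z.
Proof. by case: z. Qed.

Lemma Re_conjc z : complex.Re (conjc z) = complex.Re z.
Proof. by case: z. Qed.

Lemma Im_conjc z : complex.Im (conjc z) = - complex.Im z.
Proof. by case: z. Qed.

Lemma complexP x y :
  complex.Re x = complex.Re y -> complex.Im x = complex.Im y -> x = y.
Proof. by case: x => ? ?; case: y => ? ? /= -> ->. Qed.

Lemma normc_ge0 z : 0 <= normc z.
Proof. by case: z => ? ?; rewrite /normc sqrtr_ge0. Qed.

Lemma sqr_normcE z : normc z ^+ 2 = complex.Re z ^+ 2 + complex.Im z ^+ 2.
Proof. by case: z => ? ?; rewrite /normc sqr_sqrtr// addr_ge0// sqr_ge0. Qed.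

Lemma normc_triangle x y : normc (x + y) <= normc x + normc y.
Proof. exact: le_normcD. Qed.

Lemma normcB_le x y : normc (x - y) <= normc x + normc y.
Proof. by rewrite (le_trans (normc_triangle _ _))// normcN. Qed.

Lemma normcB_sym x y : normc (x - y) = normc (y - x).
Proof. by rewrite -normcN opprB. Qed.

Lemma normcB_dist x y : `|normc x - normc y| <= normc (x - y).
Proof.
rewrite ler_norml; apply/andP; split.
  rewrite lerNl opprB lerBlDr -[in leLHS](subrK x y).
  by rewrite (le_trans (normc_triangle _ _))// normcB_sym.
by rewrite lerBlDr -[in leLHS](subrK y x) normc_triangle.
Qed.

Lemma normc_sum I (s : seq I) (P : pred I) (F : I -> R[i]) :
  normc (\sum_(i <- s | P i) F i) <= \sum_(i <- s | P i) normc (F i).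
Proof.
elim/big_ind2 : _ => [|x a y b xa yb|//]; first by rewrite normc0.
by rewrite (le_trans (normc_triangle _ _))// lerD.
Qed.

Lemma normc_conjc z : normc (conjc z) = normc z.
Proof. by case: z => ? ?; rewrite /normc /= sqrrN. Qed.

Lemma normc_real a : normc a%:C = `|a|.
Proof. by rewrite /normc /= expr0n/= addr0 sqrtr_sqr. Qed.

Lemma normc_i : normc ('i%C : R[i]) = 1.
Proof. by rewrite /normc /= expr0n/= expr1n add0r sqrtr1. Qed.

Lemma normcX z n : normc (z ^+ n) = normc z ^+ n.
Proof. by elim: n => [|n ih]; rewrite ?expr0 ?normc1// !exprS normcM ih. Qed.

Lemma Re_le_normc z : `|complex.Re z| <= normc z.
Proof.
rewrite -[leRHS]ger0_norm ?normc_ge0// -ler_sqr ?nnegrE//.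
by rewrite !real_normK ?num_real// sqr_normcE lerDl sqr_ge0.
Qed.

Lemma Im_le_normc z : `|complex.Im z| <= normc z.
Proof.
rewrite -[leRHS]ger0_norm ?normc_ge0// -ler_sqr ?nnegrE//.
by rewrite !real_normK ?num_real// sqr_normcE lerDr sqr_ge0.
Qed.

Lemma normc_le_ReIm z : normc z <= `|complex.Re z| + `|complex.Im z|.
Proof.
rewrite -[leLHS]ger0_norm ?normc_ge0// -[leRHS]ger0_norm ?addr_ge0//.
rewrite -ler_sqr ?nnegrE// !real_normK ?num_real// sqr_normcE.
rewrite sqrrD !real_normK ?num_real//.
by rewrite -addrA lerD2l lerDr mulrn_wge0// mulr_ge0.
Qed.

Lemma mulc_conjc z : z * conjc z = (normc z ^+ 2)%:C.
Proof.
apply: complexP; rewrite ?sqr_normcE; case: z => ? ? /=; ring.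
Qed.

Lemma Re_mulc_conjc z : complex.Re (z * conjc z) = normc z ^+ 2.
Proof. by rewrite mulc_conjc. Qed.

Lemma sqr_normcB x y : normc (x - y) ^+ 2 =
  normc x ^+ 2 - complex.Re (x * conjc y) *+ 2 + normc y ^+ 2.
Proof. by rewrite !sqr_normcE; case: x => ? ?; case: y => ? ? /=; ring. Qed.

Lemma normc_sum_sqr I (s : seq I) (F : I -> R[i]) :
  normc (\sum_(i <- s) F i) ^+ 2 <=
  (size s)%:R * \sum_(i <- s) normc (F i) ^+ 2.
Proof.
apply: (@le_trans _ _ ((\sum_(i <- s) normc (F i)) ^+ 2)).
  by rewrite lerXn2r ?nnegrE ?normc_ge0 ?normc_sum// sumr_ge0// => *; rewrite normc_ge0.
elim: s => [|a s ih]; first by rewrite !big_nil expr0n mulr0.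
rewrite !big_cons /= -natr1 mulrDl mul1r.
set A := normc _; set B := \sum_(i <- s) _ in ih *; set S := \sum_(i <- s) _ in ih *.
case: s => [|b s] in A B S ih *; first by rewrite /B /S !big_nil /= mul0r add0r !addr0.
set n : R := (size _)%:R in ih *.
have n0 : 0 < n by rewrite ltr0n.
(* Multiplied by [n], this is (n A - B)^2 >= 0 combined with the induction hypothesis B^2 <= n S. *)
suff : 2 * A * B <= n * A ^+ 2 + S by move: ih; nra.
rewrite -(ler_pM2l n0).
have := sqr_ge0 (n * A - B); nra.
Qed.

(** Splitting off |x|^2 (x - y) leaves (|x|^2 - |y|^2) y, whose first factor is at most |x - y| (|x|
    + |y|). The cubic nonlinearity is thus Lipschitz with a constant quadratic in the sizes. *)
Lemma normcB3 (x y : R[i]) :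
  normc ((normc x ^+ 2)%:C * x - (normc y ^+ 2)%:C * y) <=
  2 * (normc x ^+ 2 + normc y ^+ 2) * normc (x - y).
Proof.
have -> : (normc x ^+ 2)%:C * x - (normc y ^+ 2)%:C * y =
  (normc x ^+ 2)%:C * (x - y) + (normc x ^+ 2 - normc y ^+ 2)%:C * y.
  by rewrite rmorphB /=; ring.
rewrite (le_trans (normc_triangle _ _))// !normcM !normc_real.
rewrite (ger0_norm (sqr_ge0 _)) subr_sqr normrM.
have := normcB_dist x y; set d := `|normc x - _|; set e := normc (x - y) => de.
have d0 : 0 <= d by rewrite /d normr_ge0.
have := normc_ge0 x; have := normc_ge0 y; have := normc_ge0 (x - y).
rewrite -/e; set a := normc x; set b := normc y => e0 b0 a0.
rewrite (ger0_norm (addr_ge0 a0 b0)).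
suff : d * (a + b) * b <= e * (a ^+ 2 + 2 * b ^+ 2) by nra.
have h1 : (a + b) * b <= a ^+ 2 + 2 * b ^+ 2 by have := sqr_ge0 (a - b); nra.
rewrite -mulrA ler_pM//.
by rewrite mulr_ge0 ?addr_ge0.
Qed.

Definition cis a : R[i] := cos a +i* sin a.

Lemma cis0 : cis 0 = 1.
Proof. by rewrite /cis cos0 sin0. Qed.

Lemma cisD a b : cis (a + b) = cis a * cis b.
Proof. by apply: complexP; rewrite /= ?cosD ?sinD//; ring. Qed.

Lemma cisN a : cis (- a) = conjc (cis a).
Proof. by rewrite /cis cosN sinN. Qed.

Lemma normc_cis a : normc (cis a) = 1.
Proof. by rewrite /normc /= cos2Dsin2 sqrtr1. Qed.

Lemma cisNK a : cis (- a) * cis a = 1.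
Proof. by rewrite -cisD addNr cis0. Qed.

End complex_numbers.

(** * Integrals of complex-valued functions *)

Section complex_integral.
Context {R : realType} d (X : measurableType d).
Context (mu : {measure set X -> \bar R}) (D : set X) (mD : measurable D).
Implicit Types (f g : X -> R[i]).

Definition cmeas f :=
  measurable_fun D (fun x => complex.Re (f x)) /\
  measurable_fun D (fun x => complex.Im (f x)).

Definition cintble f :=
  mu.-integrable D (EFin \o (fun x => complex.Re (f x))) /\
  mu.-integrable D (EFin \o (fun x => complex.Im (f x))).

Lemma cmeas_cst z : cmeas (fun=> z).
Proof. by split; exact: measurable_cst. Qed.

Lemma cmeas_real (h : X -> R) : measurable_fun D h -> cmeas (fun x => (h x)%:C).
Proof. by move=> mh; split => //=; exact: measurable_cst. Qed.

Lemma cmeasD f g : cmeas f -> cmeas g -> cmeas (fun x => f x + g x).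
Proof.
move=> [f1 f2] [g1 g2]; split.
  by under eq_fun do rewrite ReD; exact: measurable_funD.
by under eq_fun do rewrite ImD; exact: measurable_funD.
Qed.

Lemma cmeasM f g : cmeas f -> cmeas g -> cmeas (fun x => f x * g x).
Proof.
move=> [f1 f2] [g1 g2]; split.
  under eq_fun do rewrite ReM.
  by apply: measurable_funB; exact: measurable_funM.
under eq_fun do rewrite ImM.
by apply: measurable_funD; exact: measurable_funM.
Qed.

Lemma cmeasZ z f : cmeas f -> cmeas (fun x => z * f x).
Proof. by move=> mf; apply: cmeasM => //; exact: cmeas_cst. Qed.

Lemma cmeasN f : cmeas f -> cmeas (fun x => - f x).
Proof. by move=> mf; under eq_fun do rewrite -mulN1r; exact: cmeasZ. Qed.

Lemma cmeasB f g : cmeas f -> cmeas g -> cmeas (fun x => f x - g x).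
Proof. by move=> mf mg; apply: cmeasD => //; exact: cmeasN. Qed.

Lemma cmeas_conj f : cmeas f -> cmeas (fun x => conjc (f x)).
Proof.
move=> [f1 f2]; split.
  by under eq_fun do rewrite Re_conjc.
under eq_fun do rewrite Im_conjc.
exact: measurable_funN.
Qed.

Lemma cmeas_sum I (s : seq I) (F : I -> X -> R[i]) : (forall i, cmeas (F i)) ->
  cmeas (fun x => \sum_(i <- s) F i x).
Proof.
move=> mF; elim: s => [|a s ih].
  by under eq_fun do rewrite big_nil; exact: cmeas_cst.
by under eq_fun do rewrite big_cons; exact: cmeasD.
Qed.

Lemma cmeas_normc f : cmeas f -> measurable_fun D (fun x => normc (f x)).
Proof.
move=> [f1 f2].
rewrite (_ : (fun x => _) =
  Num.sqrt \o (fun x => complex.Re (f x) ^+ 2 + complex.Im (f x) ^+ 2)).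
  apply: measurableT_comp.
    exact: (continuous_measurable_fun (@sqrt_continuous R)).
  by apply: measurable_funD; exact: measurable_funX.
by apply/funext => x /=; rewrite -sqr_normcE sqrtr_sqr ger0_norm ?normc_ge0.
Qed.

Lemma cmeas_normcX f n : cmeas f -> measurable_fun D (fun x => normc (f x) ^+ n).
Proof. by move=> mf; apply: measurable_funX; exact: cmeas_normc. Qed.

Lemma cmeas_EnormcX f n : cmeas f ->
  measurable_fun D (fun x => (normc (f x) ^+ n)%:E).
Proof. by move=> mf; apply/measurable_EFinP; exact: cmeas_normcX. Qed.

Lemma cintble_meas f : cintble f -> cmeas f.
Proof. by move=> [f1 f2]; split; apply/measurable_EFinP; exact: (measurable_int mu). Qed.

Lemma cintble_bound f (g : X -> R) : cmeas f -> mu.-integrable D (EFin \o g) ->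
  (forall x, D x -> normc (f x) <= g x) -> cintble f.
Proof.
move=> [f1 f2] ig fg; split; apply: (le_integrable mD _ _ ig) => //=.
- exact/measurable_EFinP.
- move=> x Dx /=; rewrite lee_fin (le_trans (Re_le_normc _))//.
  by rewrite (le_trans (fg _ Dx))// ler_norm.
- exact/measurable_EFinP.
- move=> x Dx /=; rewrite lee_fin (le_trans (Im_le_normc _))//.
  by rewrite (le_trans (fg _ Dx))// ler_norm.
Qed.

Lemma cintble_normc f : cintble f -> mu.-integrable D (EFin \o (fun x => normc (f x))).
Proof.
move=> if_; have [f1 f2] := if_; have [m1 m2] := cintble_meas if_.
apply: (@le_integrable _ _ _ _ _ mD _ (fun x => `|(complex.Re (f x))%:E| + `|(complex.Im (f x))%:E|)%E).
- by apply/measurable_EFinP; exact: cmeas_normc.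
- move=> x Dx /=; rewrite lee_fin ger0_norm ?normc_ge0//.
  by rewrite (le_trans (normc_le_ReIm _))// ler_norm.
- by apply: integrableD => //; exact: integrable_abse.
Qed.

Lemma cintble_lty f : cmeas f -> (\int[mu]_(x in D) (normc (f x))%:E < +oo)%E ->
  cintble f.
Proof.
move=> mf ifoo; apply: (@cintble_bound _ (fun x => normc (f x))) => //.
apply/integrableP; split; first by apply/measurable_EFinP; exact: cmeas_normc.
under eq_integral do rewrite /= ger0_norm ?normc_ge0//.
exact: ifoo.
Qed.

Lemma cintbleD f g : cintble f -> cintble g -> cintble (fun x => f x + g x).
Proof.
move=> [f1 f2] [g1 g2]; split.
  by under [EFin \o _]eq_fun do rewrite /= ReD EFinD; exact: integrableD.
by under [EFin \o _]eq_fun do rewrite /= ImD EFinD; exact: integrableD.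
Qed.

Lemma cintbleZ z f : cintble f -> cintble (fun x => z * f x).
Proof.
move=> [f1 f2]; split.
  under [EFin \o _]eq_fun do rewrite /= ReM EFinB !EFinM.
  by apply: integrableB => //; exact: integrableZl.
under [EFin \o _]eq_fun do rewrite /= ImM EFinD !EFinM.
by apply: integrableD => //; exact: integrableZl.
Qed.

Lemma cintble_sum I (s : seq I) (F : I -> X -> R[i]) : (forall i, cintble (F i)) ->
  cintble (fun x => \sum_(i <- s) F i x).
Proof.
move=> mF; elim: s => [|a s ih].
  under eq_fun do rewrite big_nil.
  by split; rewrite (_ : _ \o _ = cst 0%E)//; exact: integrable0.
by under eq_fun do rewrite big_cons; exact: cintbleD.
Qed.

Lemma cintegralD f g : cintble f -> cintble g ->
  cintegral mu D (fun x => f x + g x) = cintegral mu D f + cintegral mu D g.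
Proof.
move=> [f1 f2] [g1 g2]; apply: complexP => /=.
  by under eq_Rintegral do rewrite ReD; rewrite RintegralD.
by under eq_Rintegral do rewrite ImD; rewrite RintegralD.
Qed.

Lemma cintegralZ z f : cintble f ->
  cintegral mu D (fun x => z * f x) = z * cintegral mu D f.
Proof.
move=> [f1 f2]; apply: complexP.
  rewrite ReM /=; under eq_Rintegral do rewrite ReM.
  rewrite RintegralB//=; first by rewrite !RintegralZl.
    by under [EFin \o _]eq_fun do rewrite /= !EFinM; exact: integrableZl.
  by under [EFin \o _]eq_fun do rewrite /= !EFinM; exact: integrableZl.
rewrite ImM /=; under eq_Rintegral do rewrite ImM.
rewrite RintegralD//=; first by rewrite !RintegralZl.
  by under [EFin \o _]eq_fun do rewrite /= !EFinM; exact: integrableZl.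
by under [EFin \o _]eq_fun do rewrite /= !EFinM; exact: integrableZl.
Qed.

Lemma cintegralB f g : cintble f -> cintble g ->
  cintegral mu D (fun x => f x - g x) = cintegral mu D f - cintegral mu D g.
Proof.
move=> fi gi; under [fun x => _]eq_fun do rewrite -mulN1r.
by rewrite cintegralD//; [rewrite cintegralZ// mulN1r|exact: cintbleZ].
Qed.

Lemma cintegral_sum I (s : seq I) (F : I -> X -> R[i]) : (forall i, cintble (F i)) ->
  cintegral mu D (fun x => \sum_(i <- s) F i x) = \sum_(i <- s) cintegral mu D (F i).
Proof.
move=> iF; elim: s => [|a s ih].
  under eq_fun do rewrite big_nil.
  rewrite big_nil; apply: complexP => /=; rewrite /Rintegral integral0//.
under eq_fun do rewrite big_cons.
by rewrite big_cons cintegralD// ?ih//; exact: cintble_sum.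
Qed.

Lemma eq_cintegral f g : {in D, f =1 g} -> cintegral mu D f = cintegral mu D g.
Proof.
by move=> fg; apply: complexP => /=; apply: eq_Rintegral => x xD; rewrite fg.
Qed.

(* Rotating the integral onto the positive real axis reduces to the real case. *)
Lemma normc_cintegral f : cintble f ->
  normc (cintegral mu D f) <= \int[mu]_(x in D) normc (f x).
Proof.
move=> fi; set z := cintegral mu D f.
have [->|z0] := eqVneq z 0; first by rewrite normc0 Rintegral_ge0// => *; exact: normc_ge0.
have nz : 0 < normc z.
  by rewrite lt_neqAle normc_ge0 andbT eq_sym; apply: contra z0 => /eqP/eq0_normc ->.
have zE : normc z ^+ 2 = \int[mu]_(x in D) complex.Re (conjc z * f x).
  by rewrite -Re_mulc_conjc mulrC /z -cintegralZ.
rewrite -(ler_pM2l nz) -expr2 zE.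
rewrite -RintegralZl//; last exact: cintble_normc.
apply: le_Rintegral => //.
- by have [] := cintbleZ (conjc z) fi.
- under [EFin \o _]eq_fun do rewrite /= EFinM.
  by apply: integrableZl => //; exact: cintble_normc.
- move=> x Dx; rewrite (le_trans (ler_norm _))// (le_trans (Re_le_normc _))//.
  by rewrite normcM normc_conjc.
Qed.

Lemma Rintegral_fineK f : cintble f ->
  ((\int[mu]_(x in D) normc (f x))%:E = \int[mu]_(x in D) (normc (f x))%:E)%E.
Proof. by move=> fi; rewrite /Rintegral fineK// integrable_fin_num//; exact: cintble_normc. Qed.

Lemma normc_cintegral_le f (B : R) : cmeas f ->
  (\int[mu]_(x in D) (normc (f x))%:E <= B%:E)%E -> normc (cintegral mu D f) <= B.
Proof.
move=> mf iB; have fi : cintble f by apply: cintble_lty => //; exact: le_lt_trans iB (ltry _).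
by rewrite (le_trans (normc_cintegral fi))// -lee_fin Rintegral_fineK.
Qed.

End complex_integral.

(** * Integrals over intervals and over one period *)

Section continuous_integrals.
Context {R : realType}.
Local Notation leb := (@lebesgue_measure R).
Implicit Types (f g F : R -> R) (a b c : R).

Lemma continuous_integrable_itv f a b : continuous f ->
  leb.-integrable `[a, b] (EFin \o f).
Proof.
move=> cf; apply: continuous_compact_integrable; first exact: segment_compact.
exact: continuous_subspaceT.
Qed.

Lemma Rintegral_FTC2 F f a b : a <= b ->
  (forall x : R, is_derive x 1 F (f x)) -> continuous f ->
  \int[leb]_(x in `[a, b]) f x = F b - F a.
Proof.
rewrite le_eqVlt => /predU1P[->|ab] dF cf.
  by rewrite set_itv1 Rintegral_set1 subrr.
have derF (x : R) : derivable F x 1 by have [] := dF x.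
have cF : continuous F.
  by move=> x; apply/differentiable_continuous/derivable1_diffP.
rewrite /Rintegral (@continuous_FTC2 _ _ F)//.
- exact: continuous_subspaceT.
- split => //.
  + exact/cvg_at_right_filter/cF.
  + exact/cvg_at_left_filter/cF.
- by move=> x _; rewrite derive1E; have [_ ->] := dF x.
Qed.

Lemma Rintegral_split f a b c : continuous f -> a <= b -> b <= c ->
  \int[leb]_(x in `[a, c]) f x =
  \int[leb]_(x in `[a, b]) f x + \int[leb]_(x in `[b, c]) f x.
Proof.
move=> cf ab bc; apply/eqP; rewrite addrC -subr_eq; apply/eqP.
rewrite Rintegral_itvB ?bnd_simp//; last exact: continuous_integrable_itv.
rewrite Rintegral_itv_obnd_cbnd//.
by apply: integrableS (continuous_integrable_itv b c cf) => //; exact: subset_itv_oc_cc.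
Qed.

Lemma Rintegral_le f g a b : continuous f -> continuous g ->
  (forall x, a <= x <= b -> f x <= g x) ->
  \int[leb]_(x in `[a, b]) f x <= \int[leb]_(x in `[a, b]) g x.
Proof.
move=> cf cg fg; apply: le_Rintegral => //; try exact: continuous_integrable_itv.
Qed.

Lemma Rintegral_itv_cst a b c : a <= b -> \int[leb]_(x in `[a, b]) c = c * (b - a).
Proof.
move=> ab; rewrite Rintegral_cst//= lebesgue_measure_itv/= lte_fin.
by case: ltgtP ab => // -> _; rewrite subrr.
Qed.

Lemma is_derive_sin_scale a (x : R) : a != 0 ->
  is_derive x 1 (fun x => a^-1 * sin (a * x)) (cos (a * x)).
Proof.
move=> a0.
have h : is_derive x 1 (fun y : R => a * y) a.
  apply: is_derive_eq (@is_deriveZ _ _ _ _ a x 1 _ (is_derive_id x 1)) _.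
  by rewrite /GRing.scale /= mulr1.
have h2 := @is_derive1_comp _ _ _ x _ _ (is_derive_sin (a * x)) h.
apply: is_derive_eq (@is_deriveZ _ _ _ _ a^-1 x 1 _ h2) _.
by rewrite /GRing.scale /= mulrCA mulVf// mulr1.
Qed.

Lemma is_derive_cos_scale a (x : R) : a != 0 ->
  is_derive x 1 (fun x => - a^-1 * cos (a * x)) (sin (a * x)).
Proof.
move=> a0.
have h : is_derive x 1 (fun y : R => a * y) a.
  apply: is_derive_eq (@is_deriveZ _ _ _ _ a x 1 _ (is_derive_id x 1)) _.
  by rewrite /GRing.scale /= mulr1.
have h2 := @is_derive1_comp _ _ _ x _ _ (is_derive_cos (a * x)) h.
apply: is_derive_eq (@is_deriveZ _ _ _ _ (- a^-1) x 1 _ h2) _.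
by rewrite /GRing.scale /= mulNr mulNr mulrN opprK mulrCA mulVf// mulr1.
Qed.

Lemma continuous_mulr a : continuous (fun x : R => a * x).
Proof. by move=> x; apply: cvgM; [exact: cvg_cst|exact: cvg_id]. Qed.

Lemma continuous_cos_scale a : continuous (fun x : R => cos (a * x)).
Proof. by move=> x; apply: continuous_comp; [exact: continuous_mulr|exact: continuous_cos]. Qed.

Lemma continuous_sin_scale a : continuous (fun x : R => sin (a * x)).
Proof. by move=> x; apply: continuous_comp; [exact: continuous_mulr|exact: continuous_sin]. Qed.

Lemma sin_nat2pi (n : nat) : sin (n%:R * (2 * pi)) = 0 :> R.
Proof.
have := @periodicn _ _ _ _ (@sinD2pi R) n 0; rewrite add0r sin0 => h.
by rewrite -[RHS]h mulr_natl [2 * pi]mulr_natl.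
Qed.

Lemma cos_nat2pi (n : nat) : cos (n%:R * (2 * pi)) = 1 :> R.
Proof.
have := @periodicn _ _ _ _ (@cosD2pi R) n 0; rewrite add0r cos0 => h.
by rewrite -[RHS]h mulr_natl [2 * pi]mulr_natl.
Qed.

Lemma sin_int2pi (n : int) : sin (n%:~R * (2 * pi)) = 0 :> R.
Proof.
case: n => n; first by rewrite -pmulrn sin_nat2pi.
by rewrite NegzE mulrNz mulNr sinN -pmulrn sin_nat2pi oppr0.
Qed.

Lemma cos_int2pi (n : int) : cos (n%:~R * (2 * pi)) = 1 :> R.
Proof.
case: n => n; first by rewrite -pmulrn cos_nat2pi.
by rewrite NegzE mulrNz mulNr cosN -pmulrn cos_nat2pi.
Qed.

Let pi2_ge0 : 0 <= 2 * pi :> R. Proof. by rewrite mulr_ge0 ?pi_ge0. Qed.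

Lemma Rintegral_cos_period (n : int) : n != 0 ->
  \int[leb]_(x in `[0, 2 * pi[) cos (n%:~R * x) = 0.
Proof.
move=> n0; have n0' : n%:~R != 0 :> R by rewrite intr_eq0.
rewrite Rintegral_itv_bndo_bndc; last first.
  by apply: integrableS (continuous_integrable_itv 0 (2 * pi) (continuous_cos_scale (a := _))) => //; exact: subset_itv_co_cc.
rewrite (Rintegral_FTC2 pi2_ge0 (fun x => is_derive_sin_scale x n0'))//.
  by rewrite sin_int2pi mulr0 mulr0 sin0 mulr0 subrr.
exact: continuous_cos_scale.
Qed.

Lemma Rintegral_sin_period (n : int) :
  \int[leb]_(x in `[0, 2 * pi[) sin (n%:~R * x) = 0.
Proof.
have [->|n0] := eqVneq n 0.
  by under eq_Rintegral do rewrite mul0r sin0; rewrite Rintegral_cst// mul0r.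
have n0' : n%:~R != 0 :> R by rewrite intr_eq0.
rewrite Rintegral_itv_bndo_bndc; last first.
  by apply: integrableS (continuous_integrable_itv 0 (2 * pi) (continuous_sin_scale (a := _))) => //; exact: subset_itv_co_cc.
rewrite (Rintegral_FTC2 pi2_ge0 (fun x => is_derive_cos_scale x n0'))//.
  by rewrite cos_int2pi mulr0 cos0 subrr.
exact: continuous_sin_scale.
Qed.

End continuous_integrals.

(** * Fourier coefficients and orthogonality of the modes *)

Section fourier_L2.
Context {R : realType}.
Local Notation leb := (@lebesgue_measure R).
Local Notation leb2 := (leb \x leb)%E.
Local Notation cell := (@cell R).
Local Notation plane := (measurableTypeR R * measurableTypeR R)%type.
Local Notation cmeas2 := (@cmeas R _ plane).
Local Notation circ := (`[0, 2 * pi[%classic : set R).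
Implicit Types (f g h : R * R -> R[i]) (k l : int * int) (x : R * R) (s : seq (int * int)).

Lemma measurable_cell : measurable (cell : set plane).
Proof. by apply: measurableX; exact: measurable_itv. Qed.
Local Hint Resolve measurable_cell : core.

Lemma leb_circ : leb circ = (2 * pi)%:E.
Proof.
rewrite lebesgue_measure_itv/= lte_fin mulr_gt0 ?pi_gt0//.
by rewrite -EFinB subr0.
Qed.

Lemma leb_circ_lty : (leb circ < +oo)%E.
Proof. by rewrite leb_circ ltry. Qed.

Lemma leb2_cell : leb2 cell = ((2 * pi) ^+ 2)%:E.
Proof. by rewrite product_measure1E//= leb_circ -EFinM expr2. Qed.

Lemma leb2_cell_lty : (leb2 cell < +oo)%E.
Proof. by rewrite leb2_cell ltry. Qed.

Lemma integrable_cell_bounded (u : plane -> R) (B : R) : measurable_fun setT u ->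
  (forall x, `|u x| <= B) -> leb2.-integrable cell (EFin \o u).
Proof.
move=> mu uB; apply: measurable_bounded_integrable => //.
- exact: leb2_cell_lty.
- exact: measurable_funTS.
- exists B; split; first exact: num_real.
  by move=> M BM x _ /=; rewrite (le_trans (uB x))// ltW.
Qed.

Lemma integrable_circ_bounded (u : R -> R) (B : R) : measurable_fun setT u ->
  (forall y, `|u y| <= B) -> leb.-integrable circ (EFin \o u).
Proof.
move=> mu uB; apply: measurable_bounded_integrable => //.
- exact: leb_circ_lty.
- exact: measurable_funTS.
- exists B; split; first exact: num_real.
  by move=> M BM x _ /=; rewrite (le_trans (uB x))// ltW.
Qed.

(** Fubini's theorem for the extensions by zero, which turn the cell into a product of full lines.
    The bound 1 provides integrability and fits the cosine and the sine. *)
Lemma Rintegral_cell_prod (u v : R -> R) :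
  measurable_fun setT u -> measurable_fun setT v ->
  (forall y, `|u y| <= 1) -> (forall y, `|v y| <= 1) ->
  \int[leb2]_(x in cell) (u x.1 * v x.2) =
  (\int[leb]_(y in circ) u y) * (\int[leb]_(y in circ) v y).
Proof.
move=> mu mv u1 v1.
have iu := integrable_circ_bounded mu u1.
have iv := integrable_circ_bounded mv v1.
have iuT : leb.-integrable setT (EFin \o (u \_ circ)).
  by rewrite -restrict_EFin -integrable_mkcond.
have ivT : leb.-integrable setT (EFin \o (v \_ circ)).
  by rewrite -restrict_EFin -integrable_mkcond.
have E : (fun x : R * R => (u x.1 * v x.2)%:E) \_ cell =
    (fun x => ((u \_ circ) x.1 * (v \_ circ) x.2)%:E).
  apply/funext => -[a b]; rewrite /patch /=.
  have [ac|ac] := boolP (a \in circ); have [bc|bc] := boolP (b \in circ).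
  - by rewrite mem_set//; split; exact/set_mem.
  - rewrite mulr0 memNset// => -[_ /=] bc'; move/negP: bc; apply; exact/mem_set.
  - rewrite mul0r memNset// => -[/= ac' _]; move/negP: ac; apply; exact/mem_set.
  - rewrite mul0r memNset// => -[/= ac' _]; move/negP: ac; apply; exact/mem_set.
have iuv : leb2.-integrable setT
    (fun x => ((u \_ circ) x.1 * (v \_ circ) x.2)%:E).
  rewrite -E -integrable_mkcond//.
  apply: (@integrable_cell_bounded (fun x => u x.1 * v x.2) 1).
    by apply: measurable_funM; exact: measurableT_comp.
  by move=> x; rewrite normrM mulr_ile1.
rewrite {1}/Rintegral integral_mkcond E -integral12_prod_meas1//.
rewrite /fubini_F /=.
under eq_integral do (under eq_integral do rewrite EFinM; rewrite integralZl//).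
have -> : (\int[leb]_y ((v \_ circ) y)%:E = (\int[leb]_(y in circ) v y)%:E)%E.
  rewrite Rintegral_mkcond /Rintegral fineK//.
  exact: integrable_fin_num.
rewrite integralZr// fineM//=; last exact: (integrable_fin_num _ iuT).
by rewrite [X in _ = X * _]Rintegral_mkcond.
Qed.

Definition ek k x : R[i] := cis (k.1%:~R * x.1 + k.2%:~R * x.2).

Definition trigp s (c : int * int -> R[i]) x : R[i] := \sum_(k <- s) c k * ek k x.

Lemma normc_ek k x : normc (ek k x) = 1.
Proof. exact: normc_cis. Qed.

Lemma ekB k l x : ek k x * conjc (ek l x) = ek (k - l) x.
Proof. by rewrite /ek -cisN -cisD /= !intrB; congr cis; ring. Qed.

Lemma cmeasT_cis (u : plane -> R) : measurable_fun setT u ->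
  cmeas2 setT (fun x => cis (u x)).
Proof.
move=> mu; split => /=; apply: measurableT_comp => //.
- exact: (continuous_measurable_fun (@continuous_cos R)).
- exact: (continuous_measurable_fun (@continuous_sin R)).
Qed.

Lemma cmeasT_ek k : cmeas2 setT (ek k).
Proof.
apply: cmeasT_cis; apply: measurable_funD; apply: measurable_funM => //.
Qed.

Lemma cmeasT_trigp s c : cmeas2 setT (trigp s c).
Proof.
apply: cmeas_sum => // k; apply: cmeasZ => //; exact: cmeasT_ek.
Qed.

Lemma cmeasTS f : cmeas2 setT f -> cmeas2 cell f.
Proof. by move=> [f1 f2]; split; exact: measurable_funTS. Qed.

Lemma cintble_ek k : cintble leb2 cell (ek k).
Proof.
apply: (@cintble_bound _ _ _ _ _ _ _ (cst 1)) => //.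
- by apply: cmeasTS; exact: cmeasT_ek.
- apply: (@integrable_cell_bounded (cst 1) 1); first exact: measurable_cst.
  by move=> x; rewrite normr1.
- by move=> x _; rewrite normc_ek.
Qed.

Lemma measurable_cosn (n : int) : measurable_fun setT (fun x : R => cos (n%:~R * x)).
Proof. by apply: continuous_measurable_fun; exact: continuous_cos_scale. Qed.

Lemma measurable_sinn (n : int) : measurable_fun setT (fun x : R => sin (n%:~R * x)).
Proof. by apply: continuous_measurable_fun; exact: continuous_sin_scale. Qed.

Lemma cintegral_ek k :
  cintegral leb2 cell (ek k) = if k == 0 then (((2 * pi) ^+ 2)%:C) else 0.
Proof.
have cc (a b : int) := Rintegral_cell_prod (measurable_cosn a) (measurable_cosn b)
  (fun=> cos_max _) (fun=> cos_max _).
have ss (a b : int) := Rintegral_cell_prod (measurable_sinn a) (measurable_sinn b)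
  (fun=> sin_max _) (fun=> sin_max _).
have sc (a b : int) := Rintegral_cell_prod (measurable_sinn a) (measurable_cosn b)
  (fun=> sin_max _) (fun=> cos_max _).
have cs (a b : int) := Rintegral_cell_prod (measurable_cosn a) (measurable_sinn b)
  (fun=> cos_max _) (fun=> sin_max _).
have icc (a b : int) : leb2.-integrable cell (EFin \o (fun x => cos (a%:~R * x.1) * cos (b%:~R * x.2))).
  apply: (@integrable_cell_bounded _ 1).
    exact: measurable_funM (measurableT_comp (measurable_cosn a) measurable_fst) (measurableT_comp (measurable_cosn b) measurable_snd).
  by move=> x; rewrite normrM mulr_ile1 ?cos_max.
have iss (a b : int) : leb2.-integrable cell (EFin \o (fun x => sin (a%:~R * x.1) * sin (b%:~R * x.2))).
  apply: (@integrable_cell_bounded _ 1).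
    exact: measurable_funM (measurableT_comp (measurable_sinn a) measurable_fst) (measurableT_comp (measurable_sinn b) measurable_snd).
  by move=> x; rewrite normrM mulr_ile1 ?sin_max.
have isc (a b : int) : leb2.-integrable cell (EFin \o (fun x => sin (a%:~R * x.1) * cos (b%:~R * x.2))).
  apply: (@integrable_cell_bounded _ 1).
    exact: measurable_funM (measurableT_comp (measurable_sinn a) measurable_fst) (measurableT_comp (measurable_cosn b) measurable_snd).
  by move=> x; rewrite normrM mulr_ile1 ?sin_max ?cos_max.
have ics (a b : int) : leb2.-integrable cell (EFin \o (fun x => cos (a%:~R * x.1) * sin (b%:~R * x.2))).
  apply: (@integrable_cell_bounded _ 1).
    exact: measurable_funM (measurableT_comp (measurable_cosn a) measurable_fst) (measurableT_comp (measurable_sinn b) measurable_snd).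
  by move=> x; rewrite normrM mulr_ile1 ?sin_max ?cos_max.
have RE : complex.Re (cintegral leb2 cell (ek k)) =
    (\int[leb]_(y in circ) cos (k.1%:~R * y)) * (\int[leb]_(y in circ) cos (k.2%:~R * y)).
  rewrite /=; under eq_Rintegral do rewrite cosD.
  by rewrite RintegralB// cc ss !Rintegral_sin_period mul0r subr0.
have IM : complex.Im (cintegral leb2 cell (ek k)) = 0.
  rewrite /=; under eq_Rintegral do rewrite sinD.
  by rewrite RintegralD// cs sc !Rintegral_sin_period mul0r mulr0 addr0.
apply: complexP; rewrite ?RE ?IM; last by case: ifP.
case: ifPn => [/eqP ->|k0] /=.
  under eq_Rintegral do rewrite mul0r cos0.
  by rewrite Rintegral_cst//= leb_circ /= mul1r expr2.
have [k1|k1] := eqVneq k.1 0; last by rewrite Rintegral_cos_period// mul0r.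
rewrite [X in _ * X]Rintegral_cos_period ?mulr0//.
by apply: contra k0 => /eqP k2; rewrite -pair_eqE /= k1 k2.
Qed.

Lemma fourierE f k : fourier f k =
  ((2 * pi) ^- 2)%:C * cintegral leb2 cell (fun x => f x * conjc (ek k x)).
Proof. by []. Qed.

Lemma cintble_mul_ek f k : cintble leb2 cell f ->
  cintble leb2 cell (fun x => f x * conjc (ek k x)).
Proof.
move=> fi; apply: (cintble_bound measurable_cell _ (cintble_normc measurable_cell fi)).
- apply: cmeasM => //; first exact: cintble_meas fi.
  by apply: cmeas_conj => //; apply: cmeasTS; exact: cmeasT_ek.
- by move=> x _; rewrite normcM normc_conjc normc_ek mulr1.
Qed.

Lemma fourierD f g k : cintble leb2 cell f -> cintble leb2 cell g ->
  fourier (fun x => f x + g x) k = fourier f k + fourier g k.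
Proof.
move=> fi gi; rewrite !fourierE -mulrDr -cintegralD//; [|exact: cintble_mul_ek..].
by congr (_ * _); apply: eq_cintegral => x _; rewrite mulrDl.
Qed.

Lemma fourierB f g k : cintble leb2 cell f -> cintble leb2 cell g ->
  fourier (fun x => f x - g x) k = fourier f k - fourier g k.
Proof.
move=> fi gi; rewrite !fourierE -mulrBr -cintegralB//; [|exact: cintble_mul_ek..].
by congr (_ * _); apply: eq_cintegral => x _; rewrite mulrBl.
Qed.

Lemma normc_fourier_le f k (B : R) : cmeas2 cell f ->
  (\int[leb2]_(x in cell) (normc (f x))%:E <= B%:E)%E ->
  normc (fourier f k) <= (2 * pi) ^- 2 * B.
Proof.
move=> mf fB; rewrite fourierE normcM normc_real ger0_norm; last first.
  by rewrite invr_ge0 sqr_ge0.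
rewrite ler_pM2l; last by rewrite invr_gt0 exprn_gt0// mulr_gt0// pi_gt0.
apply: normc_cintegral_le => //.
  apply: cmeasM => //; apply: cmeas_conj => //.
  by apply: cmeasTS; exact: cmeasT_ek.
under eq_integral do rewrite normcM normc_conjc normc_ek mulr1.
exact: fB.
Qed.

Lemma pi2_neq0 : (2 * pi) ^+ 2 != 0 :> R.
Proof. by rewrite expf_neq0// mulf_neq0// gt_eqF// pi_gt0. Qed.

Lemma fourier_trigp s c k : uniq s ->
  fourier (trigp s c) k = if k \in s then c k else 0.
Proof.
move=> us; rewrite fourierE.
have -> : cintegral leb2 cell (fun x => trigp s c x * conjc (ek k x)) =
    \sum_(l <- s) c l * cintegral leb2 cell (ek (l - k)).
  rewrite -[RHS](eq_bigr _ (fun l _ => cintegralZ measurable_cell (c l) (cintble_ek (l - k)))).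
  rewrite -cintegral_sum//.
    by apply: eq_cintegral => x _; rewrite /trigp mulr_suml; apply: eq_bigr => l _; rewrite -mulrA ekB.
  by move=> l; apply: cintbleZ => //; exact: cintble_ek.
under eq_bigr do rewrite cintegral_ek subr_eq0.
case: ifPn => ks.
  rewrite (bigD1_seq k)//= eqxx big1 ?addr0.
    by rewrite mulrCA -rmorphM /= mulVf ?pi2_neq0// mulr1.
  by move=> l /negbTE ->; rewrite mulr0.
rewrite big_seq big1 ?mulr0// => l ls.
by case: eqP => [E|_]; [move: ks; rewrite -E ls|rewrite mulr0].
Qed.

End fourier_L2.

(** * Square-integrable functions and Bessel's identity *)

Section square_integrable.
Context {R : realType}.
Local Notation leb := (@lebesgue_measure R).
Local Notation leb2 := (leb \x leb)%E.
Local Notation cell := (@cell R).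
Local Notation plane := (measurableTypeR R * measurableTypeR R)%type.
Local Notation cmeas2 := (@cmeas R _ plane).
Local Notation mcell := (@measurable_cell R).
Implicit Types (f g h : R * R -> R[i]) (k l : int * int) (x : R * R) (s : seq (int * int)).

Definition nint (p : nat) f : \bar R :=
  (\int[leb2]_(x in cell) ((normc (f x)) ^+ p)%:E)%E.

Definition sqint f := cmeas2 cell f /\ (nint 2 f < +oo)%E.

(** By the convention of [fine] this is 0 when the integral is infinite, so it carries information
    only under [sqint]. *)
Definition sq f : R := fine (nint 2 f).

Lemma nint_ge0 p f : (0 <= nint p f)%E.
Proof. by apply: integral_ge0 => x _; rewrite lee_fin exprn_ge0// normc_ge0. Qed.

Lemma sq_ge0 f : 0 <= sq f.
Proof. exact/fine_ge0/nint_ge0. Qed.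

Lemma nintE f : sqint f -> nint 2 f = (sq f)%:E.
Proof. by move=> [_ ff]; rewrite fineK// ge0_fin_numE// nint_ge0. Qed.

Lemma le_integral_cell (u v : plane -> R) :
  measurable_fun cell u -> measurable_fun cell v ->
  (forall x, cell x -> 0 <= u x <= v x) ->
  (\int[leb2]_(x in cell) (u x)%:E <= \int[leb2]_(x in cell) (v x)%:E)%E.
Proof.
move=> mu mv uv; apply: ge0_le_integral => //.
- exact: mcell.
- by move=> x /uv /andP[u0 _]; rewrite lee_fin.
- exact/measurable_EFinP.
- exact/measurable_EFinP.
- by move=> x /uv /andP[_ h]; rewrite lee_fin.
Qed.

Lemma integral_cellD (u v : plane -> R) :
  measurable_fun cell u -> measurable_fun cell v ->
  (forall x, cell x -> 0 <= u x) -> (forall x, cell x -> 0 <= v x) ->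
  (\int[leb2]_(x in cell) (u x + v x)%:E =
   \int[leb2]_(x in cell) (u x)%:E + \int[leb2]_(x in cell) (v x)%:E)%E.
Proof.
move=> mu mv u0 v0; under eq_integral do rewrite EFinD.
rewrite ge0_integralD//.
- exact: mcell.
- exact/measurable_EFinP.
- exact/measurable_EFinP.
Qed.

Lemma integral_cellZ (u : plane -> R) (c : R) : 0 <= c ->
  measurable_fun cell u -> (forall x, cell x -> 0 <= u x) ->
  (\int[leb2]_(x in cell) (c * u x)%:E = c%:E * \int[leb2]_(x in cell) (u x)%:E)%E.
Proof.
move=> c0 mu u0; under eq_integral do rewrite EFinM.
rewrite ge0_integralZl//.
- exact: mcell.
- exact/measurable_EFinP.
Qed.

Lemma integral_cell_cst (c : R) :
  (\int[leb2]_(x in cell) (cst c x)%:E = (c * (2 * pi) ^+ 2)%:E)%E.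
Proof.
rewrite (integral_cst (leb2 : {measure set plane -> \bar R}) mcell c%:E).
by rewrite EFinM -leb2_cell.
Qed.

Lemma nint2D_le f g : cmeas2 cell f -> cmeas2 cell g ->
  (nint 2 (fun x => f x + g x)%R <= 2%:E * nint 2 f + 2%:E * nint 2 g)%E.
Proof.
move=> mf mg; rewrite /nint -!integral_cellZ//; try exact: cmeas_normcX;
  try by move=> x _; rewrite sqr_ge0.
rewrite -integral_cellD//.
- apply: le_integral_cell.
  + by apply: cmeas_normcX; exact: cmeasD.
  + by apply: measurable_funD; apply: measurable_funM => //; exact: cmeas_normcX.
  + move=> x _; rewrite sqr_ge0 /=.
    have := normc_triangle (f x) (g x).
    have := normc_ge0 (f x + g x); have := normc_ge0 (f x); have := normc_ge0 (g x).
    have := sqr_ge0 (normc (f x) - normc (g x)); nra.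
- by apply: measurable_funM => //; exact: cmeas_normcX.
- by apply: measurable_funM => //; exact: cmeas_normcX.
- by move=> x _; rewrite mulr_ge0// sqr_ge0.
- by move=> x _; rewrite mulr_ge0// sqr_ge0.
Qed.

Lemma sqintD f g : sqint f -> sqint g -> sqint (fun x => f x + g x).
Proof.
move=> [mf ff] [mg gg]; split; first exact: cmeasD.
apply: (le_lt_trans (nint2D_le mf mg)).
by rewrite lte_add_pinfty// lte_mul_pinfty// nint_ge0.
Qed.

Lemma sqintN f : sqint f -> sqint (fun x => - f x).
Proof.
move=> [mf ff]; split; first exact: cmeasN.
by rewrite /nint; under eq_integral do rewrite normcN.
Qed.

Lemma sqintB f g : sqint f -> sqint g -> sqint (fun x => f x - g x).
Proof. by move=> sf sg; apply: sqintD => //; exact: sqintN. Qed.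

Lemma sqint_bounded f (B : R) : cmeas2 cell f -> (forall x, normc (f x) <= B) ->
  sqint f.
Proof.
move=> mf fB; split => //.
apply: (@le_lt_trans _ _ (\int[leb2]_(x in cell) (cst (B ^+ 2) x)%:E)%E).
  apply: le_integral_cell; [exact: cmeas_normcX|exact: measurable_cst|].
  move=> x _; rewrite sqr_ge0 /= lerXn2r ?nnegrE ?normc_ge0//.
  by rewrite (le_trans (normc_ge0 _) (fB x)).
by rewrite integral_cell_cst ltry.
Qed.

Lemma normc_trigp_le s c x : normc (trigp s c x) <= \sum_(k <- s) normc (c k).
Proof.
rewrite (le_trans (normc_sum _ _ _))//; apply: ler_sum => k _.
by rewrite normcM normc_ek mulr1.
Qed.

Lemma sqint_trigp s c : sqint (trigp s c : R * R -> R[i]).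
Proof.
apply: sqint_bounded (normc_trigp_le s c).
by apply: cmeasTS; exact: cmeasT_trigp.
Qed.

Lemma sqint_integrable f : sqint f ->
  leb2.-integrable cell (EFin \o (fun x => normc (f x) ^+ 2)).
Proof.
move=> [mf ff]; apply/integrableP; split; first exact: cmeas_EnormcX.
under eq_integral do rewrite /= ger0_norm ?sqr_ge0//.
exact: ff.
Qed.

Lemma sqint_cintble f : sqint f -> cintble leb2 cell f.
Proof.
move=> sf; have [mf _] := sf.
apply: (cintble_bound mcell mf (g := fun x => 1 + normc (f x) ^+ 2)).
  under [EFin \o _]eq_fun do rewrite /= EFinD.
  apply: integrableD; [exact: mcell| |].
    by apply: (@integrable_cell_bounded _ (cst 1) 1) => [|x]; [exact: measurable_cst|rewrite normr1].
  exact: sqint_integrable.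
by move=> x _; have := sqr_ge0 (normc (f x) - 1); have := normc_ge0 (f x); nra.
Qed.

Lemma cintble_mul f g : sqint f -> sqint g ->
  cintble leb2 cell (fun x => f x * conjc (g x)).
Proof.
move=> sf sg; have [mf _] := sf; have [mg _] := sg.
apply: (cintble_bound mcell _ (g := fun x => normc (f x) ^+ 2 + normc (g x) ^+ 2)).
- by apply: cmeasM => //; exact: cmeas_conj.
- under [EFin \o _]eq_fun do rewrite /= EFinD.
  by apply: integrableD; [exact: mcell|exact: sqint_integrable..].
- move=> x _; rewrite normcM normc_conjc.
  by have := sqr_ge0 (normc (f x) - normc (g x)); have := sqr_ge0 (normc (f x) + normc (g x)); nra.
Qed.

Lemma sqE f : sq f = \int[leb2]_(x in cell) (normc (f x) ^+ 2).
Proof. by []. Qed.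

Lemma sqB f g : sqint f -> sqint g -> sq (fun x => f x - g x) =
  sq f - complex.Re (cintegral leb2 cell (fun x => f x * conjc (g x))) *+ 2 + sq g.
Proof.
move=> sf sg; have [i1 i2] := cintble_mul sf sg.
have if2 := sqint_integrable sf; have ig2 := sqint_integrable sg.
rewrite !sqE; under eq_Rintegral do rewrite sqr_normcB -mulr_natl.
have i1' : leb2.-integrable cell (EFin \o (fun x => 2 * complex.Re (f x * conjc (g x)))).
  under [EFin \o _]eq_fun do rewrite /= EFinM.
  by apply: integrableZl => //; exact: mcell.
rewrite RintegralD//; [rewrite RintegralB//| |]; try exact: mcell.
  by rewrite RintegralZl//; [rewrite mulr_natl|exact: mcell].
under [EFin \o _]eq_fun do rewrite /= EFinB.
by apply: integrableB => //; exact: mcell.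
Qed.

Lemma cintegral_conjc_trigp f s c : cintble leb2 cell f ->
  cintegral leb2 cell (fun x => f x * conjc (trigp s c x)) =
  ((2 * pi) ^+ 2)%:C * \sum_(k <- s) conjc (c k) * fourier f k.
Proof.
move=> fi; rewrite mulr_sumr.
have E k : ((2 * pi) ^+ 2)%:C * (conjc (c k) * fourier f k) =
   cintegral leb2 cell (fun x => conjc (c k) * (f x * conjc (ek k x))).
  rewrite cintegralZ ?fourierE; [|exact: mcell|exact: cintble_mul_ek].
  rewrite mulrCA; congr (_ * _); rewrite mulrA -rmorphM /= divff ?mul1r//.
  exact: pi2_neq0.
under [RHS]eq_bigr do rewrite E.
rewrite -cintegral_sum; last first.
  - by move=> k; apply: cintbleZ; [exact: mcell|exact: cintble_mul_ek].
  - exact: mcell.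
apply: eq_cintegral => x _; rewrite /trigp rmorph_sum /= mulr_sumr.
by apply: eq_bigr => k _; rewrite rmorphM /=; ring.
Qed.

Lemma sq_conjc f : sqint f ->
  complex.Re (cintegral leb2 cell (fun x => f x * conjc (f x))) = sq f.
Proof. by move=> sf; rewrite sqE /=; apply: eq_Rintegral => x _; rewrite Re_mulc_conjc. Qed.

Lemma sum_conjc_mul s (c : int * int -> R[i]) : \sum_(k <- s) conjc (c k) * c k =
  (\sum_(k <- s) normc (c k) ^+ 2)%:C.
Proof. by rewrite rmorph_sum /=; apply: eq_bigr => k _; rewrite mulrC mulc_conjc. Qed.

Lemma sq_trigp s c : uniq s ->
  sq (trigp s c) = (2 * pi) ^+ 2 * \sum_(k <- s) normc (c k) ^+ 2.
Proof.
move=> us; have st := sqint_trigp s c; rewrite -sq_conjc//.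
rewrite cintegral_conjc_trigp; last exact: sqint_cintble.
rewrite (eq_big_seq (fun k => conjc (c k) * c k)).
  by rewrite sum_conjc_mul -rmorphM.
by move=> k ks; rewrite fourier_trigp// ks.
Qed.

(** The cross term of [sqB] is twice the norm of the partial sum, because that sum is the orthogonal
    projection. The equality, and not just Bessel's inequality, is what later yields Plancherel and
    the bound on tails. *)
Lemma bessel_identity f s : sqint f -> uniq s ->
  sq (fun x => f x - trigp s (fourier f) x) =
  sq f - (2 * pi) ^+ 2 * \sum_(k <- s) normc (fourier f k) ^+ 2.
Proof.
move=> sf us; rewrite sqB//; last exact: sqint_trigp.
rewrite sq_trigp// cintegral_conjc_trigp; last exact: sqint_cintble.
rewrite sum_conjc_mul -rmorphM /=; ring.
Qed.

Lemma bessel f s : sqint f -> uniq s ->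
  (2 * pi) ^+ 2 * \sum_(k <- s) normc (fourier f k) ^+ 2 <= sq f.
Proof. by move=> sf us; rewrite -subr_ge0 -bessel_identity// sq_ge0. Qed.

End square_integrable.

(** * Dominated convergence for complex integrands *)

Section complex_dominated_convergence.
Context {R : realType} d (X : measurableType d).
Context (mu : {measure set X -> \bar R}) (D : set X) (mD : measurable D).

Lemma cintegral_dominated_cvg (F : nat -> X -> R[i]) (f : X -> R[i]) (g : X -> R) :
  (forall n, cmeas D (F n)) -> cmeas D f ->
  {ae mu, forall x, D x -> (fun n => normc (F n x - f x)) @ \oo --> (0 : R)} ->
  mu.-integrable D (EFin \o g) ->
  (forall n x, D x -> normc (F n x) <= g x) ->
  (forall x, D x -> normc (f x) <= g x) ->
  (fun n => normc (cintegral mu D (F n) - cintegral mu D f)) @ \oo --> (0 : R).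
Proof.
move=> mF mf Ff ig Fg fg.
have iF n : cintble mu D (F n) by apply: (cintble_bound mD (mF n) ig) => x; exact: Fg.
have if_ : cintble mu D f by apply: (cintble_bound mD mf ig).
have mB n : cmeas D (fun x => F n x - f x) by apply: cmeasB.
have iB n : cintble mu D (fun x => F n x - f x).
  by under eq_fun do rewrite -mulN1r; apply: cintbleD => //; exact: cintbleZ.
pose h n (x : X) := (normc (F n x - f x))%:E.
have [|||||_ _ H] := @dominated_convergence _ _ _ mu D mD h (cst 0%E) (fun x => 2%:E * (g x)%:E)%E.
- by move=> n; apply/measurable_EFinP; exact: cmeas_normc.
- exact: measurable_cst.
- near=> x => Dx; apply: cvg_EFin; first by near=> n.
  by move: Dx; near: x.
- exact: integrableZl.
- near=> x => n Dx; rewrite /h /= lee_fin ger0_norm ?normc_ge0//.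
  by rewrite (le_trans (normcB_le _ _))// mulr2n mulrDl !mul1r lerD// (Fg, fg).
have {}H : (fun n => \int[mu]_(x in D) normc (F n x - f x)) @ \oo --> (0 : R).
  by rewrite integral0 in H; exact: (fine_cvg H).
apply: (squeeze_cvgr _ _ H); last exact: cvg_cst.
near=> n; apply/andP; split; first exact: normc_ge0.
by rewrite -cintegralB//; exact: normc_cintegral.
Unshelve. all: by end_near. Qed.

Lemma cintegral_dominated_cst (F : nat -> X -> R[i]) (f : X -> R[i]) (g : X -> R) z :
  (forall n, cmeas D (F n)) -> cmeas D f ->
  {ae mu, forall x, D x -> (fun n => normc (F n x - f x)) @ \oo --> (0 : R)} ->
  mu.-integrable D (EFin \o g) ->
  (forall n x, D x -> normc (F n x) <= g x) ->
  (forall x, D x -> normc (f x) <= g x) ->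
  (forall n, cintegral mu D (F n) = z) -> cintegral mu D f = z.
Proof.
move=> mF mf Ff ig Fg fg Fz.
have := cintegral_dominated_cvg mF mf Ff ig Fg fg.
under eq_fun do rewrite Fz.
move=> h; have : normc (z - cintegral mu D f) = 0 by exact: (cvg_unique _ (cvg_cst _) h).
by move/eq0_normc/eqP; rewrite subr_eq0 eq_sym => /eqP.
Qed.

End complex_dominated_convergence.

(** * Trigonometric approximation of the indicator of an arc *)

Section steps.
Context {R : realType}.
Implicit Types y t a b : R.

Lemma bernoulli_ge y n : 0 <= y <= 1 -> 1 - n%:R * y <= (1 - y) ^+ n.
Proof.
move=> /andP[y0 y1]; elim: n => [|n ih]; first by rewrite mul0r subr0.
rewrite exprSr; apply: (@le_trans _ _ ((1 - n%:R * y) * (1 - y))).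
  rewrite -natr1 mulrDl mul1r.
  have : 0 <= n%:R * y * y by rewrite !mulr_ge0.
  by lra.
by rewrite ler_wpM2r// subr_ge0.
Qed.

Lemma bernoulli_ge_add y n : 0 <= y -> 1 + n%:R * y <= (1 + y) ^+ n.
Proof.
move=> y0; elim: n => [|n ih]; first by rewrite mul0r addr0.
rewrite exprSr; apply: (@le_trans _ _ ((1 + n%:R * y) * (1 + y))).
  rewrite -natr1 mulrDl mul1r.
  have : 0 <= n%:R * y * y by rewrite !mulr_ge0.
  by lra.
by rewrite ler_wpM2r// addr_ge0.
Qed.

Definition sharpen (n : nat) y : R := 1 - (1 - y ^+ n) ^+ (2 ^ n).

Lemma sharpen_itv n y : 0 <= y <= 1 -> 0 <= sharpen n y <= 1.
Proof.
move=> /andP[y0 y1]; have yn : 0 <= 1 - y ^+ n <= 1.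
  by rewrite subr_ge0 exprn_ile1//= lerBlDr lerDl exprn_ge0.
case/andP: yn => h0 h1; rewrite /sharpen subr_ge0 exprn_ile1//=.
by rewrite lerBlDr lerDl exprn_ge0.
Qed.

(* The Brosowski-Deutsch polynomials [(1 - y^n)^(2^n)] have a sharp threshold at 1/2. *)
Lemma sharpen_cvg y : 0 <= y <= 1 -> y != 1 / 2 ->
  sharpen ^~ y @ \oo --> (if 1 / 2 < y then 1 else 0 : R).
Proof.
move=> /andP[y0 y1] y2.
have yn n : 0 <= y ^+ n <= 1 by rewrite exprn_ge0//= exprn_ile1.
have [ly|ly] := ltrP.
  have iy : `|(2 * y)^-1| < 1.
    rewrite ger0_norm ?invr_ge0 ?mulr_ge0// invf_lt1; first by lra.
    by lra.
  have h : (fun n => 1 - (2 * y)^-1 ^+ n) @ \oo --> (1 : R).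
    by rewrite -[X in _ --> X]subr0; apply: cvgB; [exact: cvg_cst|exact: cvg_expr].
  apply: (squeeze_cvgr _ h (cvg_cst (1 : R))).
  near=> n; have /andP[_ ->] : 0 <= sharpen n y <= 1 by apply: sharpen_itv; rewrite y0.
  rewrite andbT.
  rewrite /sharpen lerB// exprVn; set z := y ^+ n.
  have z01 := yn n; rewrite -/z in z01; case/andP: z01 => z0 z1.
  (* As (1 - z)(1 + z) <= 1, Bernoulli's inequality bounds (1 - z)^(2^n) by the inverse of 1 + 2^n
     z, hence by (2y)^(-n). *)
  have P0 : 0 < 1 + (2 ^ n)%:R * z by rewrite ltr_pwDl// mulr_ge0.
  apply: (@le_trans _ _ (1 + (2 ^ n)%:R * z)^-1).
    rewrite -[leRHS]mul1r ler_pdivlMr//.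
    apply: (@le_trans _ _ ((1 - z) ^+ (2 ^ n) * (1 + z) ^+ (2 ^ n))).
      rewrite ler_wpM2l ?exprn_ge0 ?subr_ge0//; exact: bernoulli_ge_add.
    rewrite -exprMn exprn_ile1//; first by rewrite mulr_ge0 ?subr_ge0 ?addr_ge0.
    by rewrite -subr_sqr expr1n lerBlDr lerDl sqr_ge0.
  rewrite exprMn -natrX lef_pV2 ?posrE//; first by rewrite lerDr.
  by rewrite mulr_gt0 ?ltr0n ?expn_gt0// exprn_gt0//; lra.
have {}ly : y < 1 / 2 by rewrite lt_neqAle y2 ly.
have iy : `|2 * y| < 1 by rewrite ger0_norm ?mulr_ge0//; lra.
apply: (squeeze_cvgr _ (cvg_cst (0 : R)) (cvg_expr iy)).
near=> n; have /andP[-> _] : 0 <= sharpen n y <= 1 by apply: sharpen_itv; rewrite y0.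
rewrite /=.
have := bernoulli_ge (2 ^ n) (yn n).
by rewrite /sharpen exprMn -natrX; lra.
Unshelve. all: by end_near. Qed.

(** A cosine centred at the midpoint of the arc and shifted to take the value 1/2, the threshold of
    [sharpen], at both ends; inside the arc it is larger. The division by 4 keeps the values in
    [0, 1]. *)
Definition arcfun (a b t : R) : R :=
  1 / 2 + (cos (t - (a + b) / 2) - cos ((b - a) / 2)) / 4.

Lemma arcfun_itv a b t : 0 <= arcfun a b t <= 1.
Proof.
rewrite /arcfun; have := cos_le1 (t - (a + b) / 2); have := cos_geN1 (t - (a + b) / 2).
have := cos_le1 ((b - a) / 2); have := cos_geN1 ((b - a) / 2); lra.
Qed.

Lemma arcfun_half a b t : 0 <= a -> a < b -> b <= 2 * pi -> 0 < t -> t < 2 * pi ->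
  t != a -> t != b ->
  arcfun a b t != 1 / 2 /\ (1 / 2 < arcfun a b t) = (a < t < b).
Proof.
move=> a0 ab b2 t0 t2 ta tb.
have pi0 := pi_gt0 R.
rewrite /arcfun -(cos_norm (t - _)); set r := `|_|; set e := (b - a) / 2.
have re : (r < e) = (a < t < b).
  by rewrite /r /e ltr_norml; apply/idP/idP => /andP[? ?]; apply/andP; split; lra.
have rne : r != e.
  rewrite /r /e; apply/eqP => E; move: ta tb.
  have [h|h] := ger0P (t - (a + b) / 2).
    by rewrite ger0_norm// in E => _ /eqP; apply; lra.
  by rewrite ltr0_norm// in E => /eqP + _; apply; lra.
have e0 : 0 < e by rewrite /e; lra.
have epi : e <= pi by rewrite /e; lra.
have r0 : 0 <= r by rewrite /r.
have main : cos r != cos e /\ (cos e < cos r) = (r < e).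
  have [rpi|rpi] := lerP r pi.
    have ri : r \in `[0, pi] by rewrite in_itv/= r0 rpi.
    have ei : e \in `[0, pi] by rewrite in_itv/= (ltW e0) epi.
    rewrite ltr_cos//; split => //.
    by apply: contra rne => /eqP /(cos_inj ri ei) ->.
  (* Beyond pi the angle is reflected into [0, pi], where the cosine is decreasing; the reflected
     angle still exceeds [e] because both t and the arc lie within one period. *)
  have -> : cos r = cos (2 * pi - r).
    have := cosD2pi (- r); rewrite /periodic cosN => <-.
    by rewrite mulr_natl addrC.
  have re2 : e < 2 * pi - r.
    suff : r < 2 * pi - e by lra.
    by rewrite /r /e ltr_norml; apply/andP; split; lra.
  have ri : 2 * pi - r \in `[0, pi] by rewrite in_itv/=; apply/andP; split; lra.
  have ei : e \in `[0, pi] by rewrite in_itv/= (ltW e0) epi.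
  have h : cos (2 * pi - r) < cos e by rewrite ltr_cos.
  split; first by rewrite lt_eqF.
  by rewrite ltNge (ltW h) /= ltNge (le_trans epi (ltW rpi)).
case: main => n1 n2; rewrite -re -n2; split.
  by apply: contra n1 => /eqP E; apply/eqP; lra.
by apply/idP/idP; lra.
Qed.

End steps.

(** * An integrable function with vanishing Fourier coefficients vanishes almost everywhere *)

Section fourier_uniqueness.
Context {R : realType}.
Local Notation leb := (@lebesgue_measure R).
Local Notation leb2 := (leb \x leb)%E.
Local Notation cell := (@cell R).
Local Notation plane := (measurableTypeR R * measurableTypeR R)%type.
Local Notation cmeas2 := (@cmeas R _ plane).
Local Notation mcell := (@measurable_cell R).
Implicit Types (f g h p q : R * R -> R[i]) (k l : int * int) (x : R * R).

(** Trigonometric polynomials as an inductive closure instead of coefficient lists: closure under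
    products, and the vanishing of integrals against a function without Fourier coefficients, become
    inductions. *)
Inductive tpoly : (R * R -> R[i]) -> Prop :=
| tpoly_ek k : tpoly (ek k)
| tpolyD p q : tpoly p -> tpoly q -> tpoly (fun x => p x + q x)
| tpolyZ z p : tpoly p -> tpoly (fun x => z * p x).

Lemma ekD k l x : ek k x * ek l x = ek (k + l) x :> R[i].
Proof. by rewrite /ek -cisD /= !intrD; congr cis; ring. Qed.

Lemma ek0 x : ek 0 x = 1 :> R[i].
Proof. by rewrite /ek /= !mul0r addr0 cis0. Qed.

Lemma tpoly_cst z : tpoly (fun=> z).
Proof.
rewrite (_ : (fun=> z) = (fun x => z * ek 0 x)); first by apply/tpolyZ/tpoly_ek.
by apply/funext => x; rewrite ek0 mulr1.
Qed.

Lemma tpolyM p q : tpoly p -> tpoly q -> tpoly (fun x => p x * q x).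
Proof.
move=> tp; elim: tp q => {p} [k|p1 p2 _ ih1 _ ih2|z p _ ih] q tq.
- elim: tq => {q} [l|q1 q2 _ ih1 _ ih2|z q _ ih].
  + by rewrite (_ : (fun x => _) = ek (k + l)); [exact: tpoly_ek|apply/funext => x; rewrite ekD].
  + rewrite (_ : (fun x => _) = (fun x => ek k x * q1 x + ek k x * q2 x)); first exact: tpolyD.
    by apply/funext => x; rewrite mulrDr.
  + rewrite (_ : (fun x => _) = (fun x => z * (ek k x * q x))); first exact: tpolyZ.
    by apply/funext => x; rewrite mulrCA.
- rewrite (_ : (fun x => _) = (fun x => p1 x * q x + p2 x * q x)).
    by apply: tpolyD; [exact: ih1|exact: ih2].
  by apply/funext => x; rewrite mulrDl.
- rewrite (_ : (fun x => _) = (fun x => z * (p x * q x))); first by apply: tpolyZ; exact: ih.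
  by apply/funext => x; rewrite mulrA.
Qed.

Lemma tpolyX p n : tpoly p -> tpoly (fun x => p x ^+ n).
Proof.
move=> tp; elim: n => [|n ih]; first by under eq_fun do rewrite expr0; exact: tpoly_cst.
by under eq_fun do rewrite exprS; exact: tpolyM.
Qed.

Lemma tpolyB p q : tpoly p -> tpoly q -> tpoly (fun x => p x - q x).
Proof.
move=> tp tq; rewrite (_ : (fun x => _) = (fun x => p x + -1 * q x)).
  by apply: tpolyD => //; exact: tpolyZ.
by apply/funext => x; rewrite mulN1r.
Qed.

Lemma tpoly_arcfun1 a b : tpoly (fun x => (arcfun a b x.1)%:C).
Proof.
set c := (a + b) / 2.
(* The coefficient 1/8 is the 1/4 of [arcfun] times the 1/2 of Euler's formula. *)
rewrite (_ : (fun x => _) = (fun x => (1 / 2 - cos ((b - a) / 2) / 4)%:C +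
  ((8^-1)%:C * cis (- c) * ek (1, 0) x + (8^-1)%:C * cis c * ek (-1, 0) x))).
  by apply: tpolyD; [exact: tpoly_cst|apply: tpolyD; apply/tpolyZ/tpoly_ek].
apply/funext => x; rewrite /arcfun -/c /ek -!mulrA -!cisD [LHS]/= [in RHS]/= ?(mulr0z, mulr1z, mulrNz).
rewrite !mul0r !addr0 mulN1r ?[1 * x.1]mul1r.
by apply: complexP; rewrite /= ?mul1r !(cosD, sinD, cosN, sinN); field.
Qed.

Lemma tpoly_arcfun2 a b : tpoly (fun x => (arcfun a b x.2)%:C).
Proof.
set c := (a + b) / 2.
rewrite (_ : (fun x => _) = (fun x => (1 / 2 - cos ((b - a) / 2) / 4)%:C +
  ((8^-1)%:C * cis (- c) * ek (0, 1) x + (8^-1)%:C * cis c * ek (0, -1) x))).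
  by apply: tpolyD; [exact: tpoly_cst|apply: tpolyD; apply/tpolyZ/tpoly_ek].
apply/funext => x; rewrite /arcfun -/c /ek -!mulrA -!cisD /=.
rewrite !mul0r !add0r mulN1r ?[1 * x.2]mul1r.
by apply: complexP; rewrite /= !(cosD, sinD, cosN, sinN); field.
Qed.

Lemma tpoly_sharpen n (u : R * R -> R) : tpoly (fun x => (u x)%:C) ->
  tpoly (fun x => (sharpen n (u x))%:C).
Proof.
move=> tu; rewrite (_ : (fun x => _) = (fun x => 1 - (1 - (u x)%:C ^+ n) ^+ (2 ^ n))).
  by apply: tpolyB; [exact: tpoly_cst|apply/tpolyX/tpolyB; [exact: tpoly_cst|exact: tpolyX]].
by apply/funext => x; rewrite /sharpen !(rmorphB, rmorphXn, rmorph1).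
Qed.

Lemma cmeas_tpoly p : tpoly p -> cmeas2 setT p.
Proof.
elim=> [k|{}p q _ mp _ mq|z {}p _ mp]; [exact: cmeasT_ek|exact: cmeasD|exact: cmeasZ].
Qed.

Lemma cintegral_tpoly f p : cintble leb2 cell f -> (forall k, fourier f k = 0) ->
  tpoly p ->
  cintble leb2 cell (fun x => f x * p x) /\ cintegral leb2 cell (fun x => f x * p x) = 0.
Proof.
move=> fi f0; elim=> [k|{}p q _ [ip p0] _ [iq q0]|z {}p _ [ip p0]].
- have E : (fun x => f x * ek k x) = (fun x => f x * conjc (ek (- k) x)).
    by apply/funext => x; rewrite /ek -cisN /= !intrN; congr (_ * cis _); ring.
  rewrite E; split; first exact: cintble_mul_ek.
  have /eqP := f0 (- k); rewrite fourierE mulf_eq0 => /orP[|/eqP//].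
  rewrite -(rmorph0 (real_complex R)) => /eqP/(@complexI R)/eqP.
  by rewrite invr_eq0 (negbTE (@pi2_neq0 R)).
- under eq_fun do rewrite mulrDr; split; first by apply: cintbleD => //; exact: mcell.
  by rewrite cintegralD ?p0 ?q0 ?addr0//; exact: mcell.
- under eq_fun do rewrite mulrCA; split; first by apply: cintbleZ => //; exact: mcell.
  by rewrite cintegralZ ?p0 ?mulr0//; exact: mcell.
Qed.

Lemma negligible_line1 (a : R) : leb2.-negligible [set x : plane | x.1 = a].
Proof.
exists ([set a] `*` setT); split.
- by apply: measurableX => //; exact: measurable_set1.
- by rewrite product_measure1E//= ?lebesgue_measure_set1 ?mul0e//; exact: measurable_set1.
- by move=> [u v] /= ->.
Qed.

Lemma negligible_line2 (a : R) : leb2.-negligible [set x : plane | x.2 = a].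
Proof.
exists (setT `*` [set a]); split.
- by apply: measurableX => //; exact: measurable_set1.
- by rewrite product_measure1E//= ?lebesgue_measure_set1 ?mule0//; exact: measurable_set1.
- by move=> [u v] /= ->.
Qed.

(** The excluded lines carry the edges of a rectangle, where [arcfun] sits at the threshold 1/2, and
    the sides at coordinate 0 of the cell, which [arcfun_half] does not cover. *)
Lemma ae_off_lines (a b c d : R) :
  {ae leb2, forall x : plane, [/\ x.1 != 0, x.1 != a & x.1 != b] /\
                              [/\ x.2 != 0, x.2 != c & x.2 != d]}.
Proof.
have L1 e : {ae leb2, forall x : plane, x.1 != e}.
  by apply: negligibleS (negligible_line1 e) => x /= /negP; rewrite negbK => /eqP.
have L2 e : {ae leb2, forall x : plane, x.2 != e}.
  by apply: negligibleS (negligible_line2 e) => x /= /negP; rewrite negbK => /eqP.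
near=> x; split; split; near: x; by [exact: L1|exact: L2].
Unshelve. all: by end_near. Qed.

(** Products of two sharpened arc functions are trigonometric polynomials, so their integrals
    against f vanish; they stay in [0, 1] and converge almost everywhere on the cell to the
    indicator of the rectangle. *)
Lemma cintegral_rect f (u v w z : R) : cintble leb2 cell f ->
  (forall k, fourier f k = 0) ->
  cintegral leb2 cell (fun x => f x * (\1_(`]u, v[ `*` `]w, z[) x)%:C) = 0.
Proof.
move=> fi f0.
(* The rectangle is clipped to one period, as [arcfun_half] requires; if nothing is left, the
   integrand vanishes on the cell. *)
pose a := Num.max 0 u; pose b := Num.min (2 * pi) v.
pose c := Num.max 0 w; pose d := Num.min (2 * pi) z.
have abE t : 0 <= t < 2 * pi -> (u < t < v) -> a <= t < b.
  by move=> /andP[t0 t2] /andP[ut tv]; rewrite /a /b ge_max lt_min t0 t2 tv (ltW ut).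
have cdE t : 0 <= t < 2 * pi -> (w < t < z) -> c <= t < d.
  by move=> /andP[t0 t2] /andP[ut tv]; rewrite /c /d ge_max lt_min t0 t2 tv (ltW ut).
have [/andP[ab cd]|] := boolP ((a < b) && (c < d)); last first.
  move=> abcd; rewrite (@eq_cintegral _ _ _ _ _ _ (fun=> 0)).
    by apply: complexP; rewrite /= Rintegral_cst ?mul0r//; exact: mcell.
  move=> x /set_mem[/= x1 x2]; rewrite indicE memNset ?mulr0// => -[/= x1' x2'].
  move: x1 x2 x1' x2'; rewrite !in_itv/= => x1 x2 x1' x2'.
  have /andP[h1 h2] := abE _ x1 x1'; have /andP[h3 h4] := cdE _ x2 x2'.
  by move: abcd; rewrite (le_lt_trans h1 h2) (le_lt_trans h3 h4).
have a0 : 0 <= a by rewrite /a le_max lexx.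
have c0 : 0 <= c by rewrite /c le_max lexx.
have b2 : b <= 2 * pi by rewrite /b ge_min lexx.
have d2 : d <= 2 * pi by rewrite /d ge_min lexx.
pose F n x := f x * (((sharpen n (arcfun a b x.1))%:C) * ((sharpen n (arcfun c d x.2))%:C)).
have mf := cintble_meas fi.
have tF n : tpoly (fun x => (sharpen n (arcfun a b x.1))%:C * (sharpen n (arcfun c d x.2))%:C).
  by apply: tpolyM; apply: tpoly_sharpen; [exact: tpoly_arcfun1|exact: tpoly_arcfun2].
apply: (@cintegral_dominated_cst _ _ _ leb2 _ mcell F _ (fun x => normc (f x)) 0).
- by move=> n; apply: cmeasM => //; apply/cmeasTS/cmeas_tpoly.
- apply: cmeasM => //; apply: cmeas_real.
  by apply: measurable_funTS; apply: measurable_indic; apply: measurableX; exact: measurable_itv.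
- have := ae_off_lines a b c d; apply: filterS => x [[x10 x1a x1b] [x20 x2c x2d]] [/= x1 x2].
  move: x1 x2; rewrite !in_itv/= => /andP[x1p x1q] /andP[x2p x2q].
  have [n1 e1] := @arcfun_half _ a b x.1 a0 ab b2 ltac:(by rewrite lt_neqAle eq_sym x10) x1q x1a x1b.
  have [n2 e2] := @arcfun_half _ c d x.2 c0 cd d2 ltac:(by rewrite lt_neqAle eq_sym x20) x2q x2c x2d.
  have {}e1 : (1 / 2 < arcfun a b x.1) = (u < x.1 < v).
    by rewrite e1 /a /b gt_max lt_min (lt_neqAle 0) eq_sym x10 x1p x1q.
  have {}e2 : (1 / 2 < arcfun c d x.2) = (w < x.2 < z).
    by rewrite e2 /c /d gt_max lt_min (lt_neqAle 0) eq_sym x20 x2p x2q.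
  have c1 := sharpen_cvg (arcfun_itv a b x.1) n1.
  have c2 := sharpen_cvg (arcfun_itv c d x.2) n2.
  have E : (\1_(`]u, v[ `*` `]w, z[) x : R) =
      (if u < x.1 < v then 1 else 0) * (if w < x.2 < z then 1 else 0).
    rewrite indicE; case: x {x10 x1a x1b x20 x2c x2d x1p x1q x2p x2q n1 n2 e1 e2 c1 c2} => t t' /=.
    have [h|/negP h] := boolP (u < t < v); have [h'|/negP h'] := boolP (w < t' < z);
      rewrite ?mulr1 ?mulr0 ?mul0r.
    + by rewrite mem_set//=; split; rewrite /= in_itv.
    + by rewrite memNset//= => -[_ /=]; rewrite in_itv.
    + by rewrite memNset//= => -[/=]; rewrite in_itv.
    + by rewrite memNset//= => -[/=]; rewrite in_itv.
  have c12 : (fun n => sharpen n (arcfun a b x.1) * sharpen n (arcfun c d x.2)) @ \oo -->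
      (\1_(`]u, v[ `*` `]w, z[) x : R) by rewrite E -e1 -e2; exact: cvgM.
  have : (fun n => normc (f x) * `|sharpen n (arcfun a b x.1) * sharpen n (arcfun c d x.2) -
      \1_(`]u, v[ `*` `]w, z[) x|) @ \oo -->
      normc (f x) * `|\1_(`]u, v[ `*` `]w, z[) x - \1_(`]u, v[ `*` `]w, z[) x : R|.
    apply: cvgM; first exact: cvg_cst.
    by apply: cvg_norm; apply: cvgB => //; exact: cvg_cst.
  rewrite subrr normr0 mulr0; apply: cvg_trans; apply: near_eq_cvg.
  by near=> n; rewrite /F -rmorphM -mulrBr normcM -rmorphB normc_real.
- exact: (cintble_normc mcell fi).
- move=> n x _; rewrite normcM ler_piMr ?normc_ge0// -rmorphM normc_real.
  have /andP[p0 p1] := sharpen_itv n (arcfun_itv a b x.1).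
  have /andP[q0 q1] := sharpen_itv n (arcfun_itv c d x.2).
  by rewrite ger0_norm ?mulr_ge0// mulr_ile1.
- move=> x _; rewrite normcM ler_piMr ?normc_ge0// normc_real indicE.
  by case: (_ \in _); rewrite ?normr1 ?normr0.
- by move=> n; have [] := cintegral_tpoly fi f0 (tF n).
Unshelve. all: by end_near. Qed.

Definition open_rects : set (set plane) :=
  [set A | exists a b c d : R, A = `]a, b[ `*` `]c, d[].

Lemma setI_closed_open_rects : setI_closed open_rects.
Proof.
move=> _ _ [a [b [c [d ->]]]] [a' [b' [c' [d' ->]]]].
exists (Num.max a a'), (Num.min b b'), (Num.max c c'), (Num.min d d').
apply/seteqP; split => -[u v] /=; rewrite !in_itv/=.
  by move=> [[/andP[? ?] /andP[? ?]] [/andP[? ?] /andP[? ?]]]; rewrite !gt_max !lt_min;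
    split; apply/andP; split; apply/andP; split.
by rewrite !gt_max !lt_min => -[/andP[/andP[? ?] /andP[? ?]] /andP[/andP[? ?] /andP[? ?]]];
  split; split; apply/andP; split.
Qed.

(** Bounded open rectangles form a pi-system, and a strip over an open interval is a countable union
    of them; this is the generator needed for Dynkin's argument. *)
Lemma measurable_open_rects : @measurable _ plane = <<s open_rects >>.
Proof.
rewrite measurable_prod_measurableType; apply/seteqP; split.
  apply: smallest_sub; first exact: smallest_sigma_algebra.
  move=> _ [A mA [B mB <-]].
  pose GT := g_sigma_algebraType open_rects.
  have -> : A `*` B = (fst @^-1` A) `&` (snd @^-1` B) :> set plane by [].
  have rect a b c d : (@measurable _ GT) (`]a, b[ `*` `]c, d[).
    by apply: sub_sigma_algebra; exists a, b, c, d.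
  have cov (u : R) : exists n : nat, (- n%:R < u < n%:R).
    exists (Num.truncn `|u|).+1; have := truncnS_gt `|u|.
    by rewrite ltr_norml.
  have m1 : measurable_fun (setT : set GT) (fst : GT -> measurableTypeR R).
    apply: (measurability _ (RGenOpens.measurableE R)).
    move=> _ [_ [a [b ->]] <-]; rewrite setTI.
    rewrite (_ : _ @^-1` _ = \bigcup_n (`]a, b[ `*` `](- n%:R), n%:R[)).
      by apply: bigcupT_measurable => n; exact: rect.
    apply/seteqP; split => -[u v] /=.
      by have [n vn] := cov v; exists n => //=; split => //=; rewrite in_itv.
    by move=> [n _ []].
  have m2 : measurable_fun (setT : set GT) (snd : GT -> measurableTypeR R).
    apply: (measurability _ (RGenOpens.measurableE R)).
    move=> _ [_ [a [b ->]] <-]; rewrite setTI.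
    rewrite (_ : _ @^-1` _ = \bigcup_n (`](- n%:R), n%:R[ `*` `]a, b[)).
      by apply: bigcupT_measurable => n; exact: rect.
    apply/seteqP; split => -[u v] /=.
      by have [n vn] := cov u; exists n => //=; split => //=; rewrite in_itv.
    by move=> [n _ []].
  have := @measurableI _ GT _ _ (m1 measurableT _ mA) (m2 measurableT _ mB).
  by rewrite !setTI.
rewrite -measurable_prod_measurableType.
apply: smallest_sub; first exact: sigma_algebra_measurable.
by move=> _ [a [b [c [d ->]]]]; apply: measurableX; exact: measurable_itv.
Qed.

(** Integrals over open rectangles vanish by [cintegral_rect]. For the real and the imaginary part
    separately, the sets with vanishing integral form a lambda-system, so every measurable set has
    this property. Assuming integrability only allows f to be compared with a pointwise limit in
    [psum_cvg_ae]. *)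
Lemma fourier_uniqueness f : cintble leb2 cell f ->
  (forall k, fourier f k = 0) -> torus_eq f (fun=> 0).
Proof.
move=> fi f0.
have real_part (h : plane -> R) : leb2.-integrable cell (EFin \o h) ->
    (forall a b c d, \int[leb2]_(x in cell) (h x * \1_(`]a, b[ `*` `]c, d[) x) = 0) ->
    {ae leb2, forall x : plane, cell x -> h x = 0}.
  move=> hi h0.
  have mh := measurable_int _ hi.
  have sub S : measurable S -> leb2.-integrable (cell `&` S) (EFin \o h).
    move=> mS; apply: integrableS hi => //; first exact: mcell.
    by apply: measurableI => //; exact: mcell.
  have hf S : measurable S -> (\int[leb2]_(x in cell `&` S) (h x)%:E)%E \is a fin_num.
    move=> mS; apply: (integrable_fin_num _ (sub _ mS)).
    by apply: measurableI => //; exact: mcell.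
  pose P (S : set plane) := (\int[leb2]_(x in cell `&` S) (h x)%:E = 0)%E.
  have PG A : open_rects A -> P A.
    move=> [a [b [c [d ->]]]]; rewrite /P -[LHS]fineK; last first.
      by apply: hf; apply: measurableX; exact: measurable_itv.
    rewrite -/(Rintegral leb2 _ h) Rintegral_mkcondr.
    congr (_%:E); rewrite -[RHS](h0 a b c d); apply: eq_Rintegral => x _.
    by rewrite /patch indicE; case: ifP => _ /=; rewrite ?mulr1 ?mulr0.
  (* The cell lies inside an open square, so the whole plane is covered by the case of a
     rectangle. *)
  have PT : P setT.
    have := PG (`](- 1 : R), 2 * pi + 1[ `*` `](- 1 : R), 2 * pi + 1[).
    rewrite /P setIT setIidl; first by apply; do 4 eexists.
    by move=> [u v] [/=]; rewrite !in_itv/= => /andP[? ?] /andP[? ?]; split;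
      rewrite /= ?in_itv/=; apply/andP; split; lra.
  have H S : measurable S -> P S.
    move=> mS; apply: (dynkin_induction measurable_open_rects setI_closed_open_rects PT PG).
    - move=> A mA PA; have := PT; rewrite /P -(setUv A) setIUr.
      rewrite integral_setU//; last 4 first.
      + by apply: measurableI => //; exact: mcell.
      + by apply: measurableI; [exact: mcell|exact: measurableC].
      + rewrite -setIUr setUv setIT; exact: mh.
      + by apply/disj_setPS => x [[_ ?] [_ ?]].
      by rewrite [X in (X + _)%E]PA add0e.
    - move=> F mF tF PF; rewrite /P setI_bigcupr integral_bigcup//.
      + by rewrite eseries0// => i _ _; exact: PF.
      + apply/trivIsetP => i j _ _ ij; move/trivIsetP : tF => /(_ i j I I ij) E.
        by rewrite setIACA E setI0.
      + by move=> k; apply: measurableI => //; exact: mcell.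
      + by rewrite -setI_bigcupr; apply: sub; exact: bigcupT_measurable.
    - by rewrite -measurable_open_rects.
  have := @integral_ae_eq _ _ _ leb2 _ mcell (cst 0%E) (EFin \o h) hi (measurable_cst _).
  move=> /(_ _)/wrap[E Ec mE|].
    by rewrite integral0 -(setIidr Ec); exact: H.
  by apply: filterS => x hx cx; have [] := hx cx.
have [f1 f2] := fi.
have rect a b c d := cintegral_rect a b c d fi f0.
have R0 : {ae leb2, forall x : plane, cell x -> complex.Re (f x) = 0}.
  apply: real_part => // a b c d; have := congr1 (@complex.Re R) (rect a b c d).
  by rewrite /=; under eq_Rintegral do rewrite ReM /= mulr0 subr0.
have I0 : {ae leb2, forall x : plane, cell x -> complex.Im (f x) = 0}.
  apply: real_part => // a b c d; have := congr1 (@complex.Im R) (rect a b c d).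
  by rewrite /=; under eq_Rintegral do rewrite ImM /= mulr0 add0r.
have H : {ae leb2, forall x : plane, cell x -> f x = 0}.
  by apply: filterS2 R0 I0 => x r i cx; apply: complexP; rewrite /= ?r ?i.
exact: H.
Qed.

End fourier_uniqueness.

(** * Square boxes of frequencies and their dyadic differences *)

Section frequency_boxes.

(** An explicit list starting at 1 - n turns a Weyl sum over frequencies into a sum over consecutive
    naturals, the form in which van der Corput's identity is applied. *)
Definition zrange (n : nat) : seq int :=
  [seq (i%:Z - n%:Z + 1)%R | i <- iota 0 (2 * n).-1].

Lemma mem_zrange n (a : int) : (a \in zrange n) = (`|a| < n)%N.
Proof.
apply/mapP/idP => [[j]|an].
  by rewrite mem_iota => + ->; lia.
exists `|(a + n%:Z - 1)%R|%N; last lia.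
by rewrite mem_iota; lia.
Qed.

Lemma uniq_zrange n : uniq (zrange n).
Proof. by rewrite map_inj_uniq ?iota_uniq// => i j; lia. Qed.

Definition box (n : nat) : seq (int * int) :=
  [seq (a, b) | a <- zrange n, b <- zrange n].

Lemma mem_box n (k : int * int) :
  (k \in box n) = (`|k.1| < n)%N && (`|k.2| < n)%N.
Proof.
case: k => a b /=; rewrite -!mem_zrange; apply/allpairsP/andP => [[[c d] [/= ? ? [-> ->]]]//|[? ?]].
by exists (a, b).
Qed.

Lemma uniq_box n : uniq (box n).
Proof. by rewrite allpairs_uniq ?uniq_zrange// => -[? ?] [? ?]. Qed.

Lemma size_box n : (size (box n) <= 4 * n ^ 2)%N.
Proof.
rewrite size_allpairs !size_map size_iota.
by apply: (@leq_trans ((2 * n) * (2 * n))%N); [apply: leq_mul; lia|lia].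
Qed.

Lemma sub_box m n : (m <= n)%N -> {subset box m <= box n}.
Proof. by move=> mn k; rewrite !mem_box => /andP[? ?]; apply/andP; split; lia. Qed.

(* [sc j] is the size of the [j]-th dyadic block; with this choice every
   fractional power of [sc j] that occurs is an integral power of [2 ^ j]. *)
Definition sc (j : nat) : nat := (2 ^ (12 * j))%N.

Lemma scR (R : realType) j : (sc j)%:R = 2 ^+ (12 * j) :> R.
Proof. by rewrite /sc natrX. Qed.

Lemma sc_gt0 j : (0 < sc j)%N.
Proof. by rewrite expn_gt0. Qed.

Lemma leq_sc i j : (i <= j)%N -> (sc i <= sc j)%N.
Proof. by move=> ij; rewrite leq_exp2l// leq_mul2l. Qed.

Lemma sc_ge j : (j < sc j)%N.
Proof.
apply: (@leq_trans (2 ^ j)%N); first exact: ltn_expl.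
by rewrite leq_exp2l//; lia.
Qed.

Definition blk (j : nat) : seq (int * int) :=
  if j is i.+1 then [seq k <- box (sc j) | k \notin box (sc i)] else box (sc 0).

Lemma uniq_blk j : uniq (blk j).
Proof. by case: j => [|j] /=; rewrite ?filter_uniq// uniq_box. Qed.

Lemma sub_blk j : {subset blk j <= box (sc j)}.
Proof. by case: j => [|j] k //; rewrite mem_filter => /andP[]. Qed.

Lemma size_blk j : (size (blk j) <= 4 * sc j ^ 2)%N.
Proof.
apply: leq_trans (size_box _).
by case: j => [|j] //; rewrite size_filter count_size.
Qed.

Lemma perm_box_blk j : perm_eq (box (sc j.+1)) (box (sc j) ++ blk j.+1).
Proof.
rewrite -(perm_filterC (mem (box (sc j))) (box (sc j.+1))) perm_cat//.
apply: uniq_perm; rewrite ?filter_uniq ?uniq_box// => k.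
rewrite mem_filter /=; apply/andb_idr; apply: sub_box; exact: leq_sc.
Qed.

Lemma sum_box_blk (V : nmodType) J (F : int * int -> V) :
  \sum_(k <- box (sc J)) F k = \sum_(j < J.+1) \sum_(k <- blk j) F k.
Proof.
elim: J => [|J ih]; first by rewrite big_ord_recl big_ord0 addr0.
by rewrite big_ord_recr /= -ih (perm_big _ (perm_box_blk J)) big_cat.
Qed.

End frequency_boxes.

(** * Cauchy-Schwarz with geometric weights *)

Section weighted_sums.
Context {R : realType}.
Implicit Types x : nat -> R.

(** Weighted Cauchy-Schwarz: the inverse weights 2^(-i-1) have sum at most 1. It suits terms with
    geometric decay, and the bound does not involve the number of terms. *)
Lemma sqr_sum_le n x :
  (\sum_(i < n) x i) ^+ 2 <= \sum_(i < n) 2 ^+ i.+1 * x i ^+ 2.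
Proof.
elim: n x => [|n ih] x; first by rewrite !big_ord0 expr0n.
rewrite !big_ord_recl /= expr1.
under [X in _ <= _ + X]eq_bigr do rewrite exprS -mulrA.
rewrite -mulr_sumr.
have := ih (fun i => x i.+1); set S := \sum_(i < n) x _; set T := \sum_(i < n) _.
by have := sqr_ge0 (x 0%N - S); nra.
Qed.

(** The weights grow towards small indices, which suits geometrically growing terms dominated by the
    last one. *)
Lemma sqr_sum_le_rev n x :
  (\sum_(i < n) x i) ^+ 2 <= \sum_(i < n) 2 ^+ (n - i) * x i ^+ 2.
Proof.
elim: n => [|n ih]; first by rewrite !big_ord0 expr0n.
rewrite !big_ord_recr /= subSnn expr1.
rewrite [X in _ <= X + _](eq_bigr (fun i : 'I_n => 2 * (2 ^+ (n - i) * x i ^+ 2))); last first.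
  by move=> i _; rewrite subSn ?exprS ?mulrA// ltnW.
rewrite -mulr_sumr.
move: ih; set S := \sum_(i < n) x _; set T := \sum_(i < n) _.
by have := sqr_ge0 (x n - S); nra.
Qed.

(** Applying [sqr_sum_le] twice produces the weight 2^(i+1) (2^(i+1))^2 = 8^(i+1). *)
Lemma pow4_sum_le n x :
  (\sum_(i < n) x i) ^+ 4 <= \sum_(i < n) 8 ^+ i.+1 * x i ^+ 4.
Proof.
rewrite (exprM _ 2 2) (le_trans (_ : _ <= (\sum_(i < n) 2 ^+ i.+1 * x i ^+ 2) ^+ 2))//.
  rewrite lerXn2r ?nnegrE ?sqr_ge0 ?sqr_sum_le//.
  by rewrite sumr_ge0// => i _; rewrite mulr_ge0 ?sqr_ge0// exprn_ge0.
apply: (le_trans (sqr_sum_le n (fun i => 2 ^+ i.+1 * x i ^+ 2))).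
apply: ler_sum => i _; rewrite exprMn mulrA (exprM _ 2 2).
rewrite ler_wpM2r ?sqr_ge0//.
have -> : (8 : R) = 2 * 2 * 2 by ring.
by rewrite !exprMn expr2 mulrA.
Qed.

Lemma sum_half_le n : \sum_(i < n) (2 ^- i : R) <= 2.
Proof.
suff -> : \sum_(i < n) (2 ^- i : R) = 2 - 2 * 2 ^- n by rewrite gerBl mulr_ge0// invr_ge0 exprn_ge0.
elim: n => [|n ih]; first by rewrite big_ord0 expr0 invr1 mulr1 subrr.
rewrite big_ord_recr /= ih exprS invfM.
by rewrite mulrA divff ?mul1r; [lra|lra].
Qed.

Lemma nneseries_le_bound (u : nat -> R) (B : R) : (forall n, 0 <= u n) ->
  (forall n, \sum_(i < n) u i <= B) -> (\sum_(0 <= i <oo) (u i)%:E <= B%:E)%E.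
Proof.
move=> u0 uB; apply: lime_le; first by apply: is_cvg_nneseries => i _ _; rewrite lee_fin.
by near=> n; rewrite big_mkord sumEFin lee_fin.
Unshelve. all: by end_near. Qed.

Lemma nneseries_ge_partial (u : nat -> R) n : (forall n, 0 <= u n) ->
  ((\sum_(i < n) u i)%:E <= \sum_(0 <= i <oo) (u i)%:E)%E.
Proof.
move=> u0; have := @nneseries_lim_ge R (fun i => (u i)%:E) xpredT 0%N n.
by rewrite big_mkord sumEFin; apply => i _; rewrite lee_fin.
Qed.

End weighted_sums.

(** * Frequency blocks of functions bounded in the Sobolev space of order 2/3 *)

Section sobolev_blocks.
Context {R : realType}.
Local Notation leb := (@lebesgue_measure R).
Local Notation leb2 := (leb \x leb)%E.
Local Notation cell := (@cell R).
Local Notation plane := (measurableTypeR R * measurableTypeR R)%type.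
Local Notation cmeas2 := (@cmeas R _ plane).
Local Notation mcell := (@measurable_cell R).
Implicit Types (f g : R * R -> R[i]) (k : int * int) (x : R * R) (s : seq (int * int)) (M : R).

Definition wt k : R := (1 + k.1%:~R ^+ 2 + k.2%:~R ^+ 2) `^ (2 / 3).

(** [M] bounds the squared Sobolev norm. Quantifying over finite lists of frequencies avoids
    infinite sums: this is the form in which every later estimate uses the bound. *)
Definition hbd M f := sqint f /\ forall s, uniq s ->
  \sum_(k <- s) wt k * normc (fourier f k) ^+ 2 <= M.

Lemma wt_base_ge1 k : 1 <= 1 + k.1%:~R ^+ 2 + k.2%:~R ^+ 2 :> R.
Proof. by rewrite -addrA lerDl addr_ge0 ?sqr_ge0. Qed.

Lemma wt_ge1 k : 1 <= wt k.
Proof.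
apply: (@le_trans _ _ (1 `^ (2 / 3) : R)); first by rewrite powR1.
apply: ge0_ler_powR; rewrite ?nnegrE//.
- by rewrite (le_trans _ (wt_base_ge1 k)).
- exact: wt_base_ge1.
Qed.

Lemma sqr_absz_le (n : nat) (a : int) : (n <= `|a|)%N -> n%:R ^+ 2 <= a%:~R ^+ 2 :> R.
Proof.
move=> na; rewrite -[leRHS](real_normK (num_real _)) -intr_norm -natr_absz.
by rewrite lerXn2r ?nnegrE// ler_nat.
Qed.

Lemma wt_ge_sc i k : k \notin box (sc i) -> 2 ^+ (16 * i) <= wt k.
Proof.
rewrite mem_box negb_and -!leqNgt => ki.
have h : (sc i)%:R ^+ 2 <= 1 + k.1%:~R ^+ 2 + k.2%:~R ^+ 2 :> R.
  have := sqr_ge0 (k.1%:~R : R); have := sqr_ge0 (k.2%:~R : R).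
  by case/orP: ki => /sqr_absz_le; lra.
(* With N = 2^(12 i) the weight outside the box is at least (N^2)^(2/3) = N^(4/3) = 2^(16 i). *)
have -> : 2 ^+ (16 * i) = ((sc i)%:R ^+ 2) `^ (2 / 3) :> R.
  rewrite scR -exprM -powR_mulrn// -powR_mulrn// -powRrM; congr (_ `^ _).
  by rewrite !natrM; field.
apply: ge0_ler_powR; rewrite ?nnegrE ?divr_ge0 ?exprn_ge0//.
by rewrite (le_trans _ (wt_base_ge1 k)).
Qed.

Lemma hbd_sqint M f : hbd M f -> sqint f. Proof. by case. Qed.

Lemma hbd_ge0 M f : hbd M f -> 0 <= M.
Proof. by move=> [_ /(_ [::] isT)]; rewrite big_nil. Qed.

Lemma hbd_le M M' f : M <= M' -> hbd M f -> hbd M' f.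
Proof. by move=> MM [sf h]; split => // s us; rewrite (le_trans (h _ us)). Qed.

Lemma sum_sqr_ge0 s (c : int * int -> R[i]) : 0 <= \sum_(k <- s) normc (c k) ^+ 2.
Proof. by apply: sumr_ge0 => *; rewrite sqr_ge0. Qed.

Lemma hbd_tail M f s i : hbd M f -> uniq s ->
  (forall k, k \in s -> k \notin box (sc i)) ->
  2 ^+ (16 * i) * \sum_(k <- s) normc (fourier f k) ^+ 2 <= M.
Proof.
move=> [_ h] us ks; apply: le_trans (h _ us); rewrite mulr_sumr !big_seq.
by apply: ler_sum => k kin; rewrite ler_wpM2r ?sqr_ge0// wt_ge_sc// ks.
Qed.

Lemma hbd_sum M f s : hbd M f -> uniq s ->
  \sum_(k <- s) normc (fourier f k) ^+ 2 <= M.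
Proof.
move=> [_ h] us; apply: le_trans (h _ us).
by apply: ler_sum => k _; rewrite ler_peMl ?sqr_ge0// wt_ge1.
Qed.

(** Block j starts at the edge of the previous box, so the weight there is only 2^(16 (j - 1)); the
    factor 2^16 makes up for it and also absorbs block 0. *)
Lemma hbd_blk M f j : hbd M f ->
  2 ^+ (16 * j) * \sum_(k <- blk j) normc (fourier f k) ^+ 2 <= 2 ^+ 16 * M.
Proof.
move=> h; have M0 := hbd_ge0 h; case: j => [|j].
  rewrite muln0 expr0 mul1r (le_trans (hbd_sum h (uniq_blk 0)))//.
  by rewrite ler_peMl// exprn_ege1// ler1n.
rewrite mulnS exprD -mulrA ler_wpM2l ?exprn_ge0//.
apply: (hbd_tail h (uniq_blk _)) => k.
by rewrite mem_filter => /andP[].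
Qed.

Definition ublk f j x : R[i] := trigp (blk j) (fourier f) x.

Definition psum f n x : R[i] := \sum_(i < n) ublk f i x.

(** Beware of the shift: [psum f n] adds the blocks with index below n, so truncation to the n-th
    box is [psum f n.+1]. *)
Lemma psumE f n x : psum f n.+1 x = trigp (box (sc n)) (fourier f) x.
Proof. by rewrite /psum /trigp sum_box_blk. Qed.

Lemma normc_trigp_sqr s c x :
  normc (trigp s c x) ^+ 2 <= (size s)%:R * \sum_(k <- s) normc (c k) ^+ 2 :> R.
Proof.
rewrite (le_trans (normc_sum_sqr _ _))// ler_wpM2l//.
by apply: ler_sum => k _; rewrite normcM normc_ek mulr1.
Qed.

(** Bernstein's inequality: at most 4 N^2 modes times a square sum of at most 2^16 M N^(-4/3) leave
    N^(2/3) = 2^(8 j). *)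
Lemma ublk_sup M f j x : hbd M f ->
  normc (ublk f j x) ^+ 2 <= 2 ^+ 18 * M * 2 ^+ (8 * j).
Proof.
move=> h; apply: (le_trans (normc_trigp_sqr _ _ _)).
set S := \sum_(k <- _) _.
have S0 : 0 <= S by apply: sum_sqr_ge0.
apply: (@le_trans _ _ (4 * (2 ^+ (12 * j)) ^+ 2 * S)).
  rewrite ler_wpM2r// -scR -natrX -natrM ler_nat; exact: size_blk.
have := hbd_blk j h; rewrite -/S.
have -> : 2 ^+ (12 * j) ^+ 2 = 2 ^+ (8 * j) * 2 ^+ (16 * j) :> R.
  by rewrite -exprM -exprD; congr (_ ^+ _); lia.
have -> : (2 : R) ^+ 18 = 4 * 2 ^+ 16 by rewrite (_ : 18 = 2 + 16)%N// exprD; congr (_ * _); rewrite expr2; ring.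
have p0 : 0 <= 2 ^+ (8 * j) :> R by rewrite exprn_ge0.
move=> /(ler_wpM2l p0).
set a := 2 ^+ (8 * j); set b := 2 ^+ (16 * j); set c := 2 ^+ 16; nra.
Qed.

Lemma cmeasT_ublk f j : cmeas2 setT (ublk f j).
Proof. exact: cmeasT_trigp. Qed.

Lemma cmeas_ublk f j : cmeas2 cell (ublk f j).
Proof. by apply: cmeasTS; exact: cmeasT_ublk. Qed.

Lemma cmeas_psum f n : cmeas2 cell (psum f n).
Proof. by apply: cmeas_sum => // i; exact: cmeas_ublk. Qed.

Lemma sqint_psum f n : sqint (psum f n).
Proof.
case: n => [|n]; last by rewrite (funext (psumE f n)); exact: sqint_trigp.
apply: (@sqint_bounded _ _ 0); first exact: cmeas_psum.
by move=> x; rewrite /psum big_ord0 normc0.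
Qed.

Lemma nint2_ublk f j : nint 2 (ublk f j) =
  ((2 * pi) ^+ 2 * \sum_(k <- blk j) normc (fourier f k) ^+ 2)%:E.
Proof. by rewrite nintE ?sq_trigp ?uniq_blk//; exact: sqint_trigp. Qed.

(** Two of the four factors are estimated by their supremum, which costs N^(2/3), and the other two
    in L^2, which gains N^(-4/3). The exponent 34 is 18 + 16. *)
Lemma nint4_ublk M f j : hbd M f ->
  (nint 4 (ublk f j) <= ((2 * pi) ^+ 2 * 2 ^+ 34 * M ^+ 2 * 2 ^- (8 * j))%:E)%E.
Proof.
move=> h; have M0 := hbd_ge0 h.
have c0 : 0 <= 2 ^+ 18 * M * 2 ^+ (8 * j) by rewrite !mulr_ge0 ?exprn_ge0//.
apply: (@le_trans _ _ ((2 ^+ 18 * M * 2 ^+ (8 * j))%:E * nint 2 (ublk f j))%E).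
  rewrite /nint -integral_cellZ//; first last.
    by move=> x _; rewrite sqr_ge0.
    by apply: cmeas_normcX; exact: cmeas_ublk.
  apply: le_integral_cell.
  - by apply: cmeas_normcX; exact: cmeas_ublk.
  - by apply: measurable_funM => //; apply: cmeas_normcX; exact: cmeas_ublk.
  - move=> x _; rewrite exprn_ge0 ?normc_ge0//= (exprM _ 2 2) expr2.
    by rewrite ler_wpM2r ?sqr_ge0// ublk_sup.
rewrite nint2_ublk -EFinM lee_fin.
have := hbd_blk j h; set S := \sum_(k <- _) _ => hS.
have e16 : 2 ^+ (16 * j) = 2 ^+ (8 * j) * 2 ^+ (8 * j) :> R.
  by rewrite -exprD; congr (_ ^+ _); lia.
rewrite e16 in hS; rewrite (_ : 34 = 18 + 16)%N// exprD.
have p0 : 0 < 2 ^+ (8 * j) :> R by rewrite exprn_gt0.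
set a := 2 ^+ (8 * j) in hS p0 *.
have -> : (2 * pi) ^+ 2 * (2 ^+ 18 * 2 ^+ 16) * M ^+ 2 / a =
   ((2 * pi) ^+ 2 * (2 ^+ 18 * M)) * (2 ^+ 16 * M / a) by ring.
have -> : 2 ^+ 18 * M * a * ((2 * pi) ^+ 2 * S) =
   ((2 * pi) ^+ 2 * (2 ^+ 18 * M)) * (a * S) by ring.
apply: ler_wpM2l; first by apply: mulr_ge0; [exact: sqr_ge0|apply: mulr_ge0 => //; exact: exprn_ge0].
by rewrite ler_pdivlMr// mulrC mulrA.
Qed.

(** The block suprema grow geometrically, so their sum is of the order of the last one. The two
    extra factors 2 over [ublk_sup] are the smallest reversed weight and the geometric sum. *)
Lemma psum_sup M f n x : hbd M f ->
  normc (psum f n.+1 x) ^+ 2 <= 2 ^+ 20 * M * 2 ^+ (8 * n).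
Proof.
move=> h; have M0 := hbd_ge0 h.
apply: (@le_trans _ _ ((\sum_(i < n.+1) normc (ublk f i x)) ^+ 2)).
  by rewrite lerXn2r ?nnegrE ?normc_ge0 ?normc_sum// sumr_ge0// => *; rewrite normc_ge0.
apply: (le_trans (sqr_sum_le_rev n.+1 (fun i => normc (ublk f i x)))).
apply: (@le_trans _ _ (\sum_(i < n.+1) (2 ^+ 19 * M * 2 ^+ (8 * n)) * 2 ^- (n - i))).
  apply: ler_sum => i _; have i_n : (i <= n)%N by rewrite -ltnS.
  apply: (@le_trans _ _ (2 ^+ (n.+1 - i) * (2 ^+ 18 * M * 2 ^+ (8 * i)))).
    by rewrite ler_wpM2l ?exprn_ge0// ublk_sup.
  rewrite subSn// (exprS _ (n - i)) (exprS _ 18).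
  have -> : 2 ^+ (8 * n) = 2 ^+ (8 * (n - i)) * 2 ^+ (8 * i) :> R.
    by rewrite -exprD; congr (_ ^+ _); lia.
  rewrite ler_pdivlMr ?exprn_gt0//.
  have : 2 ^+ (n - i) * 2 ^+ (n - i) <= 2 ^+ (8 * (n - i)) :> R.
    by rewrite -exprD ler_weXn2l//; [rewrite ler1n|lia].
  have K0 : 0 <= 2 * (2 ^+ 18 * M * 2 ^+ (8 * i)) by rewrite !mulr_ge0 ?exprn_ge0//.
  move=> /(ler_wpM2l K0).
  set a := 2 ^+ (n - i); set b' := 2 ^+ (8 * (n - i)); set e := 2 ^+ (8 * i).
  set c := 2 ^+ 18; lra.
rewrite -mulr_sumr (exprS _ 19).
have -> : \sum_(i < n.+1) (2 : R) ^- (n - i) = \sum_(i < n.+1) 2 ^- i.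
  rewrite (reindex_inj rev_ord_inj) /=; apply: eq_bigr => i _.
  by rewrite subSS subKn// -ltnS.
have := sum_half_le (R := R) n.+1.
have K0 : 0 <= 2 ^+ 19 * M * 2 ^+ (8 * n) by rewrite !mulr_ge0 ?exprn_ge0//.
move=> /(ler_wpM2l K0); set c := 2 ^+ 19; lra.
Qed.

End sobolev_blocks.

(** * Integrals of functions equal almost everywhere *)

Section ae_equality.
Context {R : realType} d (X : measurableType d).
Context (mu : {measure set X -> \bar R}) (D : set X) (mD : measurable D).

Lemma ae_eq_cintegral (f g : X -> R[i]) : cmeas D f -> cmeas D g ->
  {ae mu, forall x, D x -> f x = g x} -> cintegral mu D f = cintegral mu D g.
Proof.
move=> [f1 f2] [g1 g2] fg; apply: complexP; congr fine; apply: ae_eq_integral => //.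
- exact/measurable_EFinP.
- exact/measurable_EFinP.
- by apply: filterS fg => x + Dx => /(_ Dx) ->.
- exact/measurable_EFinP.
- exact/measurable_EFinP.
- by apply: filterS fg => x + Dx => /(_ Dx) ->.
Qed.

End ae_equality.

(** * Almost everywhere convergence of the block expansion *)

Section block_expansion.
Context {R : realType}.
Local Notation leb := (@lebesgue_measure R).
Local Notation leb2 := (leb \x leb)%E.
Local Notation cell := (@cell R).
Local Notation plane := (measurableTypeR R * measurableTypeR R)%type.
Local Notation cmeas2 := (@cmeas R _ plane).
Local Notation mcell := (@measurable_cell R).
Implicit Types (f g : R * R -> R[i]) (k : int * int) (s : seq (int * int)) (M : R).

Lemma fourier_ae_eq f g k : cmeas2 cell f -> cmeas2 cell g ->
  {ae leb2, forall x : plane, cell x -> f x = g x} -> fourier f k = fourier g k.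
Proof.
move=> mf mg fg; rewrite !fourierE; congr (_ * _); apply: ae_eq_cintegral.
- exact: mcell.
- by apply: cmeasM => //; apply: cmeas_conj => //; apply: cmeasTS; exact: cmeasT_ek.
- by apply: cmeasM => //; apply: cmeas_conj => //; apply: cmeasTS; exact: cmeasT_ek.
- by apply: filterS fg => x + cx => /(_ cx) ->.
Qed.

Lemma series_abs_cvg (u : nat -> R) (B : R) : (forall n, \sum_(i < n) `|u i| <= B) ->
  cvgn (fun n => \sum_(i < n) u i).
Proof.
move=> uB; have E : (fun n => \sum_(i < n) u i) = series u.
  by apply/funext => n; rewrite /series /= big_mkord.
rewrite E; apply: normed_cvg; apply: nondecreasing_is_cvgn.
  by apply: nondecreasing_series => i _ _; exact: normr_ge0.
by exists B => y [n _ <-]; rewrite /= /series /= big_mkord; exact: uB.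
Qed.

(* By Cauchy-Schwarz, [bsq f] dominates [|f|^2] wherever the blocks of [f] sum to [f]. *)
Definition bsq f (x : plane) : \bar R :=
  (\sum_(0 <= i <oo) (2 ^+ i.+1 * normc (ublk f i x) ^+ 2)%:E)%E.

Lemma bsq_term_ge0 f x i : 0 <= 2 ^+ i.+1 * normc (ublk f i x) ^+ 2 :> R.
Proof. by rewrite mulr_ge0 ?sqr_ge0// exprn_ge0. Qed.

Lemma bsq_ge0 f x : (0 <= bsq f x)%E.
Proof. by apply: nneseries_ge0 => i _ _; rewrite lee_fin bsq_term_ge0. Qed.

Lemma measurable_bsq f : measurable_fun cell (bsq f).
Proof.
apply: ge0_emeasurable_sum => [i x _ _|i _]; first by rewrite lee_fin bsq_term_ge0.
apply/measurable_EFinP; apply: measurable_funM => //.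
by apply: cmeas_normcX; exact: cmeas_ublk.
Qed.

(** The weights 2^(i+1) are harmless against the decay 2^(-16 i) of the block energies, of which the
    proof keeps just enough for a geometric series of ratio 1/2. *)
Lemma integral_bsq M f : hbd M f ->
  (\int[leb2]_(x in cell) bsq f x <= ((2 * pi) ^+ 2 * (2 ^+ 18 * M))%:E)%E.
Proof.
move=> h; have M0 := hbd_ge0 h; rewrite integral_nneseries//; last 3 first.
- exact: mcell.
- move=> i; apply/measurable_EFinP; apply: measurable_funM => //.
  by apply: cmeas_normcX; exact: cmeas_ublk.
- by move=> i x _; rewrite lee_fin bsq_term_ge0.
have E i : (\int[leb2]_(x in cell) (2 ^+ i.+1 * normc (ublk f i x) ^+ 2)%:E =
    (2 ^+ i.+1 * ((2 * pi) ^+ 2 * \sum_(k <- blk i) normc (fourier f k) ^+ 2))%:E)%E.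
  rewrite integral_cellZ ?exprn_ge0//; last 2 first.
  - by apply: cmeas_normcX; exact: cmeas_ublk.
  - by move=> x _; rewrite sqr_ge0.
  by rewrite EFinM -nint2_ublk.
rewrite (eq_eseriesr (fun i _ => E i)); apply: nneseries_le_bound.
  by move=> i; apply: mulr_ge0; [exact: exprn_ge0|apply: mulr_ge0; [exact: sqr_ge0|exact: sum_sqr_ge0]].
move=> n; apply: (@le_trans _ _ (\sum_(i < n) ((2 * pi) ^+ 2 * (2 ^+ 17 * M)) * 2 ^- i)).
  apply: ler_sum => i _; rewrite mulrCA -[leRHS]mulrA.
  rewrite ler_wpM2l ?sqr_ge0// ler_pdivlMr ?exprn_gt0//.
  have := hbd_blk i h; set S := \sum_(k <- _) _ => hS.
  have S0 : 0 <= S by apply: sum_sqr_ge0.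
  rewrite (exprS _ 16) (exprS _ i).
  have : 2 ^+ i * 2 ^+ i * S <= 2 ^+ (16 * i) * S.
    by rewrite ler_wpM2r// -exprD ler_weXn2l ?ler1n//; lia.
  move: hS; set a := 2 ^+ i; set c := 2 ^+ 16; set b := 2 ^+ (16 * i); lra.
rewrite -mulr_sumr (exprS _ 17).
have K0 : 0 <= (2 * pi) ^+ 2 * (2 ^+ 17 * M).
  by rewrite mulr_ge0 ?sqr_ge0// mulr_ge0// exprn_ge0.
have := sum_half_le (R := R) n; move=> /(ler_wpM2l K0).
set c := 2 ^+ 17; set p := (2 * pi) ^+ 2; lra.
Qed.

Lemma integrable_bsq M f : hbd M f -> leb2.-integrable cell (bsq f).
Proof.
move=> h; apply/integrableP; split; first exact: measurable_bsq.
under eq_integral do rewrite gee0_abs ?bsq_ge0//.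
by rewrite (le_lt_trans (integral_bsq h)) ?ltry.
Qed.

Lemma psum_sqr_le_bsq f n (x : plane) : ((normc (psum f n x) ^+ 2)%:E <= bsq f x)%E.
Proof.
apply: le_trans (nneseries_ge_partial n (bsq_term_ge0 f x)).
rewrite lee_fin; apply: le_trans (sqr_sum_le n (fun i => normc (ublk f i x))).
by rewrite lerXn2r ?nnegrE ?normc_ge0 ?normc_sum// sumr_ge0// => *; rewrite normc_ge0.
Qed.

Lemma psum_cvg f (x : plane) : bsq f x \is a fin_num ->
  exists z : R[i], (fun n => complex.Re (psum f n x)) @ \oo --> complex.Re z /\
    (fun n => complex.Im (psum f n x)) @ \oo --> complex.Im z.
Proof.
move=> fin; pose B := 1 + fine (bsq f x).
have sB n : \sum_(i < n) normc (ublk f i x) <= B.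
  have S0 : 0 <= \sum_(i < n) normc (ublk f i x) by apply: sumr_ge0 => *; exact: normc_ge0.
  have := sqr_sum_le n (fun i => normc (ublk f i x)).
  have := nneseries_ge_partial n (bsq_term_ge0 f x).
  rewrite -/(bsq f x) -(fineK fin) lee_fin /B.
  set S := \sum_(i < n) normc _ in S0 *; set T := \sum_(i < n) _; set Q := fine _.
  have := sqr_ge0 (S - 1); nra.
have c1 : cvgn (fun n => complex.Re (psum f n x)).
  rewrite /psum; under eq_fun do rewrite Re_sum.
  apply: (@series_abs_cvg (fun i => complex.Re (ublk f i x)) B) => n.
  by apply: le_trans (sB n); apply: ler_sum => i _; exact: Re_le_normc.
have c2 : cvgn (fun n => complex.Im (psum f n x)).
  rewrite /psum; under eq_fun do rewrite Im_sum.
  apply: (@series_abs_cvg (fun i => complex.Im (ublk f i x)) B) => n.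
  by apply: le_trans (sB n); apply: ler_sum => i _; exact: Im_le_normc.
by exists (limn (fun n => complex.Re (psum f n x)) +i* limn (fun n => complex.Im (psum f n x))).
Qed.

Lemma normc_cvg0 (u : nat -> R[i]) (z : R[i]) :
  (fun n => complex.Re (u n)) @ \oo --> complex.Re z ->
  (fun n => complex.Im (u n)) @ \oo --> complex.Im z ->
  (fun n => normc (u n - z)) @ \oo --> (0 : R).
Proof.
move=> h1 h2.
have h : (fun n => `|complex.Re (u n) - complex.Re z| + `|complex.Im (u n) - complex.Im z|) @ \oo --> (0 : R).
  have -> : 0 = `|complex.Re z - complex.Re z| + `|complex.Im z - complex.Im z| by rewrite !subrr !normr0 addr0.
  by apply: cvgD; apply: cvg_norm; apply: cvgB => //; exact: cvg_cst.
apply: (squeeze_cvgr _ (cvg_cst (0 : R)) h).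
near=> n; rewrite normc_ge0 /= (le_trans (normc_le_ReIm _))// ReD ImD.
by rewrite ReN ImN.
Unshelve. all: by end_near. Qed.

(** Where [bsq f] is finite, hence almost everywhere on the cell, the blocks are absolutely
    summable. The limit [w] has the Fourier coefficients of f by dominated convergence, and
    uniqueness of coefficients identifies it with f. *)
Lemma psum_cvg_ae M f : hbd M f ->
  {ae leb2, forall x : plane, cell x -> (fun n => normc (psum f n x - f x)) @ \oo --> (0 : R)}.
Proof.
move=> h; have sf := hbd_sqint h; have [mf _] := sf.
pose G : set plane := cell `&` [set x | bsq f x \is a fin_num].
have mG : measurable G by apply: emeasurable_fin_num; [exact: mcell|exact: measurable_bsq].
have aeG : {ae leb2, forall x : plane, cell x -> G x}.
  by have := integrable_ae mcell (integrable_bsq h); apply: filterS => x + cx => /(_ cx).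
(* Cutting off outside [G] makes the sequence converge at every point, so that the limit is defined
   everywhere and measurable. *)
pose F n (x : plane) := psum f n x * (\1_G x)%:C.
have mF n : cmeas2 cell (F n).
  apply: cmeasM => //; first exact: cmeas_psum.
  by apply: cmeas_real => //; apply: measurable_funTS; exact: measurable_indic.
have /choice[w wP] : forall x : plane, exists z : R[i],
    (fun n => complex.Re (F n x)) @ \oo --> complex.Re z /\
    (fun n => complex.Im (F n x)) @ \oo --> complex.Im z.
  move=> x.
  rewrite /F indicE; have [xG|xG] := boolP (x \in G).
    have [_ /= fin] := set_mem xG; have [z zP] := psum_cvg fin.
    by exists z; under eq_fun do rewrite mulr1; under [X in _ /\ X @ _ --> _]eq_fun do rewrite mulr1.
  exists 0; under eq_fun do rewrite mulr0; under [X in _ /\ X @ _ --> _]eq_fun do rewrite mulr0.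
  by split; exact: cvg_cst.
have mw : cmeas2 cell w.
  split.
    apply: (@measurable_fun_cvg _ _ _ _ (fun n x => complex.Re (F n x))).
      by move=> n; have [] := mF n.
    by move=> x _; have [] := wP x.
  apply: (@measurable_fun_cvg _ _ _ _ (fun n x => complex.Im (F n x))).
    by move=> n; have [] := mF n.
  by move=> x _; have [] := wP x.
have Fw x : (fun n => normc (F n x - w x)) @ \oo --> (0 : R).
  by have [] := wP x; exact: normc_cvg0.
pose g (x : plane) := 1 + fine (bsq f x).
have ig : leb2.-integrable cell (EFin \o g).
  under [EFin \o _]eq_fun do rewrite /= EFinD.
  apply: integrableD; first exact: mcell.
    by apply: (@integrable_cell_bounded _ (cst 1) 1) => [|x]; [exact: measurable_cst|rewrite normr1].
  apply: le_integrable (integrable_bsq h); first exact: mcell.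
    apply/measurable_EFinP; apply: measurableT_comp => //; exact: measurable_bsq.
  move=> x _ /=; have := bsq_ge0 f x; case: (bsq f x) => [r| |]//= r0.
  by rewrite leey.
have Fg n x : normc (F n x) <= g x.
  rewrite /F /g indicE; have [xG|xG] := boolP (x \in G); last first.
    by rewrite mulr0 normc0 addr_ge0// fine_ge0// bsq_ge0.
  have [_ /= fin] := set_mem xG; rewrite mulr1.
  have := psum_sqr_le_bsq f n x; rewrite -(fineK fin) lee_fin /=.
  by have := sqr_ge0 (normc (psum f n x) - 1); have := normc_ge0 (psum f n x); nra.
have wg x : normc (w x) <= g x.
  have : (fun n => normc (F n x)) @ \oo --> normc (w x).
    apply/cvgrPdist_le => e e0.
    have /cvgrPdist_le /(_ e e0) := Fw x; apply: filterS => n.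
    rewrite sub0r normrN ger0_norm ?normc_ge0//; apply: le_trans.
    by rewrite distrC normcB_dist.
  move=> cv; rewrite -(cvg_lim _ cv)//; apply: limr_le; last by near=> n; exact: Fg.
  by apply/cvg_ex; eexists; exact: cv.
have iw : cintble leb2 cell w by apply: (cintble_bound mcell mw ig).
have fw k : fourier w k = fourier f k.
  (* A given coefficient of the partial sums is stationary once its frequency has entered the
     box. *)
  have FE n : k \in box (sc n) -> fourier (F n.+1) k = fourier f k.
    move=> kn; rewrite (@fourier_ae_eq _ (psum f n.+1)).
    - by rewrite (funext (psumE f n)) fourier_trigp ?uniq_box// kn.
    - exact: mF.
    - exact: cmeas_psum.
    - apply: filterS aeG => x cG cx; rewrite /F indicE mem_set ?mulr1//; exact: cG.
  have mek : cmeas2 cell (fun x => conjc (ek k x)).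
    by apply: cmeas_conj => //; apply: cmeasTS; exact: cmeasT_ek.
  have eg (z : R[i]) x : normc (z * conjc (ek k x)) = normc z.
    by rewrite normcM normc_conjc normc_ek mulr1.
  have H : (fun n => normc (cintegral leb2 cell (fun x => F n x * conjc (ek k x)) -
      cintegral leb2 cell (fun x => w x * conjc (ek k x)))) @ \oo --> (0 : R).
    apply: (cintegral_dominated_cvg mcell _ _ _ ig).
    - by move=> n; exact: cmeasM.
    - exact: cmeasM.
    - apply: nearW => x _; have := Fw x; apply: cvg_trans; apply: near_eq_cvg.
      by near=> n; rewrite -mulrBl eg.
    - by move=> n x _; rewrite eg.
    - by move=> x _; rewrite eg.
  have : (fun n => (2 * pi) ^- 2 * normc (cintegral leb2 cell (fun x => F n x * conjc (ek k x)) -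
      cintegral leb2 cell (fun x => w x * conjc (ek k x)))) @ \oo --> ((2 * pi) ^- 2 * 0 : R).
    by apply: cvgM => //; exact: cvg_cst.
  rewrite mulr0 => H0.
  have : (fun n : nat => normc (fourier f k - fourier w k)) @ \oo --> (0 : R).
    apply: cvg_trans H0; apply: near_eq_cvg.
    near=> n; have n0 : (maxn `|k.1| `|k.2| < n)%N by near: n; exact: nbhs_infty_gt.
    have nE : n = n.-1.+1 by move: n0; case: (n).
    rewrite nE -[fourier f k](FE n.-1); last first.
      by rewrite mem_box; have := sc_ge n.-1; move: n0; rewrite gtn_max; lia.
    rewrite !fourierE -mulrBr normcM normc_real ger0_norm//.
    by rewrite invr_ge0 sqr_ge0.
  move=> /(cvg_unique _ (cvg_cst _)) E; apply/eqP; rewrite eq_sym -subr_eq0; apply/eqP.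
  by apply: eq0_normc; exact: E.
have fw0 : {ae leb2, forall x : plane, cell x -> f x - w x = 0}.
  apply: (@fourier_uniqueness _ (fun x => f x - w x)).
    under eq_fun do rewrite -mulN1r.
    by apply: cintbleD; [exact: mcell|exact: sqint_cintble|apply: cintbleZ => //; exact: mcell].
  by move=> k; rewrite fourierB ?fw ?subrr//; exact: sqint_cintble.
apply: filterS2 aeG fw0 => x cG h0 cx.
have /eqP := h0 cx; rewrite subr_eq0 => /eqP ->.
have := Fw x; rewrite /F indicE mem_set; last exact: cG.
by under eq_fun do rewrite mulr1.
Unshelve. all: by end_near. Qed.

End block_expansion.

(** * L^4 bounds, Plancherel, and the cubic nonlinearity *)

Section sobolev_estimates.
Context {R : realType}.
Local Notation leb := (@lebesgue_measure R).
Local Notation leb2 := (leb \x leb)%E.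
Local Notation cell := (@cell R).
Local Notation plane := (measurableTypeR R * measurableTypeR R)%type.
Local Notation cmeas2 := (@cmeas R _ plane).
Local Notation mcell := (@measurable_cell R).
Implicit Types (f g : R * R -> R[i]) (k : int * int) (s : seq (int * int)) (M : R).

Lemma EFin_lim_le (u : nat -> R) (l : R) (Q : \bar R) : u @ \oo --> l ->
  (forall n, ((u n)%:E <= Q)%E) -> (l%:E <= Q)%E.
Proof.
move=> ul uQ; case: Q uQ => [q| |] uQ; last 2 first.
- by rewrite leey.
- by have := uQ 0%N; rewrite leeNy_eq.
rewrite lee_fin -(cvg_lim _ ul)//; apply: limr_le; first by apply/cvg_ex; exists l.
by near=> n; have := uQ n; rewrite lee_fin.
Unshelve. all: by end_near. Qed.

Lemma normc_cvgX (u : nat -> R[i]) (z : R[i]) p :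
  (fun n => normc (u n - z)) @ \oo --> (0 : R) ->
  (fun n => normc (u n) ^+ p) @ \oo --> normc z ^+ p.
Proof.
move=> uz; have : (fun n => normc (u n)) @ \oo --> normc z.
  apply/cvgrPdist_le => e e0; move/cvgrPdist_le : uz => /(_ e e0); apply: filterS => n.
  rewrite sub0r normrN ger0_norm ?normc_ge0//; apply: le_trans.
  by rewrite distrC normcB_dist.
by move=> h; exact: (continuous_cvg (h := fun y : R => y ^+ p) _ (@exprn_continuous R p (normc z)) h).
Qed.

Lemma sqr_le_bsq_ae M f : hbd M f ->
  {ae leb2, forall x : plane, cell x -> ((normc (f x) ^+ 2)%:E <= bsq f x)%E}.
Proof.
move=> h; have := psum_cvg_ae h; apply: filterS => x + cx => /(_ cx) /(@normc_cvgX _ _ 2) H.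
by apply: (EFin_lim_le H) => n; exact: psum_sqr_le_bsq.
Qed.

(** The counterpart of [bsq] for |f|^4, with the weights of [pow4_sum_le]; these are still beaten by
    the decay 2^(-8 i) of the fourth powers of the blocks. *)
Definition bqt f (x : plane) : \bar R :=
  (\sum_(0 <= i <oo) (8 ^+ i.+1 * normc (ublk f i x) ^+ 4)%:E)%E.

Lemma bqt_term_ge0 f x i : 0 <= 8 ^+ i.+1 * normc (ublk f i x) ^+ 4 :> R.
Proof. by rewrite mulr_ge0 ?exprn_ge0 ?normc_ge0. Qed.

Lemma psum_qt_le_bqt f n (x : plane) : ((normc (psum f n x) ^+ 4)%:E <= bqt f x)%E.
Proof.
apply: le_trans (nneseries_ge_partial n (bqt_term_ge0 f x)).
rewrite lee_fin; apply: le_trans (pow4_sum_le n (fun i => normc (ublk f i x))).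
by rewrite lerXn2r ?nnegrE ?normc_ge0 ?normc_sum// sumr_ge0// => *; rewrite normc_ge0.
Qed.

Lemma measurable_bqt f : measurable_fun cell (bqt f).
Proof.
apply: ge0_emeasurable_sum => [i x _ _|i _]; first by rewrite lee_fin bqt_term_ge0.
apply/measurable_EFinP; apply: measurable_funM => //.
by apply: cmeas_normcX; exact: cmeas_ublk.
Qed.

(** Constant of the embedding into L^4: 2^38 is the 2^34 of [nint4_ublk] times the first weight 8
    times 2 for the geometric series. *)
Definition l4c : R := (2 * pi) ^+ 2 * 2 ^+ 38.

Lemma l4c_ge0 : 0 <= l4c.
Proof. by apply: mulr_ge0; [exact: sqr_ge0|exact: exprn_ge0]. Qed.

Lemma integral_bqt M f : hbd M f ->
  (\int[leb2]_(x in cell) bqt f x <= (l4c * M ^+ 2)%:E)%E.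
Proof.
move=> h; have M0 := hbd_ge0 h; rewrite integral_nneseries//; last 3 first.
- exact: mcell.
- move=> i; apply/measurable_EFinP; apply: measurable_funM => //.
  by apply: cmeas_normcX; exact: cmeas_ublk.
- by move=> i x _; rewrite lee_fin bqt_term_ge0.
pose c i : R := 8 ^+ i.+1 * ((2 * pi) ^+ 2 * 2 ^+ 34 * M ^+ 2 * 2 ^- (8 * i)).
have c0 i : 0 <= c i.
  apply: mulr_ge0; first exact: exprn_ge0.
  apply: mulr_ge0; last by rewrite invr_ge0 exprn_ge0.
  apply: mulr_ge0; last exact: sqr_ge0.
  by apply: mulr_ge0; [exact: sqr_ge0|exact: exprn_ge0].
have E i : (\int[leb2]_(x in cell) (8 ^+ i.+1 * normc (ublk f i x) ^+ 4)%:E <= (c i)%:E)%E.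
  rewrite integral_cellZ ?exprn_ge0//; last 2 first.
  - by apply: cmeas_normcX; exact: cmeas_ublk.
  - by move=> x _; rewrite exprn_ge0 ?normc_ge0.
  rewrite /c EFinM lee_wpmul2l ?lee_fin ?exprn_ge0//; exact: nint4_ublk.
apply: le_trans (@nneseries_le_bound _ c _ c0 _).
  apply: lee_nneseries => [i _ _|i _]; last exact: E.
  by apply: integral_ge0 => x _; rewrite lee_fin bqt_term_ge0.
move=> n; apply: (@le_trans _ _ (\sum_(i < n) ((2 * pi) ^+ 2 * 2 ^+ 37 * M ^+ 2) * 2 ^- i)).
  apply: ler_sum => i _; rewrite /c.
  have h8 : 8 ^+ i * 2 ^- (8 * i) <= 2 ^- i :> R.
    rewrite -[leRHS]mul1r ler_pdivlMr ?exprn_gt0// mulrAC ler_pdivrMr ?exprn_gt0//.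
    have -> : 8 = 2 ^+ 3 :> R by rewrite !exprS expr0; ring.
    by rewrite -exprM -exprD mul1r ler_weXn2l ?ler1n//; lia.
  have e37 : 2 ^+ 37 = 8 * 2 ^+ 34 :> R by rewrite (exprS _ 36) (exprS _ 35) (exprS _ 34); ring.
  have K0 : 0 <= (2 * pi) ^+ 2 * (2 ^+ 37) * M ^+ 2.
    by apply: mulr_ge0; [apply: mulr_ge0; [exact: sqr_ge0|exact: exprn_ge0]|exact: sqr_ge0].
  have := ler_wpM2l K0 h8; rewrite e37 (exprS 8 i).
  set q := 2 ^+ 34; set p := (2 * pi) ^+ 2; set a := 8 ^+ i; set b := 2 ^- (8 * i); lra.
rewrite -mulr_sumr /l4c (exprS _ 37).
have K0 : 0 <= (2 * pi) ^+ 2 * 2 ^+ 37 * M ^+ 2.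
  by apply: mulr_ge0; [apply: mulr_ge0; [exact: sqr_ge0|exact: exprn_ge0]|exact: sqr_ge0].
have := sum_half_le (R := R) n; move=> /(ler_wpM2l K0).
set c' := 2 ^+ 37; set p := (2 * pi) ^+ 2; lra.
Qed.

Lemma nint4_psum M f n : hbd M f -> (nint 4 (psum f n) <= (l4c * M ^+ 2)%:E)%E.
Proof.
move=> h; apply: le_trans (integral_bqt h); apply: ge0_le_integral => //.
- exact: mcell.
- by move=> x _; rewrite lee_fin exprn_ge0// normc_ge0.
- by apply: cmeas_EnormcX; exact: cmeas_psum.
- exact: measurable_bqt.
- by move=> x _; exact: psum_qt_le_bqt.
Qed.

Lemma nint4_hbd M f : hbd M f -> (nint 4 f <= (l4c * M ^+ 2)%:E)%E.
Proof.
move=> h; have [mf _] := hbd_sqint h.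
apply: le_trans (integral_bqt h); apply: ae_ge0_le_integral => //.
- exact: mcell.
- by move=> x _; rewrite lee_fin exprn_ge0// normc_ge0.
- exact: cmeas_EnormcX.
- by move=> x _; apply: nneseries_ge0 => i _ _; rewrite lee_fin bqt_term_ge0.
- exact: measurable_bqt.
- have := psum_cvg_ae h; apply: filterS => x + cx => /(_ cx) /(@normc_cvgX _ _ 4) H.
  by apply: (EFin_lim_le H) => n; exact: psum_qt_le_bqt.
Qed.

Lemma sq_psum_cvg M f : hbd M f ->
  (fun n => sq (fun x => f x - psum f n x)) @ \oo --> (0 : R).
Proof.
move=> h; have [mf _] := hbd_sqint h.
have mB n : cmeas2 cell (fun x => f x - psum f n x) by apply: cmeasB => //; exact: cmeas_psum.
have [|||||_ _ H] := @dominated_convergence _ _ _ leb2 cell mcell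
  (fun n x => (normc (f x - psum f n x) ^+ 2)%:E) (cst 0%E) (fun x => 4%:E * bsq f x)%E.
- by move=> n; exact: cmeas_EnormcX.
- exact: measurable_cst.
- have := psum_cvg_ae h; apply: filterS => x + cx => /(_ cx) H.
  apply: cvg_EFin; first by near=> n.
  have : (fun n => normc (psum f n x - f x) * normc (psum f n x - f x)) @ \oo --> (0 * 0 : R).
    by apply: cvgM.
  rewrite mulr0; apply: cvg_trans; apply: near_eq_cvg.
  by near=> n; rewrite /= normcB_sym expr2.
- by apply: integrableZl; [exact: mcell|exact: integrable_bsq h].
- have := sqr_le_bsq_ae h; apply: filterS => x + n cx => /(_ cx).
  rewrite /= ger0_norm ?sqr_ge0//.
  have := psum_sqr_le_bsq f n x; have := bsq_ge0 f x.
  case: (bsq f x) => [q| |]//; last by rewrite mulry gtr0_sg ?mul1e ?leey//.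
  rewrite -EFinM !lee_fin => q0.
  have := normc_ge0 (f x); have := normc_ge0 (psum f n x).
  have := normcB_le (f x) (psum f n x); have := normc_ge0 (f x - psum f n x).
  set a := normc (f x); set b := normc (psum f n x); set c := normc _ => c0 cab b0 a0 hb ha.
  have := sqr_ge0 (a - b); nra.
rewrite integral0 in H; exact: (fine_cvg H).
Unshelve. all: by end_near. Qed.

Lemma ler_sum_sub s1 s2 (F : int * int -> R) : (forall k, 0 <= F k) -> uniq s1 -> uniq s2 ->
  {subset s1 <= s2} -> \sum_(k <- s1) F k <= \sum_(k <- s2) F k.
Proof.
move=> F0 u1 u2 s12; have p : perm_eq s1 [seq k <- s2 | k \in s1].
  apply: uniq_perm; rewrite ?filter_uniq// => k; rewrite mem_filter.
  by apply/esym/andb_idr; exact: s12.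
rewrite (perm_big _ p) /= big_filter [leRHS](bigID (mem s1)) /= lerDl.
exact: sumr_ge0.
Qed.

(** The partial sums converge to f in L^2, so the remainder in [bessel_identity] tends to 0. Only
    this half of Plancherel's identity is required besides Bessel's inequality. *)
Lemma plancherel_le M f (B : R) : hbd M f ->
  (forall n, (2 * pi) ^+ 2 * \sum_(k <- box (sc n)) normc (fourier f k) ^+ 2 <= B) ->
  sq f <= B.
Proof.
move=> h fB; have := sq_psum_cvg h; rewrite -cvg_shiftS /= => H.
rewrite -subr_le0 -(cvg_lim _ H)//; apply: limr_ge; first by apply/cvg_ex; exists 0.
near=> n; rewrite (_ : (fun x => _) = (fun x => f x - trigp (box (sc n)) (fourier f) x)).
  by rewrite bessel_identity ?uniq_box ?lerB//; exact: hbd_sqint h.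
by apply/funext => x; rewrite psumE.
Unshelve. all: by end_near. Qed.

Lemma sq_hbd M f : hbd M f -> sq f <= (2 * pi) ^+ 2 * M.
Proof.
move=> h; apply: (plancherel_le h) => n.
by rewrite ler_wpM2l ?sqr_ge0// (hbd_sum h)// uniq_box.
Qed.

(** The modes inside the box are cancelled by the truncation, and each of the others carries a
    weight of at least 2^(16 n). *)
Lemma sq_tail M f n : hbd M f ->
  sq (fun x => f x - psum f n.+1 x) <= (2 * pi) ^+ 2 * M * 2 ^- (16 * n).
Proof.
move=> h.
rewrite (_ : (fun x => _) = (fun x => f x - trigp (box (sc n)) (fourier f) x)); last first.
  by apply/funext => x; rewrite psumE.
rewrite bessel_identity ?uniq_box//; last exact: hbd_sqint h.
rewrite lerBlDl; apply: (plancherel_le h) => m.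
rewrite -mulrA -mulrDr ler_wpM2l ?sqr_ge0//.
rewrite -(perm_big _ (permEl (perm_filterC (mem (box (sc n))) (box (sc m))))) big_cat /=.
apply: lerD.
  apply: (@ler_sum_sub _ _ (fun k => normc (fourier f k) ^+ 2)).
  - by move=> k; exact: sqr_ge0.
  - by rewrite filter_uniq ?uniq_box.
  - exact: uniq_box.
  - by move=> k; rewrite mem_filter => /andP[].
rewrite ler_pdivlMr ?exprn_gt0// mulrC.
apply: (hbd_tail h); first by rewrite filter_uniq ?uniq_box.
by move=> k; rewrite mem_filter => /andP[].
Qed.

Definition cub f x : R[i] := (normc (f x) ^+ 2)%:C * f x.

Lemma cmeas_cub f : cmeas2 cell f -> cmeas2 cell (cub f).
Proof. by move=> mf; apply: cmeasM => //; apply: cmeas_real => //; exact: cmeas_normcX. Qed.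

(** Pointwise the difference of the cubics is at most 2 (|f|^2 + |g|^2) |f - g|. Young's inequality
    with a free parameter [l] takes the place of Hölder's inequality with exponents 4, 4, 2; each
    application chooses [l] to balance the two terms. *)
Lemma cub_diff_L1 f g (A B l : R) : cmeas2 cell f -> cmeas2 cell g ->
  (nint 4 f <= A%:E)%E -> (nint 4 g <= A%:E)%E ->
  (nint 2 (fun x => f x - g x)%R <= B%:E)%E -> 0 < l ->
  (\int[leb2]_(x in cell) (normc (cub f x - cub g x))%:E <= (4 / l * A + l * B)%:E)%E.
Proof.
move=> mf mg fA gA fgB l0.
have l20 : 0 <= 2 / l by rewrite divr_ge0// ltW.
have mB : cmeas2 cell (fun x => f x - g x) by exact: cmeasB.
apply: (@le_trans _ _ ((2 / l)%:E * nint 4 f + (2 / l)%:E * nint 4 g +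
    l%:E * nint 2 (fun x => f x - g x)%R)%E); last first.
  rewrite EFinD leeD//.
    have -> : 4 / l * A = 2 / l * A + 2 / l * A :> R by field; rewrite gt_eqF.
    by rewrite EFinD !EFinM leeD// lee_wpmul2l ?lee_fin.
  by rewrite EFinM lee_wpmul2l// lee_fin ltW.
have p4 (h : R * R -> R[i]) : forall x : plane, cell x -> 0 <= normc (h x) ^+ 4.
  by move=> x _; rewrite exprn_ge0// normc_ge0.
have p2 : forall x : plane, cell x -> 0 <= normc (f x - g x) ^+ 2 by move=> x _; exact: sqr_ge0.
have m4f := cmeas_normcX 4 mf; have m4g := cmeas_normcX 4 mg.
have m2 := cmeas_normcX 2 mB.
rewrite /nint -!integral_cellZ//; try exact: ltW; try exact: p4.
rewrite -!integral_cellD//.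
- apply: le_integral_cell.
  + by apply: cmeas_normc => //; apply: cmeasB => //; exact: cmeas_cub.
  + by do 2 ?apply: measurable_funD; apply: measurable_funM.
  + move=> x _; rewrite normc_ge0 /=; apply: (le_trans (normcB3 _ _)).
    set a := normc (f x); set b := normc (g x); set d := normc (f x - g x).
    have -> : 2 / l * a ^+ 4 + 2 / l * b ^+ 4 + l * d ^+ 2 =
      (2 * a ^+ 4 + 2 * b ^+ 4 + l ^+ 2 * d ^+ 2) / l by field; rewrite gt_eqF.
    rewrite ler_pdivlMr//.
    have := sqr_ge0 (a ^+ 2 - b ^+ 2); have := sqr_ge0 (a ^+ 2 + b ^+ 2 - l * d).
    rewrite !sqrrB !sqrrD -!exprM; lra.
- by apply: measurable_funD; apply: measurable_funM.
- by apply: measurable_funM.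
- by move=> x cx; rewrite addr_ge0// mulr_ge0// p4.
- by move=> x cx; rewrite mulr_ge0 ?p2// ltW.
- by apply: measurable_funM.
- by apply: measurable_funM.
- by move=> x cx; rewrite mulr_ge0 ?p4.
- by move=> x cx; rewrite mulr_ge0 ?p4.
Qed.

Lemma cintble_cub M f : hbd M f -> cintble leb2 cell (cub f).
Proof.
move=> h; have [mf f2] := hbd_sqint h; have M0 := hbd_ge0 h.
apply: (cintble_lty mcell (cmeas_cub mf)).
have mc0 : cmeas2 cell (fun=> 0) by exact: cmeas_cst.
have := @cub_diff_L1 f (fun=> 0) (l4c * M ^+ 2) (sq f) 1 mf mc0 (nint4_hbd h).
have -> : nint 4 (fun=> 0 : R[i]) = 0%E.
  rewrite /nint; under eq_integral do rewrite normc0 expr0n /=.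
  exact: integral0.
rewrite lee_fin mulr_ge0 ?sqr_ge0 ?l4c_ge0//.
have -> : nint 2 (fun x => (f x - 0)%R) = nint 2 f.
  by congr nint; apply/funext => x; rewrite subr0.
rewrite nintE; last exact: hbd_sqint h.
move=> /(_ isT (lexx _) ltr01) H; apply: le_lt_trans (ltry _).
rewrite /cub mulr0 in H; under eq_integral do rewrite -[cub f _]subr0.
exact: H.
Qed.

(** The choice l = 1/e makes both terms of [cub_diff_L1] of size e. This gives continuity in time of
    the Fourier coefficients of the nonlinearity. *)
Lemma cub_fourier_lip M : 0 <= M -> exists2 K : R, 0 <= K & forall f g (e : R), 0 < e ->
  hbd M f -> hbd M g -> hbd (e ^+ 2) (fun x => f x - g x) ->
  forall k, normc (fourier (cub f) k - fourier (cub g) k) <= K * e.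
Proof.
move=> M0; exists ((2 * pi) ^- 2 * (4 * (l4c * M ^+ 2) + (2 * pi) ^+ 2)).
  rewrite mulr_ge0 ?invr_ge0 ?sqr_ge0// addr_ge0 ?sqr_ge0// mulr_ge0// mulr_ge0 ?sqr_ge0//.
  exact: l4c_ge0.
move=> f g e e0 hf hg hfg k.
have [mf _] := hbd_sqint hf; have [mg _] := hbd_sqint hg.
rewrite -fourierB; [|exact: cintble_cub hf|exact: cintble_cub hg].
rewrite -mulrA; apply: normc_fourier_le.
  by apply: cmeasB => //; exact: cmeas_cub.
have H := @cub_diff_L1 f g (l4c * M ^+ 2) ((2 * pi) ^+ 2 * e ^+ 2) e^-1 mf mg
  (nint4_hbd hf) (nint4_hbd hg).
apply: le_trans (H _ _) _; last 2 first.
- by rewrite invr_gt0.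
- rewrite lee_fin (_ : 4 / e^-1 * _ + _ = (4 * (l4c * M ^+ 2) + (2 * pi) ^+ 2) * e)//.
  by field; rewrite gt_eqF.
- by rewrite nintE ?lee_fin ?sq_hbd//; exact: hbd_sqint hfg.
Qed.

(** With N = 2^(12 n), f is replaced by its truncation p to frequencies below N. For p, Bessel's
    inequality applies, and |p|^6 is integrated as the supremum of |p|^2, of order N^(2/3), times an
    L^4 bound. The error is controlled in L^1 only, by N^(-2/3); this bounds each coefficient, and 4
    N^2 of them contribute N^2 N^(-4/3) = N^(2/3) again. *)
Lemma cubic_bound M : 0 <= M -> exists2 K : R, 0 <= K & forall f, hbd M f ->
  forall n, \sum_(k <- box (sc n)) normc (fourier (cub f) k) ^+ 2 <= K * 2 ^+ (8 * n).
Proof.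
move=> M0; pose A := l4c * M ^+ 2.
have A0 : 0 <= A by rewrite mulr_ge0 ?sqr_ge0 ?l4c_ge0.
pose p2 : R := (2 * pi) ^+ 2.
have p20 : 0 < p2 by rewrite exprn_gt0// mulr_gt0 ?pi_gt0.
pose L := p2^-1 * (4 * A + p2 * M).
exists (2 * (2 ^+ 20 * M * A / p2) + 2 * (4 * L ^+ 2)).
  have K1 : 0 <= 2 ^+ 20 * M * A / p2.
    apply: divr_ge0; last exact: ltW.
    by apply: mulr_ge0 => //; apply: mulr_ge0 => //; exact: exprn_ge0.
  by have := sqr_ge0 L; lra.
move=> f h n; have [mf _] := hbd_sqint h.
set p := psum f n.+1; have mp : cmeas2 cell p by exact: cmeas_psum.
pose e : R := 2 ^+ (8 * n); have e0 : 0 < e by rewrite exprn_gt0.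
have pe x : normc (p x) ^+ 2 <= 2 ^+ 20 * M * e by exact: psum_sup.
have c0 : 0 <= 2 ^+ 20 * M * e by rewrite !mulr_ge0 ?exprn_ge0.
have sp : sqint (cub p).
  apply: (@sqint_bounded _ _ (2 ^+ 20 * M * e * (1 + 2 ^+ 20 * M * e))); first exact: cmeas_cub.
  move=> x; rewrite /cub normcM normc_real ger0_norm ?sqr_ge0// ler_pM ?sqr_ge0 ?normc_ge0//.
  by have := pe x; have := sqr_ge0 (normc (p x) - 1); have := normc_ge0 (p x); nra.
have ip := sqint_cintble sp.
have sqp : sq (cub p) <= 2 ^+ 20 * M * e * A.
  rewrite -lee_fin -nintE//.
  apply: (@le_trans _ _ ((2 ^+ 20 * M * e)%:E * nint 4 p)%E); last first.
    by rewrite [X in (_ <= X)%E]EFinM lee_wpmul2l ?lee_fin//; exact: nint4_psum.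
  rewrite /nint -integral_cellZ//; first last.
    by move=> x _; rewrite exprn_ge0 ?normc_ge0.
    by apply: cmeas_normcX.
  apply: le_integral_cell.
  - by apply: cmeas_normcX => //; exact: cmeas_cub.
  - by apply: measurable_funM => //; exact: cmeas_normcX.
  - move=> x _; rewrite sqr_ge0 /= /cub normcM normc_real ger0_norm ?sqr_ge0//.
    by rewrite exprMn (exprM (normc (p x)) 2 2) [leLHS]mulrC ler_wpM2r ?sqr_ge0.
have I : (\int[leb2]_(x in cell) (normc (cub f x - cub p x))%:E <= ((4 * A + p2 * M) / e)%:E)%E.
  (* The parameter l = e = N^(2/3) balances 1/l against l N^(-4/3). *)
  have H := @cub_diff_L1 f p A (p2 * M * 2 ^- (16 * n)) e mf mp (nint4_hbd h) (nint4_psum _ h).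
  apply: le_trans (H _ e0) _.
    rewrite nintE ?lee_fin; first exact: sq_tail.
    by apply: sqintB; [exact: hbd_sqint h|exact: sqint_psum].
  rewrite lee_fin (_ : 2 ^- (16 * n) = e^-1 * e^-1).
    by rewrite le_eqVlt; apply/orP; left; apply/eqP; field; rewrite gt_eqF.
  by rewrite -invfM -exprD; congr (_ ^- _); lia.
have dk k : normc (fourier (cub f) k - fourier (cub p) k) <= L / e.
  rewrite -fourierB//; last exact: cintble_cub h.
  rewrite /L -mulrA; apply: normc_fourier_le => //.
  by apply: cmeasB => //; exact: cmeas_cub.
have S1 : \sum_(k <- box (sc n)) normc (fourier (cub p) k) ^+ 2 <= 2 ^+ 20 * M * A / p2 * e.
  have := bessel sp (uniq_box (sc n)); rewrite -/p2 => H.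
  rewrite -(ler_pM2l p20) (le_trans H)// (le_trans sqp)// le_eqVlt; apply/orP; left; apply/eqP.
  by field; rewrite gt_eqF.
have S2 : \sum_(k <- box (sc n)) normc (fourier (cub f) k - fourier (cub p) k) ^+ 2 <= 4 * L ^+ 2 * e.
  apply: (@le_trans _ _ (\sum_(k <- box (sc n)) (L / e) ^+ 2)).
    apply: ler_sum => k _; rewrite lerXn2r ?nnegrE ?normc_ge0//.
    by rewrite (le_trans (normc_ge0 _) (dk k)).
  rewrite big_const_seq count_predT iter_addr_0 -[leLHS]mulr_natl.
  apply: (@le_trans _ _ (4 * (2 ^+ (12 * n)) ^+ 2 * (L / e) ^+ 2)).
    by rewrite ler_wpM2r ?sqr_ge0// -scR -natrX -natrM ler_nat size_box.
  rewrite (_ : 2 ^+ (12 * n) ^+ 2 = e * e * e).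
    by rewrite le_eqVlt; apply/orP; left; apply/eqP; field; rewrite gt_eqF.
  by rewrite /e -exprM -!exprD; congr (_ ^+ _); lia.
rewrite -/e.
apply: (@le_trans _ _ (\sum_(k <- box (sc n)) (2 * normc (fourier (cub p) k) ^+ 2 +
    2 * normc (fourier (cub f) k - fourier (cub p) k) ^+ 2))).
  apply: ler_sum => k _.
  have := normc_triangle (fourier (cub p) k) (fourier (cub f) k - fourier (cub p) k).
  rewrite addrC subrK.
  set a := normc _; set b := normc (fourier (cub p) k); set c := normc _ => abc.
  have a0 : 0 <= a by exact: normc_ge0.
  by have := sqr_ge0 (b - c); nra.
rewrite big_split /= -!mulr_sumr; move: S1 S2.
set S := \sum_(k <- _) _; set S' := \sum_(k <- _) _.
set X := 2 ^+ 20 * M * A / p2; set Y := 4 * L ^+ 2; lra.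
Qed.

(** The finite sum is an integral of the difference of the cubics against the truncation [P] of w =
    f - g. The product |w| |P| is split into squares, and Bessel's inequality bounds [P] by w, so
    the estimate is uniform in the list [s]. *)
Lemma cub_energy M f g (m : R) s : hbd M f -> hbd M g -> 0 <= m -> uniq s ->
  {ae leb2, forall x : plane, cell x -> normc (f x) ^+ 2 <= m /\ normc (g x) ^+ 2 <= m} ->
  normc (\sum_(k <- s) conjc (fourier (fun x => f x - g x) k) *
      (fourier (cub f) k - fourier (cub g) k)) <=
    (2 * pi) ^- 2 * (4 * m) * sq (fun x => f x - g x).
Proof.
move=> hf hg m0 us fgm.
have sf := hbd_sqint hf; have sg := hbd_sqint hg.
have [mf _] := sf; have [mg _] := sg.
set w := fun x => f x - g x.
have sw : sqint w by exact: sqintB.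
have [mw _] := sw.
set P := trigp s (fourier w); have sP : sqint P by exact: sqint_trigp.
have [mP _] := sP.
have iH : cintble leb2 cell (fun x => cub f x - cub g x).
  under eq_fun do rewrite -mulN1r; apply: cintbleD; first exact: mcell.
    exact: cintble_cub hf.
  by apply: cintbleZ; [exact: mcell|exact: cintble_cub hg].
have p2 : 0 < (2 * pi) ^+ 2 :> R by rewrite exprn_gt0// mulr_gt0 ?pi_gt0.
have -> : \sum_(k <- s) conjc (fourier w k) * (fourier (cub f) k - fourier (cub g) k) =
    ((2 * pi) ^- 2)%:C * cintegral leb2 cell (fun x => (cub f x - cub g x) * conjc (P x)).
  rewrite cintegral_conjc_trigp// mulrA -rmorphM /= mulVf ?pi2_neq0// mul1r.
  apply: eq_bigr => k _; rewrite fourierB//; [exact: cintble_cub hf|exact: cintble_cub hg].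
rewrite normcM normc_real ger0_norm ?invr_ge0 ?sqr_ge0// -mulrA ler_wpM2l ?invr_ge0 ?sqr_ge0//.
apply: normc_cintegral_le; first exact: mcell.
  by apply: cmeasM => //; [apply: cmeasB => //; exact: cmeas_cub|exact: cmeas_conj].
have sqP : sq P <= sq w by rewrite sq_trigp//; exact: bessel.
apply: (@le_trans _ _ ((2 * m)%:E * nint 2 w + (2 * m)%:E * nint 2 P)%E); last first.
  by rewrite !nintE// -!EFinM -EFinD lee_fin; nra.
rewrite /nint -!integral_cellZ//; last 6 first.
- by rewrite mulr_ge0.
- exact: cmeas_normcX.
- by move=> x _; exact: sqr_ge0.
- by rewrite mulr_ge0.
- exact: cmeas_normcX.
- by move=> x _; exact: sqr_ge0.
rewrite -integral_cellD//; last 4 first.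
- by apply: measurable_funM => //; exact: cmeas_normcX.
- by apply: measurable_funM => //; exact: cmeas_normcX.
- by move=> x _; rewrite mulr_ge0 ?sqr_ge0// mulr_ge0.
- by move=> x _; rewrite mulr_ge0 ?sqr_ge0// mulr_ge0.
apply: ae_ge0_le_integral => //.
- exact: mcell.
- by move=> x _; rewrite lee_fin normc_ge0.
- apply/measurable_EFinP; apply: cmeas_normc => //; apply: cmeasM => //.
    by apply: cmeasB => //; exact: cmeas_cub.
  exact: cmeas_conj.
- by move=> x _; rewrite lee_fin addr_ge0// mulr_ge0 ?sqr_ge0// mulr_ge0.
- apply/measurable_EFinP; apply: measurable_funD; apply: measurable_funM => //; exact: cmeas_normcX.
- apply: filterS fgm => x + cx => /(_ cx)[fm gm].
  rewrite lee_fin normcM normc_conjc.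
  have := normcB3 (f x) (g x); rewrite -/(cub f x) -/(cub g x) -/(w x).
  set H := normc (cub f x - cub g x); set a := normc (f x) in fm *; set b := normc (g x) in gm *.
  set d := normc (w x); set q := normc (P x) => Hd.
  have d0 : 0 <= d by exact: normc_ge0.
  have q0 : 0 <= q by exact: normc_ge0.
  have : H <= 4 * m * d.
    by apply: le_trans Hd _; rewrite ler_wpM2r//; lra.
  move=> /(ler_wpM2r q0) H2; apply: le_trans H2 _.
  have := mulr_ge0 m0 (sqr_ge0 (d - q)); nra.
Qed.

End sobolev_estimates.

(** * Quadratic exponential sums for short times *)

Section weyl_sums.
Context {R : realType}.
Implicit Types (z : nat -> R[i]) (a b y t : R).

Lemma sqr_normcD (u v : R[i]) : normc (u + v) ^+ 2 =
  normc u ^+ 2 + complex.Re (v * conjc u) *+ 2 + normc v ^+ 2.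
Proof. by rewrite !sqr_normcE; case: u => ? ?; case: v => ? ? /=; ring. Qed.

Definition autocorr z n h : R[i] := \sum_(i < n - h) z (i + h)%N * conjc (z i).

(** The square of the sum is expanded and the pairs of indices are grouped by their difference h.
    For a quadratic phase each group is a geometric sum. *)
Lemma van_der_corput z n : (forall i, normc (z i) = 1) ->
  normc (\sum_(i < n) z i) ^+ 2 =
  n%:R + 2 * complex.Re (\sum_(1 <= h < n) autocorr z n h).
Proof.
move=> z1; elim: n => [|n ih].
  by rewrite big_ord0 normc0 expr0n big_geq//= mulr0 addr0.
rewrite big_ord_recr /= sqr_normcD ih z1 expr1n -natr1.
(* The new term z n pairs with every earlier one, at exactly one lag h each. *)
have -> : \sum_(1 <= h < n.+1) autocorr z n.+1 h =
    \sum_(1 <= h < n) autocorr z n h + z n * conjc (\sum_(i < n) z i).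
  rewrite (eq_big_nat _ _ (F2 := fun h => autocorr z n h + z n * conjc (z (n - h)%N))); last first.
    move=> h /andP[h1 hn]; rewrite /autocorr subSn// big_ord_recr /=.
    by rewrite subnK.
  rewrite big_split /=; congr (_ + _).
    case: n {ih} => [|n]; first by rewrite !big_geq.
    by rewrite big_nat_recr //= /autocorr subnn big_ord0 addr0.
  rewrite -mulr_sumr rmorph_sum /=; congr (_ * _).
  rewrite -(big_mkord xpredT (fun i => conjc (z i))) big_add1 /= big_nat_rev /= add0n.
  by rewrite !big_nat; apply: eq_bigr => i /andP[_ i_n]; rewrite subnSK// subKn ?(ltnW i_n)//; congr (conjc (z _)); lia.
rewrite ReD; ring.
Qed.

Lemma van_der_corput_le z n : (forall i, normc (z i) = 1) ->
  normc (\sum_(i < n) z i) ^+ 2 <=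
  n%:R + 2 * \sum_(1 <= h < n) normc (autocorr z n h).
Proof.
move=> z1; rewrite van_der_corput// lerD2l ler_pM2l// Re_sum.
by apply: ler_sum => h _; rewrite (le_trans (ler_norm _))// Re_le_normc.
Qed.

Lemma abs_sin_le y : `|sin y| <= `|y|.
Proof.
have dsin (x : R) : derivable sin x 1 by exact: derivable_sin.
have csin : continuous (sin : R -> R) by exact: continuous_sin.
wlog y0 : y / 0 <= y => [H|].
  have [/H//|y0] := lerP 0 y.
  have := H (- y); rewrite sinN !normrN; apply; lra.
rewrite le_eqVlt in y0; case/orP : y0 => [/eqP <-|y0]; first by rewrite sin0.
have [c cI E] := @MVT R sin cos 0 y y0 (fun x _ => is_derive_sin x) (continuous_subspaceT csin).
move: E; rewrite sin0 !subr0 => ->; rewrite normrM ler_piMl//; exact: cos_max.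
Qed.

Lemma cos_ge_half y : `|y| <= 1 -> 1 / 2 <= cos y.
Proof.
move=> y1; have E : y = (y / 2) *+ 2 by rewrite -mulr_natl; field.
rewrite E cos_mulr2n cos2sin2 [X in _ <= X - _]mulr2n.
have : sin (y / 2) ^+ 2 <= (1 / 2) ^+ 2.
  rewrite -[leLHS](real_normK (num_real _)) lerXn2r ?nnegrE//.
  by rewrite (le_trans (abs_sin_le _))// normrM (ger0_norm (_ : 0 <= 2^-1 :> R))//; lra.
have -> : (1 / 2 : R) ^+ 2 = 1 / 4 by field.
lra.
Qed.

Lemma abs_sin_ge y : `|y| <= 1 -> `|y| / 2 <= `|sin y|.
Proof.
have csin : continuous (sin : R -> R) by exact: continuous_sin.
wlog y0 : y / 0 <= y => [H|].
  have [/H//|y0] := lerP 0 y.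
  by have := H (- y); rewrite sinN !normrN; apply; lra.
rewrite le_eqVlt in y0; case/orP : y0 => [/eqP <- _|y0].
  by rewrite sin0 normr0 mul0r.
rewrite gtr0_norm// => y1.
have [c cI E] := @MVT R sin cos 0 y y0 (fun x _ => is_derive_sin x) (continuous_subspaceT csin).
move: E; rewrite sin0 !subr0 => ->; move: cI; rewrite in_itv/= => /andP[c0 cy].
have hc : 1 / 2 <= cos c by apply: cos_ge_half; rewrite gtr0_norm//; lra.
rewrite normrM (gtr0_norm y0) ger0_norm; last by lra.
by nra.
Qed.

(** Multiplying by cis b - 1 telescopes the sum to a quantity of norm at most 2, and |cis b - 1| >=
    |sin b| >= |b| / 2. *)
Lemma geometric_cis_le a b n : 0 < `|b| -> `|b| <= 1 ->
  normc (\sum_(i < n) cis (a + b * i%:R)) <= 4 / `|b|.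
Proof.
move=> b0 b1; set S := \sum_(i < n) _.
have ES : (cis b - 1) * S = cis (a + b * n%:R) - cis a.
  rewrite /S; elim: n {S} => [|n ih]; first by rewrite big_ord0 mulr0 mulr0 addr0 subrr.
  rewrite big_ord_recr /= mulrDr ih -natr1 mulrDr mulr1 addrA (cisD (a + _)) mulrBl mul1r.
  by rewrite [cis b * _]mulrC; ring.
have nb : `|b| / 2 <= normc (cis b - 1).
  apply: (le_trans (abs_sin_ge b1)); apply: le_trans (Im_le_normc _).
  by rewrite ImD ImN /= oppr0 addr0.
have n2 : normc (cis b - 1) * normc S <= 2.
  rewrite -normcM ES (le_trans (normcB_le _ _))// !normc_cis; lra.
rewrite ler_pdivlMr//; have := normc_ge0 S; nra.
Qed.

Definition harm n : R := \sum_(1 <= h < n) h%:R^-1.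

Lemma harm_ge1 n : (1 < n)%N -> 1 <= harm n.
Proof.
move=> n1; rewrite /harm big_ltn// invr1 lerDl sumr_ge0//.
Qed.

Lemma harm_le m n : (m <= n)%N -> harm m <= harm n.
Proof.
case: m => [|m] mn; first by rewrite /harm big_geq// sumr_ge0//.
by rewrite /harm [leRHS](big_cat_nat _ (n := m.+1))//= lerDl sumr_ge0//.
Qed.

(** Each dyadic range of indices contributes at most 1. *)
Lemma harm_pow2 m : harm (2 ^ m) <= m%:R.
Proof.
elim: m => [|m ih]; first by rewrite /harm big_geq.
rewrite /harm (big_cat_nat _ (n := (2 ^ m)%N)) ?expn_gt0 ?leq_exp2l//= -natr1 lerD//.
apply: (@le_trans _ _ (\sum_(2 ^ m <= h < 2 ^ m.+1) (2 ^ m)%:R^-1)).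
  rewrite !big_nat; apply: ler_sum => h /andP[h1 _].
  by rewrite lef_pV2 ?posrE ?ltr0n ?expn_gt0// ?ler_nat// (leq_trans _ h1)// expn_gt0.
rewrite big_const_nat iter_addr_0 expnS mul2n -addnn addnK -[leLHS]mulr_natl divff ?pnatr_eq0 -?lt0n ?expn_gt0//.
Qed.

Definition kernel1 n y t : R[i] := \sum_(a <- zrange n) cis (a%:~R * y - a%:~R ^+ 2 * t).

(** At lag h the correlation is a geometric sum of angle 2 h t, and |t| <= 1/(4n) keeps this angle
    at most 1, so the sum is at most 2 / (h |t|). Summing over h gives 4 [harm] / |t|; the diagonal
    term 2n is at most 1 / (2 |t|) and raises the constant to 5. *)
Lemma kernel1_le n y t : (0 < n)%N -> 0 < `|t| -> `|t| <= (4 * n%:R)^-1 ->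
  normc (kernel1 n y t) ^+ 2 <= 5 * harm (2 * n) / `|t|.
Proof.
move=> n0 t0 tn.
have nR : 0 < n%:R :> R by rewrite ltr0n.
have tn' : `|t| * (4 * n%:R) <= 1 by rewrite -ler_pdivlMr ?mulr_gt0// mul1r.
(* The i-th element of [zrange] is the frequency i - (n - 1). *)
pose al := n%:R - 1 : R.
pose z i := cis ((i%:R - al) * y - (i%:R - al) ^+ 2 * t).
have -> : kernel1 n y t = \sum_(i < (2 * n).-1) z i.
  rewrite /kernel1 /zrange big_map -[iota 0 _]/(iota 0 ((2 * n).-1)) -(subn0 (2 * n).-1) -/(index_iota 0 _) big_mkord subn0.
  apply: eq_bigr => i _; rewrite /z /al; congr cis.
  by rewrite intrD intrB -!pmulrn; ring.
apply: (le_trans (van_der_corput_le _ _)); first by move=> i; exact: normc_cis.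
have hH := @harm_ge1 (2 * n) ltac:(lia).
apply: (@le_trans _ _ (2 * n%:R + 2 * \sum_(1 <= h < 2 * n) (2 / `|t| * h%:R^-1))).
  apply: lerD; first by rewrite -natrM ler_nat leq_pred.
  rewrite ler_pM2l//.
  apply: (@le_trans _ _ (\sum_(1 <= h < (2 * n).-1) (2 / `|t| * h%:R^-1))).
    rewrite !big_nat; apply: ler_sum => h /andP[h1 hn].
    have hR : 0 < h%:R :> R by rewrite ltr0n.
    have -> : autocorr z (2 * n).-1 h = \sum_(i < (2 * n).-1 - h)
        cis ((h%:R * y - (h%:R ^+ 2 - 2 * h%:R * al) * t) + (- (2 * h%:R * t)) * i%:R).
      apply: eq_bigr => i _; rewrite /z -cisN -cisD natrD; congr cis; ring.
    have nb : `|- (2 * h%:R * t)| = 2 * h%:R * `|t|.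
      by rewrite normrN normrM ger0_norm// mulr_ge0.
    have h2n : h%:R <= 2 * n%:R :> R by rewrite -natrM ler_nat; lia.
    apply: le_trans (geometric_cis_le _ _ _ _) _.
    - by rewrite nb !mulr_gt0.
    - by rewrite nb; nra.
    - rewrite nb le_eqVlt; apply/orP; left; apply/eqP; field.
      by rewrite !gt_eqF.
  rewrite [leRHS](big_cat_nat _ (n := (2 * n).-1)) /=; [|lia|lia].
  rewrite lerDl; apply: sumr_ge0 => h _; apply: mulr_ge0; last by rewrite invr_ge0.
  by rewrite divr_ge0.
rewrite -mulr_sumr -/(harm (2 * n)) ler_pdivlMr// mulrDl.
have -> : 2 * (2 / `|t| * harm (2 * n)) * `|t| = 4 * harm (2 * n) by field; rewrite gt_eqF.
lra.
Qed.

Definition kernel2 n (x : R * R) t : R[i] := \sum_(k <- box n)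
  cis (k.1%:~R * x.1 + k.2%:~R * x.2 - (k.1%:~R ^+ 2 + k.2%:~R ^+ 2) * t).

Lemma kernel2E n x t : kernel2 n x t = kernel1 n x.1 t * kernel1 n x.2 t.
Proof.
rewrite /kernel2 big_allpairs_dep /= /kernel1 mulr_suml; apply: eq_bigr => a _.
rewrite mulr_sumr; apply: eq_bigr => b _; rewrite -cisD; congr cis; ring.
Qed.

(** The kernel factors into two one-dimensional ones, each of size |t|^(-1/2) up to a logarithm;
    their product has the dispersive decay of dimension two. *)
Lemma kernel2_le n x t : (0 < n)%N -> 0 < `|t| -> `|t| <= (4 * n%:R)^-1 ->
  normc (kernel2 n x t) <= 5 * harm (2 * n) / `|t|.
Proof.
move=> n0 t0 tn; rewrite kernel2E normcM.
have := kernel1_le x.1 n0 t0 tn; have := kernel1_le x.2 n0 t0 tn.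
set a := normc _; set b := normc _; have := sqr_ge0 (a - b); nra.
Qed.

Lemma kernel2_triv n x t : normc (kernel2 n x t) <= 4 * n%:R ^+ 2.
Proof.
rewrite (le_trans (normc_sum _ _ _))//; under eq_bigr do rewrite normc_cis.
by rewrite big_const_seq count_predT iter_addr_0 -natrX -natrM ler_nat size_box.
Qed.

End weyl_sums.

(** * The TT* method for one sample point per time cell *)

Section discrete_strichartz.
Context {R : realType}.
Implicit Types (B : R).

(** With z = T c and d = T* z, Schur's test gives |d|^2 <= B |z|^2. Expanding |B c - d|^2 >= 0 and
    using that the inner product of c and d is |z|^2 yields |z|^2 <= B |c|^2, without any operator
    norm or division by |z|. *)
Lemma tt_star (K : Type) (s : seq K) (M : nat) (E : 'I_M -> K -> R[i]) B (c : K -> R[i]) :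
  0 < B ->
  (forall m, \sum_(m' < M) normc (\sum_(k <- s) E m k * conjc (E m' k)) <= B) ->
  \sum_(m < M) normc (\sum_(k <- s) c k * E m k) ^+ 2 <=
  B * \sum_(k <- s) normc (c k) ^+ 2.
Proof.
move=> B0 EB; pose z m := \sum_(k <- s) c k * E m k.
pose kap m m' := normc (\sum_(k <- s) E m k * conjc (E m' k)).
have kapC m m' : kap m m' = kap m' m.
  rewrite /kap -normc_conjc rmorph_sum; congr normc; apply: eq_bigr => k _.
  by rewrite rmorphM /= conjcK mulrC.
pose d k := \sum_(m < M) z m * conjc (E m k).
set Q := \sum_(m < M) _; set S := \sum_(k <- s) _.
have QE : \sum_(k <- s) complex.Re (c k * conjc (d k)) = Q.
  rewrite -Re_sum; under eq_bigr do rewrite /d rmorph_sum mulr_sumr.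
  rewrite exchange_big /= Re_sum; apply: eq_bigr => m _.
  rewrite -[RHS]Re_mulc_conjc -/(z m) {2}/z mulr_suml; congr complex.Re.
  by apply: eq_bigr => k _; rewrite rmorphM /= conjcK; ring.
have dQ : \sum_(k <- s) normc (d k) ^+ 2 <= B * Q.
  have -> : \sum_(k <- s) normc (d k) ^+ 2 =
      complex.Re (\sum_(m < M) \sum_(m' < M) (z m * conjc (z m')) *
        (\sum_(k <- s) E m' k * conjc (E m k))).
    under eq_bigr do rewrite -Re_mulc_conjc.
    rewrite -Re_sum; congr complex.Re.
    under [RHS]eq_bigr do under eq_bigr do rewrite mulr_sumr.
    under [RHS]eq_bigr do rewrite exchange_big.
    rewrite [RHS]exchange_big /=; apply: eq_bigr => k _.
    rewrite /d rmorph_sum mulr_suml; apply: eq_bigr => m _.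
    rewrite mulr_sumr; apply: eq_bigr => m' _.
    by rewrite rmorphM /= conjcK; ring.
  apply: (le_trans (ler_norm _)); apply: (le_trans (Re_le_normc _)).
  (* Schur's test: the product of two values of z is split into half squares, and the symmetry of
     [kap] lets the row bound serve for columns as well. *)
  apply: (@le_trans _ _ (\sum_(m < M) \sum_(m' < M)
      (normc (z m) ^+ 2 / 2 * kap m m' + normc (z m') ^+ 2 / 2 * kap m' m))).
    apply: (le_trans (normc_sum _ _ _)); apply: ler_sum => m _.
    apply: (le_trans (normc_sum _ _ _)); apply: ler_sum => m' _.
    rewrite !normcM normc_conjc -/(kap m' m) (kapC m m') -mulrDl.
    rewrite ler_wpM2r ?normc_ge0//.
    by have := sqr_ge0 (normc (z m) - normc (z m')); nra.
  rewrite (eq_bigr (fun m => \sum_(m' < M) normc (z m) ^+ 2 / 2 * kap m m' +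
    \sum_(m' < M) normc (z m') ^+ 2 / 2 * kap m' m)); last by move=> m _; rewrite big_split.
  rewrite big_split /= [X in _ + X]exchange_big /= -big_split /=.
  rewrite mulr_sumr; apply: ler_sum => m _; rewrite -mulr_sumr -/(z m).
  have := ler_wpM2l (sqr_ge0 (normc (z m))) (EB m).
  rewrite -/(kap m _); set T := \sum_(m' < M) _; lra.
have S0 : 0 <= S by apply: sumr_ge0 => k _; exact: sqr_ge0.
have : 0 <= \sum_(k <- s) normc (B%:C * c k - d k) ^+ 2 by apply: sumr_ge0 => k _; exact: sqr_ge0.
have -> : \sum_(k <- s) normc (B%:C * c k - d k) ^+ 2 =
    B ^+ 2 * S - 2 * B * Q + \sum_(k <- s) normc (d k) ^+ 2.
  rewrite /S -QE !mulr_sumr -sumrB -big_split /=; apply: eq_bigr => k _.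
  rewrite sqr_normcB normcM normc_real exprMn real_normK ?num_real//.
  rewrite -mulrA ReM /= mul0r subr0; ring.
move=> H; rewrite -(ler_pM2l B0).
rewrite expr2 in H; lra.
Qed.

(** With truncated subtraction the argument of [kap] is |m - m'|, and each distance occurs at most
    twice. *)
Lemma sum_dist_le (kap : nat -> R) n m : (forall d, 0 <= kap d) -> (m < n)%N ->
  \sum_(m' < n) kap ((m - m') + (m' - m))%N <= 2 * \sum_(d < n) kap d.
Proof.
move=> k0 mn; rewrite -(big_mkord xpredT (fun m' => kap ((m - m') + (m' - m))%N)).
rewrite -(big_mkord xpredT kap) (big_cat_nat _ (n := m))//=; last exact: ltnW.
rewrite mulrDl mul1r; apply: lerD.
  apply: (@le_trans _ _ (\sum_(0 <= i < m.+1) kap i)).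
    rewrite [leRHS]big_nat_rev /= add0n big_nat_recr //= subSS subnn.
    rewrite !big_nat (eq_bigr (fun i => kap (m.+1 - i.+1)%N)) ?lerDl//.
    by move=> i /andP[_ im]; congr kap; lia.
  by rewrite [leRHS](big_cat_nat _ (n := m.+1))//= lerDl sumr_ge0.
apply: (@le_trans _ _ (\sum_(0 <= i < n - m) kap i)).
  rewrite -{1}(add0n m) big_addn; apply: ler_sum => i _.
  by rewrite le_eqVlt; apply/orP; left; apply/eqP; congr kap; lia.
by rewrite [leRHS](big_cat_nat _ (n := (n - m)%N)) ?leq_subr//= lerDl sumr_ge0.
Qed.

Definition schr (k : int * int) (t : R) (x : R * R) : R[i] :=
  cis (k.1%:~R * x.1 + k.2%:~R * x.2 - (k.1%:~R ^+ 2 + k.2%:~R ^+ 2) * t).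

(** Times from cells at distance d >= 2 are at least (d - 1) tau apart, so the decay of the kernel
    applies and its sum over d yields the second logarithm. Cells at distance 0 or 1 use the trivial
    bound 4 n^2. *)
Lemma kernel_cells n (tau al : R) (t : 'I_n -> R) (x : 'I_n -> R * R) (m : 'I_n) :
  0 < tau -> n%:R * tau <= (4 * n%:R)^-1 ->
  (forall m : 'I_n, m%:R * tau <= t m - al <= m.+1%:R * tau) ->
  \sum_(m' < n) normc (kernel2 n ((x m).1 - (x m').1, (x m).2 - (x m').2) (t m - t m')) <=
  14 * harm (2 * n) ^+ 2 / tau.
Proof.
move=> tau0 ntau tm.
have n0 : (0 < n)%N by case: (n) m => // -[].
have nR : 0 < n%:R :> R by rewrite ltr0n.
set H := harm (2 * n); have H1 : 1 <= H by apply: harm_ge1; lia.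
pose kap d : R := if (d <= 1)%N then 4 * n%:R ^+ 2 else 5 * H / (d.-1%:R * tau).
have kap0 d : 0 <= kap d.
  rewrite /kap; case: ifP => _; first by rewrite mulr_ge0 ?sqr_ge0.
  by rewrite divr_ge0// mulr_ge0//; lra.
apply: (@le_trans _ _ (\sum_(m' < n) kap ((m - m') + (m' - m))%N)).
  apply: ler_sum => m' _; rewrite /kap; case: ifPn => [_|]; first exact: kernel2_triv.
  rewrite -ltnNge => d2.
  have /andP[l1 u1] := tm m; have /andP[l2 u2] := tm m'.
  have dt : ((m - m') + (m' - m)).-1%:R * tau <= `|t m - t m'|.
    have [mm|mm] := leqP m m'.
      have -> : (((m - m') + (m' - m)).-1%:R : R) = m'%:R - m.+1%:R.
        by rewrite -natrB; [congr (_%:R); lia|lia].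
      by rewrite distrC (le_trans _ (ler_norm _))//; lra.
    have -> : (((m - m') + (m' - m)).-1%:R : R) = m%:R - m'.+1%:R.
      by rewrite -natrB; [congr (_%:R); lia|lia].
    by rewrite (le_trans _ (ler_norm _))//; lra.
  have p0 : 0 < ((m - m') + (m' - m)).-1%:R * tau by rewrite mulr_gt0// ltr0n; lia.
  have dt0 : 0 < `|t m - t m'| by exact: lt_le_trans dt.
  apply: (le_trans (kernel2_le _ n0 dt0 _)).
    apply: le_trans ntau.
    have hm : m.+1%:R * tau <= n%:R * tau by rewrite ler_pM2r// ler_nat.
    have hm' : m'.+1%:R * tau <= n%:R * tau by rewrite ler_pM2r// ler_nat.
    have m0 : 0 <= m%:R * tau by rewrite mulr_ge0// ltW.
    have m'0 : 0 <= m'%:R * tau by rewrite mulr_ge0// ltW.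
    by rewrite ler_norml; apply/andP; split; lra.
  rewrite -/H ler_pM2l; last by lra.
  by rewrite lef_pV2 ?posrE.
apply: (le_trans (sum_dist_le kap0 (ltn_ord m))).
have Sk : \sum_(d < n) kap d <= 8 * n%:R ^+ 2 + 5 * H / tau * harm n.
  rewrite -(big_mkord xpredT kap).
  have h1 : 0 <= harm n :> R by apply: sumr_ge0 => h _; rewrite invr_ge0.
  have q0 : 0 <= 5 * H / tau by rewrite divr_ge0 ?ltW//; lra.
  have [n1|n1] := leqP n 1.
    rewrite big_ltn// big_geq// addr0 /kap /=.
    by have := mulr_ge0 q0 h1; have := sqr_ge0 (n%:R : R); lra.
  rewrite big_ltn; last lia.
  rewrite big_ltn; last lia.
  rewrite {1 2}/kap /= addrA; apply: lerD; first by lra.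
  rewrite /harm mulr_sumr.
  apply: (@le_trans _ _ (\sum_(1 <= d < n.-1) 5 * H / tau * d%:R^-1)).
    rewrite -{1}(prednK n0) big_add1 /= !big_nat le_eqVlt; apply/orP; left; apply/eqP.
    apply: eq_bigr => d /andP[d1 _]; rewrite /kap ltnNge d1 /=.
    by field; rewrite !gt_eqF// ltr0n.
  rewrite [leRHS](big_cat_nat _ (n := n.-1)) /=; [|lia|lia].
  by rewrite lerDl sumr_ge0// => d _; rewrite mulr_ge0// invr_ge0.
have hH : harm n <= H :> R by apply: harm_le; lia.
have nt : 16 * n%:R ^+ 2 <= 4 / tau.
  (* The condition n tau <= 1/(4n) converts the trivial terms 16 n^2 into 4 / tau; together with
     twice 5 / tau this makes the constant 14. *)
  move: ntau; rewrite -[X in _ <= X]mul1r !ler_pdivlMr ?mulr_gt0//; nra.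
have q0 : 0 < 5 * H / tau by rewrite divr_gt0//; lra.
have : 5 * H / tau * harm n <= 5 * H / tau * H by rewrite ler_pM2l.
have : 4 / tau <= 4 * H ^+ 2 / tau by rewrite ler_pM2r ?invr_gt0//; nra.
have -> : 14 * H ^+ 2 / tau = 4 * H ^+ 2 / tau + 2 * (5 * H / tau * H) by field; rewrite gt_eqF.
lra.
Qed.

Lemma strichartz_discrete n (tau al : R) (t : 'I_n -> R) (x : 'I_n -> R * R)
    (c : int * int -> R[i]) :
  (0 < n)%N -> 0 < tau -> n%:R * tau <= (4 * n%:R)^-1 ->
  (forall m : 'I_n, m%:R * tau <= t m - al <= m.+1%:R * tau) ->
  \sum_(m < n) normc (\sum_(k <- box n) c k * schr k (t m) (x m)) ^+ 2 <=
  14 * harm (2 * n) ^+ 2 / tau * \sum_(k <- box n) normc (c k) ^+ 2.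
Proof.
move=> n0 tau0 ntau tm; apply: tt_star.
  have H1 : 1 <= harm (2 * n) :> R by apply: harm_ge1; lia.
  by rewrite divr_gt0// mulr_gt0// exprn_gt0//; lra.
move=> m; apply: le_trans (kernel_cells x m tau0 ntau tm).
apply: ler_sum => m' _; rewrite le_eqVlt; apply/orP; left; apply/eqP; congr normc.
by apply: eq_bigr => k _; rewrite /schr -cisN -cisD; congr cis; rewrite /=; ring.
Qed.

End discrete_strichartz.

(** * The Strichartz estimate in L^2 of time with forcing *)

Section integral_strichartz.
Context {R : realType}.
Local Notation leb := (@lebesgue_measure R).
Implicit Types (a b t : R).

Definition ccont (f : R -> R[i]) :=
  continuous (fun t => complex.Re (f t)) /\ continuous (fun t => complex.Im (f t)).

Lemma ccont_cst z : ccont (fun=> z).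
Proof. by split=> t; exact: cvg_cst. Qed.

Lemma ccontD f g : ccont f -> ccont g -> ccont (fun t => f t + g t).
Proof.
move=> [f1 f2] [g1 g2]; split=> t.
  by under eq_fun do rewrite ReD; apply: cvgD; [exact: f1|exact: g1].
by under eq_fun do rewrite ImD; apply: cvgD; [exact: f2|exact: g2].
Qed.

Lemma ccontM f g : ccont f -> ccont g -> ccont (fun t => f t * g t).
Proof.
move=> [f1 f2] [g1 g2]; split=> t.
  under eq_fun do rewrite ReM.
  by apply: cvgB; apply: cvgM; [exact: f1|exact: g1|exact: f2|exact: g2].
under eq_fun do rewrite ImM.
by apply: cvgD; apply: cvgM; [exact: f1|exact: g2|exact: f2|exact: g1].
Qed.

Lemma ccont_sum I (s : seq I) (F : I -> R -> R[i]) : (forall i, ccont (F i)) ->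
  ccont (fun t => \sum_(i <- s) F i t).
Proof.
move=> cF; elim: s => [|i s ih]; first by under eq_fun do rewrite big_nil; exact: ccont_cst.
by under eq_fun do rewrite big_cons; exact: ccontD.
Qed.

Lemma ccont_cis (u : R -> R) : continuous u -> ccont (fun t => cis (u t)).
Proof.
move=> cu; split=> t; apply: (@continuous_comp _ _ _ u); try exact: cu.
  exact: continuous_cos.
exact: continuous_sin.
Qed.

Lemma ccont_conjc f : ccont f -> ccont (fun t => conjc (f t)).
Proof.
move=> [f1 f2]; split=> t; first by under eq_fun do rewrite Re_conjc; exact: f1.
by under eq_fun do rewrite Im_conjc; apply: cvgN; exact: f2.
Qed.

Lemma ccont_sqr_normc f : ccont f -> continuous (fun t => normc (f t) ^+ 2).
Proof.
move=> [f1 f2] t; under eq_fun do rewrite sqr_normcE !expr2.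
by apply: cvgD; apply: cvgM; [exact: f1|exact: f1|exact: f2|exact: f2].
Qed.

Lemma ccont_normc f : ccont f -> continuous (fun t => normc (f t)).
Proof.
move=> cf t.
rewrite (_ : (fun t => normc (f t)) = Num.sqrt \o (fun t => normc (f t) ^+ 2)).
  by apply: continuous_comp; [exact: ccont_sqr_normc|exact: sqrt_continuous].
by apply/funext => y /=; rewrite sqrtr_sqr ger0_norm ?normc_ge0.
Qed.

Lemma ccont_cintble f a b : ccont f -> cintble leb `[a, b] f.
Proof. by move=> [f1 f2]; split; exact: continuous_integrable_itv. Qed.

Lemma continuousD_fun (u v : R -> R) : continuous u -> continuous v ->
  continuous (fun t => u t + v t).
Proof. by move=> cu cv t; apply: cvgD; [exact: cu|exact: cv]. Qed.

Lemma continuousM_fun (u v : R -> R) : continuous u -> continuous v ->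
  continuous (fun t => u t * v t).
Proof. by move=> cu cv t; apply: cvgM; [exact: cu|exact: cv]. Qed.

Lemma continuous_cst_fun (z : R) : continuous (fun _ : R => z).
Proof. by move=> t; exact: cvg_cst. Qed.

Lemma continuousX_fun (u : R -> R) n : continuous u -> continuous (fun t => u t ^+ n).
Proof.
move=> cu; elim: n => [|n ih]; first by under eq_fun do rewrite expr0; exact: continuous_cst_fun.
by under eq_fun do rewrite exprS; exact: continuousM_fun.
Qed.

Lemma continuous_sum_fun I (s : seq I) (F : I -> R -> R) : (forall i, continuous (F i)) ->
  continuous (fun t => \sum_(i <- s) F i t).
Proof.
move=> cF; elim: s => [|i s ih]; first by under eq_fun do rewrite big_nil; exact: continuous_cst_fun.
by under eq_fun do rewrite big_cons; exact: continuousD_fun.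
Qed.

Lemma Rintegral_sum_cont I (s : seq I) (F : I -> R -> R) a b : (forall i, continuous (F i)) ->
  \int[leb]_(t in `[a, b]) (\sum_(i <- s) F i t) = \sum_(i <- s) \int[leb]_(t in `[a, b]) F i t.
Proof.
move=> cF; elim: s => [|i s ih].
  by under eq_Rintegral do rewrite big_nil; rewrite big_nil Rintegral_cst// mul0r.
under eq_Rintegral do rewrite big_cons.
rewrite big_cons RintegralD// ?ih//; apply: continuous_integrable_itv => //.
exact: continuous_sum_fun.
Qed.

(** The integral of (f - l)^2, with l the mean value of f, is nonnegative. *)
Lemma Rintegral_cauchy_schwarz f a b : continuous f -> a <= b ->
  (\int[leb]_(t in `[a, b]) f t) ^+ 2 <= (b - a) * \int[leb]_(t in `[a, b]) f t ^+ 2.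
Proof.
move=> cf; rewrite le_eqVlt => /predU1P[->|ab].
  by rewrite set_itv1 !Rintegral_set1 expr0n mulr0.
set I := \int[leb]_(t in _) f t; set J := \int[leb]_(t in _) _.
have ba : 0 < b - a by rewrite subr_gt0.
pose l := I / (b - a).
have cf2 : continuous (fun t => f t ^+ 2) by exact: continuousX_fun.
have cl : continuous (fun t => 2 * l * f t).
  by apply: continuousM_fun => //; exact: continuous_cst_fun.
have H : 0 <= \int[leb]_(t in `[a, b]) (f t ^+ 2 - 2 * l * f t + l ^+ 2).
  apply: Rintegral_ge0 => t _.
  by have := sqr_ge0 (f t - l); rewrite sqrrB mulr2n; lra.
have E : \int[leb]_(t in `[a, b]) (f t ^+ 2 - 2 * l * f t + l ^+ 2) =
    J - 2 * l * I + l ^+ 2 * (b - a).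
  rewrite RintegralD//; last 2 first.
  - apply: (@continuous_integrable_itv _ (fun t => f t ^+ 2 - 2 * l * f t)).
    apply: (@continuousD_fun _ (fun t => - (2 * l * f t))) => // t.
    by apply: cvgN; exact: cl.
  - apply: (@continuous_integrable_itv _ (fun=> l ^+ 2)); exact: continuous_cst_fun.
  rewrite RintegralB//; [|exact: continuous_integrable_itv..].
  rewrite RintegralZl//; last exact: continuous_integrable_itv.
  by rewrite Rintegral_itv_cst// ltW.
move: H; rewrite E /l => H.
have : 0 <= (J - 2 * (I / (b - a)) * I + (I / (b - a)) ^+ 2 * (b - a)) * (b - a).
  by rewrite mulr_ge0// ltW.
have -> : (J - 2 * (I / (b - a)) * I + (I / (b - a)) ^+ 2 * (b - a)) * (b - a) =
  (b - a) * J - I ^+ 2 by field; rewrite gt_eqF.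
by rewrite subr_ge0.
Qed.

Lemma Rintegral_cells f (al tau : R) n : continuous f -> 0 <= tau ->
  \int[leb]_(t in `[al, al + n%:R * tau]) f t =
  \sum_(m < n) \int[leb]_(t in `[al + m%:R * tau, al + m.+1%:R * tau]) f t.
Proof.
move=> cf t0; elim: n => [|n ih].
  by rewrite big_ord0 mul0r addr0 set_itv1 Rintegral_set1.
rewrite big_ord_recr /= -ih; apply: Rintegral_split => //.
  by rewrite lerDl mulr_ge0.
by rewrite lerD2l ler_wpM2r// ler_nat.
Qed.

(** The integral of h^2 is at most tau times the sum of its maxima over n cells of length tau, which
    reduces it to sample points. At these the solution is the data part [A] plus the Duhamel part
    [B]. The discrete estimate handles [A] directly, and [B] after Cauchy-Schwarz in time: for fixed
    s it applies to the coefficients g k s with the same sample points. *)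
Lemma strichartz_integral n (al be G : R) (c g : int * int -> R -> R[i]) (h : R -> R) :
  (0 < n)%N -> al < be -> be - al <= (4 * n%:R)^-1 ->
  (forall k, ccont (g k)) ->
  (forall k t, al <= t <= be -> c k t = c k al + cintegral leb `[al, t] (g k)) ->
  (forall s, al <= s <= be -> \sum_(k <- box n) normc (g k s) ^+ 2 <= G) ->
  continuous h -> (forall t, 0 <= h t) ->
  (forall t, al <= t <= be -> exists x,
     h t <= 2 * normc (\sum_(k <- box n) c k t * schr k t x)) ->
  \int[leb]_(t in `[al, be]) (h t ^+ 2) <=
  112 * harm (2 * n) ^+ 2 *
    (\sum_(k <- box n) normc (c k al) ^+ 2 + (be - al) ^+ 2 * G).
Proof.
move=> n0 albe ben cg cE gG ch h0 hU.
have nR : 0 < n%:R :> R by rewrite ltr0n.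
pose de := be - al; have de0 : 0 < de by rewrite subr_gt0.
pose tau := de / n%:R; have tau0 : 0 < tau by rewrite divr_gt0.
have ntau : n%:R * tau = de by rewrite /tau mulrC divfK// gt_eqF.
have beE : be = al + n%:R * tau by rewrite ntau /de addrC subrK.
have ch2 : continuous (fun t => h t ^+ 2) by exact: continuousX_fun.
have cell m : (m < n)%N -> al <= al + m%:R * tau /\ al + m.+1%:R * tau <= be.
  move=> mn; rewrite beE lerDl mulr_ge0 ?(ltW tau0)//; split => //.
  by rewrite lerD2l ler_pM2r// ler_nat.
have step (m : nat) : al + m%:R * tau <= al + m.+1%:R * tau.
  by rewrite lerD2l ler_pM2r// ler_nat.
have /choice[tx txP] : forall m : 'I_n, exists tx : R * (R * R),
    [/\ m%:R * tau <= tx.1 - al <= m.+1%:R * tau,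
        forall s, al + m%:R * tau <= s <= al + m.+1%:R * tau -> h s ^+ 2 <= h tx.1 ^+ 2 &
        h tx.1 <= 2 * normc (\sum_(k <- box n) c k tx.1 * schr k tx.1 tx.2)].
  move=> m; have [l1 l2] := cell m (ltn_ord m).
  have [t tI tmax] := EVT_max (step m) (continuous_subspaceT ch2).
  move: tI; rewrite in_itv/= => /andP[t1 t2].
  have [|x hx] := hU t; first by rewrite (le_trans l1 t1) (le_trans t2 l2).
  by exists (t, x); split => //=; apply/andP; split; lra.
pose t m := (tx m).1; pose x m := (tx m).2.
have tI m : al <= t m <= be.
  have [/andP[a1 a2] _ _] := txP m; have [b1 b2] := cell m (ltn_ord m).
  by rewrite /t; apply/andP; split; lra.
pose E m k := schr k (t m) (x m).
pose A m := \sum_(k <- box n) c k al * E m k.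
pose bm (m : 'I_n) s := \sum_(k <- box n) g k s * E m k.
pose B m := cintegral leb `[al, t m] (bm m).
have cbm m : ccont (bm m).
  by apply: ccont_sum => k; apply: ccontM => //; exact: ccont_cst.
have UE m : \sum_(k <- box n) c k (t m) * E m k = A m + B m.
  rewrite /A /B /bm cintegral_sum//; last first.
    by move=> k; apply: ccont_cintble; apply: ccontM => //; exact: ccont_cst.
  rewrite -big_split /=; apply: eq_bigr => k _.
  rewrite (cE k _ (tI m)) mulrDl; congr (_ + _).
  rewrite (_ : (fun s => g k s * E m k) = (fun s => E m k * g k s)); last first.
    by apply/funext => s; rewrite mulrC.
  by rewrite cintegralZ//; [rewrite mulrC|exact: ccont_cintble].
pose Q : R := 14 * harm (2 * n) ^+ 2 / tau.
have Q0 : 0 <= Q by rewrite divr_ge0 ?(ltW tau0)// mulr_ge0// sqr_ge0.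
have ntau' : n%:R * tau <= (4 * n%:R)^-1 by rewrite ntau.
have tP (m : 'I_n) : m%:R * tau <= t m - al <= m.+1%:R * tau by have [] := txP m.
have disc c' := strichartz_discrete x c' n0 tau0 ntau' tP.
have SA : \sum_(m < n) normc (A m) ^+ 2 <= Q * \sum_(k <- box n) normc (c k al) ^+ 2.
  exact: disc.
have cbm2 m : continuous (fun s => normc (bm m s) ^+ 2) by exact: ccont_sqr_normc.
have cbm1 m : continuous (fun s => normc (bm m s)) by exact: ccont_normc.
have G0 : 0 <= G.
  by apply: le_trans (gG al _); [apply: sumr_ge0 => k _; exact: sqr_ge0|rewrite lexx ltW].
have SB : \sum_(m < n) normc (B m) ^+ 2 <= de ^+ 2 * (Q * G).
  (* The upper limit t m depends on m; once norms are taken inside, it can be enlarged to be, and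
     sum and integral commute. *)
  apply: (@le_trans _ _ (\sum_(m < n) de * \int[leb]_(s in `[al, be]) normc (bm m s) ^+ 2)).
    apply: ler_sum => m _; have /andP[t1 t2] := tI m.
    apply: le_trans (Rintegral_cauchy_schwarz (cbm1 m) (ltW albe)).
    rewrite lerXn2r ?nnegrE ?normc_ge0//.
      by apply: Rintegral_ge0 => s _; exact: normc_ge0.
    apply: le_trans (normc_cintegral _ _) _ => //; first exact: ccont_cintble.
    rewrite [leRHS](Rintegral_split (cbm1 m) t1 t2) lerDl.
    by apply: Rintegral_ge0 => s _; exact: normc_ge0.
  rewrite -mulr_sumr expr2 -mulrA ler_pM2l//.
  rewrite -Rintegral_sum_cont//.
  have -> : de * (Q * G) = \int[leb]_(s in `[al, be]) (Q * G).
    by rewrite Rintegral_itv_cst ?(ltW albe)// mulrC.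
  apply: Rintegral_le.
  - by apply: continuous_sum_fun.
  - exact: continuous_cst_fun.
  - move=> s sI; apply: le_trans (disc (fun k => g k s)) _.
    by rewrite ler_wpM2l// gG.
rewrite [in leLHS]beE Rintegral_cells//; last exact: ltW.
apply: (@le_trans _ _ (\sum_(m < n) tau * (8 * normc (A m) ^+ 2 + 8 * normc (B m) ^+ 2))).
  apply: ler_sum => m _.
  have [_ hmax hx] := txP m.
  apply: (@le_trans _ _ (tau * h (t m) ^+ 2)).
    apply: (@le_trans _ _ (\int[leb]_(s in `[al + m%:R * tau, al + m.+1%:R * tau]) (h (t m) ^+ 2))).
      by apply: Rintegral_le => //; exact: continuous_cst_fun.
    rewrite Rintegral_itv_cst//.
    rewrite le_eqVlt; apply/orP; left; apply/eqP.
    by rewrite -natr1; ring.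
  rewrite ler_pM2l//; move: hx; rewrite -/(t m) -/(x m) UE => hx.
  have hn := h0 (t m); have := normc_triangle (A m) (B m).
  have := normc_ge0 (A m); have := normc_ge0 (B m); have := normc_ge0 (A m + B m).
  set u := normc (A m); set v := normc (B m); set w := normc _ => w0 v0 u0 wuv.
  (* The square of the factor 2 in the choice of the point, times 2 for splitting A + B, gives 8;
     with the 14 of the discrete estimate this is 112. *)
  apply: (@le_trans _ _ (4 * w ^+ 2)).
    have -> : 4 * w ^+ 2 = (2 * w) ^+ 2 by ring.
    by rewrite lerXn2r ?nnegrE// mulr_ge0.
  by have := sqr_ge0 (u - v); nra.
rewrite -mulr_sumr big_split /= -!mulr_sumr.
have tQ : tau * Q = 14 * harm (2 * n) ^+ 2 by rewrite /Q; field; rewrite gt_eqF.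
move: SA SB; set SA' := \sum_(m < n) _; set SB' := \sum_(m < n) _; set S := \sum_(k <- _) _.
move=> hA hB; apply: (@le_trans _ _ (tau * (8 * (Q * S) + 8 * (de ^+ 2 * (Q * G))))).
  by rewrite ler_pM2l//; lra.
have -> : tau * (8 * (Q * S) + 8 * (de ^+ 2 * (Q * G))) = 8 * (tau * Q) * (S + de ^+ 2 * G) by ring.
rewrite tQ le_eqVlt; apply/orP; left; apply/eqP; rewrite /de; ring.
Qed.

End integral_strichartz.

(** * A class of smooth functions of time *)

Section smooth_functions.
Context {R : realType}.
Local Notation leb := (@lebesgue_measure R).
Implicit Types (f g : R -> R) (t a b : R).

(** The classical flat function exp(-1/t), with powers of 1/t in front so that the family is closed
    under differentiation up to linear combinations. *)
Definition rho n t : R := if 0 < t then t^-1 ^+ n * expR (- t^-1) else 0.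

Lemma rho_ge0 n t : 0 <= rho n t.
Proof.
rewrite /rho; case: ifP => // t0; rewrite mulr_ge0 ?expR_ge0// exprn_ge0//.
by rewrite invr_ge0 ltW.
Qed.

Lemma rho_le0 n t : t <= 0 -> rho n t = 0.
Proof. by rewrite /rho ltNge => ->. Qed.

Lemma rhoE n t : 0 < t -> rho n t = t^-1 ^+ n * expR (- t^-1).
Proof. by rewrite /rho => ->. Qed.

Lemma pow_le_exp n (y : R) : 0 <= y -> y ^+ n <= n%:R ^+ n * expR y.
Proof.
move=> y0; case: n => [|n]; first by rewrite !expr0 mul1r (le_trans _ (expR_ge1Dx _))// lerDl.
have n0 : 0 < n.+1%:R :> R by [].
have -> : expR y = expR (y / n.+1%:R) ^+ n.+1.
  by rewrite -expRM_natl; congr expR; rewrite mulrC divfK// gt_eqF.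
rewrite -exprMn lerXn2r ?nnegrE// ?mulr_ge0 ?expR_ge0//.
rewrite -ler_pdivrMl// mulrC (le_trans _ (expR_ge1Dx _))// lerDr//.
Qed.

Lemma rho_le_lin n t : 0 <= t -> rho n t <= n.+1%:R ^+ n.+1 * t.
Proof.
rewrite le_eqVlt => /predU1P[<-|t0]; first by rewrite rho_le0// mulr0.
rewrite rhoE// expRN ler_pdivrMr ?expR_gt0//.
have y0 : 0 <= t^-1 by rewrite invr_ge0 ltW.
have := pow_le_exp n.+1 y0; rewrite exprSr -ler_pdivlMr ?invr_gt0// invrK.
by rewrite mulrAC.
Qed.

Lemma is_derive_rho_pos n t : 0 < t ->
  is_derive t 1 (fun t => t^-1 ^+ n * expR (- t^-1)) (rho n.+2 t - n%:R * rho n.+1 t).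
Proof.
move=> t0; have tn0 : t != 0 by rewrite gt_eqF.
have dV : is_derive t 1 (fun t => t^-1) (- t ^- 2).
  apply: is_derive_eq (@is_deriveV R id t 1 1 tn0 (is_derive_id _ _)) _.
  by rewrite /GRing.scale /= mulr1.
have dN : is_derive t 1 (fun t => - t^-1) (t ^- 2).
  by apply: is_derive_eq (@is_deriveN _ _ _ _ t 1 _ dV) _; rewrite opprK.
have dE : is_derive t 1 (fun t => expR (- t^-1)) (expR (- t^-1) * t ^- 2).
  by have := @is_derive1_comp _ _ _ t _ _ (is_derive_expR (- t^-1)) dN.
have dX : is_derive t 1 (fun t => t^-1 ^+ n) (n%:R * t^-1 ^+ n.-1 * - t ^- 2).
  have -> : (fun t : R => t^-1 ^+ n) = (fun t => t^-1) ^+ n.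
    by apply/funext => s; rewrite !fctE.
  apply: is_derive_eq (@is_deriveX _ _ _ n t 1 _ dV) _.
  by rewrite /GRing.scale /=.
apply: is_derive_eq (@is_deriveM _ _ _ _ t 1 _ _ dX dE) _.
rewrite !rhoE// /GRing.scale /= -!exprVn.
case: n {dX} => [|n] /=; first by rewrite !mul0r mulr0 addr0 subr0 expr0 mul1r mulrC.
rewrite !(exprS _ n.+2) !(exprS _ n.+1) !(exprS _ n) expr2; ring.
Qed.

Lemma is_derive_rho n t : is_derive t 1 (rho n) (rho n.+2 t - n%:R * rho n.+1 t).
Proof.
have [t0|t0|->] := ltgtP t 0.
- rewrite !rho_le0 ?(ltW t0)// mulr0 subr0.
  apply: (near_eq_is_derive _ (is_derive_cst 0 t 1)).
  by near=> s; rewrite rho_le0// ltW//; near: s; exact: lt_nbhsl.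
- have h := is_derive_rho_pos n t0.
  apply: (near_eq_is_derive _ h).
  by near=> s; rewrite rhoE//; near: s; exact: lt_nbhsr.
- rewrite !rho_le0// mulr0 subr0.
  have H : h^-1 *: (rho n (h *: 1 + 0) - rho n 0) @[h --> 0^'] --> (0 : R).
    apply/cvgrPdist_le => e e0.
    pose K : R := n.+2%:R ^+ n.+2; have K0 : 0 < K by rewrite exprn_gt0.
    near=> h.
    have h0 : h != 0 by near: h; exact: nbhs_dnbhs_neq.
    rewrite sub0r normrN addr0 (rho_le0 _ (lexx 0)) subr0 /GRing.scale /= mulr1.
    have [hp|hn] := ltrP 0 h; last by rewrite rho_le0// mulr0 normr0 ltW.
    (* The difference quotient at 0 is again a member of the family, and [rho_le_lin] makes it
       O(h). *)
    have -> : h^-1 * rho n h = rho n.+1 h by rewrite !rhoE// exprS mulrA.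
    rewrite ger0_norm ?rho_ge0//; apply: (le_trans (rho_le_lin _ (ltW hp))).
    rewrite -/K -ler_pdivlMl//.
    have he : `|h| <= K^-1 * e.
      near: h; apply: nbhs_dnbhs.
      by apply: (@nbhs0_le _ R^o); rewrite mulr_gt0// invr_gt0.
    by rewrite gtr0_norm in he.
  apply: DeriveDef; first by apply/cvg_ex; exists 0.
  by apply/cvg_lim.
Unshelve. all: by end_near. Qed.

(** Every member has a derivative in the class, so all derivatives exist. The constructor
    [sfun_prim] admits the primitive of a difference of bumps, for which no closed formula is at
    hand. *)
Inductive sfun : (R -> R) -> Prop :=
| sfun_rho n a b : sfun (fun t => rho n (a * t + b))
| sfun_cst a : sfun (fun=> a)
| sfunD f g : sfun f -> sfun g -> sfun (fun t => f t + g t)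
| sfunM f g : sfun f -> sfun g -> sfun (fun t => f t * g t)
| sfun_prim f g : (forall t, is_derive t 1 f (g t)) -> sfun g -> sfun f.

Lemma sfun_derive f : sfun f -> exists2 g, sfun g & forall t, is_derive t 1 f (g t).
Proof.
elim=> {f} [n a b|a|f g _ [f' sf' df] _ [g' sg' dg]|f g sf [f' sf' df] sg [g' sg' dg]|f g df sg _].
- exists (fun t => (rho n.+2 (a * t + b) + - n%:R * rho n.+1 (a * t + b)) * a).
    apply: sfunM; last exact: sfun_cst.
    by apply: sfunD; [exact: sfun_rho|apply: sfunM; [exact: sfun_cst|exact: sfun_rho]].
  move=> t.
  have dl : is_derive t 1 (fun t => a * t + b) a.
    have h := @is_deriveZ _ _ _ _ a t 1 _ (is_derive_id t (1 : R)).
    apply: is_derive_eq (@is_deriveD _ _ _ _ _ t 1 _ _ h (is_derive_cst b t 1)) _.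
    by rewrite /GRing.scale /= mulr1 addr0.
  rewrite mulNr.
  exact: (@is_derive1_comp _ _ _ t _ _ (is_derive_rho n (a * t + b)) dl).
- by exists (fun=> 0); [exact: sfun_cst|move=> t; exact: is_derive_cst].
- exists (fun t => f' t + g' t); first exact: sfunD.
  by move=> t; exact: (@is_deriveD _ _ _ _ _ t 1 _ _ (df t) (dg t)).
- exists (fun t => f t * g' t + g t * f' t); first by apply: sfunD; exact: sfunM.
  by move=> t; exact: (@is_deriveM _ _ _ _ t 1 _ _ (df t) (dg t)).
- by exists g.
Qed.

Lemma is_derive_continuous f g : (forall t : R, is_derive t 1 f (g t)) -> continuous f.
Proof.
move=> df t; apply/differentiable_continuous/derivable1_diffP.
by have [] := df t.
Qed.

Lemma sfun_continuous f : sfun f -> continuous f.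
Proof. by move=> /sfun_derive[g _]; exact: is_derive_continuous. Qed.

End smooth_functions.

(** * Continuous functions with a continuous weak derivative *)

Section weak_derivative.
Context {R : realType}.
Local Notation leb := (@lebesgue_measure R).
Implicit Types (f g : R -> R) (t a b e : R).

(** Composing with the nearest-point map extends a curve on [a, b] to all times, so that continuity
    within the interval becomes continuity on the line. *)
Definition clamp a b t : R := Num.min b (Num.max a t).

Lemma clamp_itv a b t : a <= b -> a <= clamp a b t <= b.
Proof. by move=> ab; rewrite /clamp le_min ab le_max lexx /= ge_min lexx. Qed.

Lemma clamp_id a b t : a <= t <= b -> clamp a b t = t.
Proof. by move=> /andP[at_ tb]; rewrite /clamp (max_r at_) (min_r tb). Qed.

Lemma clamp_continuous a b : continuous (clamp a b).
Proof.
move=> t; apply/cvgrPdist_le => e e0; near=> s.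
apply: (@le_trans _ _ `|t - s|); last first.
  by near: s; apply: cvgr_dist_le => //; exact: cvg_id.
have h1 := ler_norm (t - s).
have h2 : s - t <= `|t - s| by rewrite distrC ler_norm.
have key : - `|t - s| <= clamp a b t - clamp a b s <= `|t - s|.
  by rewrite /clamp /Num.min /Num.max; case: (ltrP a t) => ?; case: (ltrP a s) => ?;
    case: ltrP => ?; case: ltrP => ?; apply/andP; split; lra.
by rewrite ler_norml.
Unshelve. all: by end_near. Qed.

Lemma eq_Rintegral_itv f g a b : (forall t, a <= t <= b -> f t = g t) ->
  \int[leb]_(t in `[a, b]) f t = \int[leb]_(t in `[a, b]) g t.
Proof. by move=> fg; apply: eq_Rintegral => t /set_mem/=; rewrite in_itv/=; exact: fg. Qed.

Lemma Rintegral_itv_eq0 f a b : (forall t, a <= t <= b -> f t = 0) ->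
  \int[leb]_(t in `[a, b]) f t = 0.
Proof. by move=> /eq_Rintegral_itv ->; rewrite Rintegral_cst// mul0r. Qed.

Lemma Rintegral_eq_support f a b a' b' : continuous f -> a <= a' -> a' <= b' -> b' <= b ->
  (forall t, t < a' -> f t = 0) -> (forall t, b' < t -> f t = 0) ->
  \int[leb]_(t in `[a, b]) f t = \int[leb]_(t in `[a', b']) f t.
Proof.
move=> cf aa ab bb fa fb.
rewrite (Rintegral_split cf aa (le_trans ab bb)) (Rintegral_split cf ab bb).
have fa' : f a' = 0.
  apply/eqP; rewrite -normr_eq0; apply/negP => /negP fa0.
  have f0 : 0 < `|f a'| by rewrite lt_neqAle eq_sym fa0 normr_ge0.
  have /cvgrPdist_lt /(_ _ f0) [d /= d0 H] := cf a'.
  have := H (a' - d / 2); rewrite /ball_ /= opprB addrC subrK gtr0_norm ?divr_gt0//.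
  rewrite (fa (a' - d / 2)); last by rewrite gtrBl divr_gt0.
  by rewrite subr0 ltxx => h; have := h ltac:(lra).
have fb' : f b' = 0.
  apply/eqP; rewrite -normr_eq0; apply/negP => /negP fb0.
  have f0 : 0 < `|f b'| by rewrite lt_neqAle eq_sym fb0 normr_ge0.
  have /cvgrPdist_lt /(_ _ f0) [d /= d0 H] := cf b'.
  have := H (b' + d / 2); rewrite /ball_ /= opprD addrA subrr sub0r normrN gtr0_norm ?divr_gt0//.
  rewrite (fb (b' + d / 2)); last by rewrite ltrDl divr_gt0.
  by rewrite subr0 ltxx => h; have := h ltac:(lra).
rewrite (@Rintegral_itv_eq0 f a a'); last first.
  by move=> t /andP[_]; rewrite le_eqVlt => /predU1P[->//|]; exact: fa.
rewrite (@Rintegral_itv_eq0 f b' b); last first.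
  by move=> t /andP[+ _]; rewrite le_eqVlt => /predU1P[<-//|]; exact: fb.
by rewrite add0r addr0.
Qed.

Lemma exists_bump t1 e : 0 < e -> exists h : R -> R, [/\ sfun h, forall t, 0 <= h t,
  (forall t, t <= t1 - e -> h t = 0) /\ (forall t, t1 + e <= t -> h t = 0) &
  \int[leb]_(t in `[t1 - e, t1 + e]) h t = 1].
Proof.
(* The two factors vanish to the left of t1 - e and to the right of t1 + e. On the middle half both
   are at least [r], which makes the mass positive and normalization possible. *)
move=> e0; pose h0 t := rho 0 (1 * t + (e - t1)) * rho 0 (-1 * t + (t1 + e)).
have sh0 : sfun h0 by apply: sfunM; exact: sfun_rho.
have ch0 := sfun_continuous sh0.
have h0_ge0 t : 0 <= h0 t by rewrite mulr_ge0 ?rho_ge0.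
pose r : R := rho 0 (e / 2).
have r0 : 0 < r by rewrite /r rhoE ?divr_gt0// expr0 mul1r expR_gt0.
have rm t : e / 2 <= t -> r <= rho 0 t.
  move=> et; have t0 : 0 < t by apply: lt_le_trans et; rewrite divr_gt0.
  rewrite /r !rhoE ?divr_gt0// !expr0 !mul1r ler_expR lerN2 lef_pV2 ?posrE ?divr_gt0//.
set m := \int[leb]_(t in `[t1 - e, t1 + e]) h0 t.
have m0 : 0 < m.
  apply: (@lt_le_trans _ _ (r ^+ 2 * e)); first by rewrite mulr_gt0 ?exprn_gt0.
  rewrite /m (@Rintegral_split _ h0 _ (t1 - e / 2))//; [|lra|lra].
  rewrite (@Rintegral_split _ h0 (t1 - e / 2) (t1 + e / 2))//; [|lra|lra].
  rewrite (_ : r ^+ 2 * e = 0 + (\int[leb]_(t in `[t1 - e / 2, t1 + e / 2]) (r ^+ 2) + 0)); last first.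
    rewrite add0r addr0 Rintegral_itv_cst; last lra.
    by congr (_ * _); field.
  apply: lerD; first by apply: Rintegral_ge0.
  apply: lerD; last by apply: Rintegral_ge0.
  apply: Rintegral_le => //; first exact: continuous_cst_fun.
  move=> t /andP[ta tb]; rewrite /h0 expr2 ler_pM ?(ltW r0)//; apply: rm; lra.
exists (fun t => m^-1 * h0 t); split.
- by apply: sfunM => //; exact: sfun_cst.
- by move=> t; rewrite mulr_ge0// invr_ge0 ltW.
- split=> t ht; rewrite /h0.
    by rewrite (@rho_le0 _ 0 (1 * t + (e - t1))) ?mul0r ?mulr0//; lra.
  by rewrite (@rho_le0 _ 0 (-1 * t + (t1 + e))) ?mulr0//; lra.
- rewrite RintegralZl//; last exact: continuous_integrable_itv.
  by rewrite mulVf// gt_eqF.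
Qed.

Lemma is_derive_Rintegral f a x : continuous f -> a < x ->
  is_derive x 1 (fun y => \int[leb]_(t in `[a, y]) f t) (f x).
Proof.
move=> cf ax.
have x1 : x < x + 1 by rewrite ltrDl.
have ax' : (a%:E < x%:E)%E by rewrite lte_fin.
have [d1 d2] := continuous_FTC1 x1 (continuous_integrable_itv a (x + 1) cf) ax' (cf x).
by apply: (DeriveDef d1); rewrite -d2 derive1E.
Qed.

Definition test1 (T : R) (psi zeta : R -> R) :=
  [/\ sfun zeta, forall t, is_derive t 1 psi (zeta t) &
    exists a b, [/\ 0 < a, b < T & forall t, t \notin `[a, b] -> psi t = 0]].

(** The primitive of the difference of two bumps is a test function: beyond both supports the unit
    masses cancel. It starts at -1, safely to the left of the supports. *)
Lemma exists_test1 (T : R) t1 t2 e (h1 h2 : R -> R) : 0 < e -> 0 < t1 - e -> 0 < t2 - e ->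
  t1 + e < T -> t2 + e < T -> sfun h1 -> sfun h2 ->
  (forall t, t <= t1 - e -> h1 t = 0) /\ (forall t, t1 + e <= t -> h1 t = 0) ->
  (forall t, t <= t2 - e -> h2 t = 0) /\ (forall t, t2 + e <= t -> h2 t = 0) ->
  \int[leb]_(t in `[t1 - e, t1 + e]) h1 t = 1 ->
  \int[leb]_(t in `[t2 - e, t2 + e]) h2 t = 1 ->
  exists psi, test1 T psi (fun t => h1 t + -1 * h2 t).
Proof.
move=> e0 a1 a2 b1 b2 s1 s2 [h1l h1r] [h2l h2r] i1 i2.
pose z t := h1 t + -1 * h2 t.
have sz : sfun z by apply: sfunD => //; apply: sfunM => //; exact: sfun_cst.
have cz := sfun_continuous sz.
have c1 := sfun_continuous s1; have c2 := sfun_continuous s2.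
pose psi y := \int[leb]_(t in `[-1, y]) z t.
pose a := Num.min (t1 - e) (t2 - e); pose b := Num.max (t1 + e) (t2 + e).
have a0 : 0 < a by rewrite /a lt_min a1 a2.
have aE : a <= t1 - e /\ a <= t2 - e by rewrite /a !ge_min !lexx orbT.
have bE : t1 + e <= b /\ t2 + e <= b by rewrite /b !le_max !lexx orbT.
have bT : b < T by rewrite /b gt_max b1 b2.
have psil y : y < a -> psi y = 0.
  move=> ya; apply: Rintegral_itv_eq0 => t /andP[_ ty].
  by rewrite /z h1l ?h2l ?mulr0 ?addr0//; lra.
exists psi; split => //.
- move=> t; have [ta|ta] := ltrP t a; last by apply: is_derive_Rintegral => //; lra.
  rewrite -/(z t) (_ : z t = 0); last by rewrite /z h1l ?h2l ?mulr0 ?addr0//; lra.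
  apply: (near_eq_is_derive _ (is_derive_cst 0 t 1)).
  by near=> s; rewrite psil//; near: s; exact: lt_nbhsl.
- exists a, b; split => // t; rewrite in_itv/= negb_and -!ltNge => /orP[/psil//|bt].
  rewrite /psi RintegralD//; last 2 first.
  + exact: continuous_integrable_itv.
  + apply: (@continuous_integrable_itv _ (fun t => -1 * h2 t)).
    by apply: continuousM_fun => //; exact: continuous_cst_fun.
  rewrite RintegralZl//; last exact: continuous_integrable_itv.
  rewrite (@Rintegral_eq_support h1 _ _ (t1 - e) (t1 + e))//; try lra; last 2 first.
  + by move=> s hs; apply: h1l; exact: ltW.
  + by move=> s hs; apply: h1r; exact: ltW.
  rewrite (@Rintegral_eq_support h2 _ _ (t2 - e) (t2 + e))//; try lra; last 2 first.
  + by move=> s hs; apply: h2l; exact: ltW.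
  + by move=> s hs; apply: h2r; exact: ltW.
Unshelve. all: by end_near. Qed.

(** Unit bumps concentrated at t1 and t2 approximate the two values of D, and their difference is
    the derivative of a test function. *)
Lemma du_bois_reymond (T : R) (D : R -> R) : continuous D ->
  (forall psi zeta, test1 T psi zeta -> \int[leb]_(t in `[0, T]) (zeta t * D t) = 0) ->
  forall t1 t2, 0 < t1 < T -> 0 < t2 < T -> D t1 = D t2.
Proof.
move=> cD HD t1 t2 /andP[t10 t1T] /andP[t20 t2T].
apply/eqP; rewrite -subr_eq0 -normr_le0; apply/ler_addgt0Pl => d d0; rewrite addr0.
have d20 : 0 < d / 2 by rewrite divr_gt0.
have /cvgrPdist_le /(_ _ d20) [e1 /= e10 H1] := cD t1.
have /cvgrPdist_le /(_ _ d20) [e2 /= e20 H2] := cD t2.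
have [e [[e0 ee1 ee2] [l1 l2 u1 u2]]] : exists e, [/\ 0 < e, e < e1 & e < e2] /\
    [/\ 0 < t1 - e, 0 < t2 - e, t1 + e < T & t2 + e < T].
  pose m := Num.min (Num.min e1 e2) (Num.min (Num.min t1 t2) (Num.min (T - t1) (T - t2))).
  have m0 : 0 < m by rewrite /m !lt_min e10 e20 t10 t20 !subr_gt0 t1T t2T.
  have : m <= m by []; rewrite {2}/m !le_min => /andP[/andP[? ?] /andP[/andP[? ?] /andP[? ?]]].
  by exists (m / 2); split; split; lra.
have [h1 [s1 p1 z1 i1]] := exists_bump t1 e0.
have [h2 [s2 p2 z2 i2]] := exists_bump t2 e0.
have [psi tpsi] := exists_test1 e0 l1 l2 u1 u2 s1 s2 z1 z2 i1 i2.
have := HD _ _ tpsi.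
have c1 := sfun_continuous s1; have c2 := sfun_continuous s2.
have key (h : R -> R) (t0 : R) : continuous h -> (forall t, 0 <= h t) -> 0 < t0 - e -> t0 + e < T ->
    (forall t, t <= t0 - e -> h t = 0) /\ (forall t, t0 + e <= t -> h t = 0) ->
    \int[leb]_(t in `[t0 - e, t0 + e]) h t = 1 ->
    (forall t, `|t0 - t| <= e -> `|D t0 - D t| <= d / 2) ->
    `|\int[leb]_(t in `[0, T]) (h t * D t) - D t0| <= d / 2.
  move=> ch h0 lo hi [hl hr] hi1; set d2 := d / 2 => Dd.
  rewrite (@Rintegral_eq_support (fun t => h t * D t) _ _ (t0 - e) (t0 + e)); try lra; last 3 first.
  - exact: continuousM_fun.
  - by move=> t ht; rewrite hl ?mul0r// ltW.
  - by move=> t ht; rewrite hr ?mul0r// ltW.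
  rewrite -[X in _ - X]mul1r -hi1 -RintegralZr//; last exact: continuous_integrable_itv.
  rewrite -RintegralB//; last 2 first.
  - by apply: (@continuous_integrable_itv _ (fun t => h t * D t)); exact: continuousM_fun.
  - apply: (@continuous_integrable_itv _ (fun t => h t * D t0)).
    by apply: continuousM_fun => //; exact: continuous_cst_fun.
  have cB : continuous (fun t => h t * D t - h t * D t0).
    move=> t; apply: cvgB; first exact: continuousM_fun.
    by apply: continuousM_fun => //; exact: continuous_cst_fun.
  apply: (le_trans (le_normr_Rintegral _ _)) => //; first exact: continuous_integrable_itv.
  rewrite -[leRHS]mulr1 -hi1 -RintegralZl//; last exact: continuous_integrable_itv.
  apply: Rintegral_le.
  - by move=> t; apply: cvg_norm; exact: cB.
  - by apply: continuousM_fun => //; exact: continuous_cst_fun.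
  - move=> t /andP[ta tb]; rewrite -mulrBr normrM ger0_norm// mulrC ler_wpM2r//.
    rewrite distrC; apply: Dd; rewrite ler_norml; apply/andP; split; lra.
have k1 := key h1 t1 c1 p1 l1 u1 z1 i1.
have k2 := key h2 t2 c2 p2 l2 u2 z2 i2.
have {}k1 : `|\int[leb]_(t in `[0, T]) (h1 t * D t) - D t1| <= d / 2.
  by apply: k1 => t ht; apply: H1; rewrite /ball_ /=; exact: le_lt_trans ht ee1.
have {}k2 : `|\int[leb]_(t in `[0, T]) (h2 t * D t) - D t2| <= d / 2.
  by apply: k2 => t ht; apply: H2; rewrite /ball_ /=; exact: le_lt_trans ht ee2.
have -> : \int[leb]_(t in `[0, T]) ((h1 t + -1 * h2 t) * D t) =
    \int[leb]_(t in `[0, T]) (h1 t * D t) - \int[leb]_(t in `[0, T]) (h2 t * D t).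
  rewrite -RintegralB//; last 2 first.
  - by apply: (@continuous_integrable_itv _ (fun t => h1 t * D t)); exact: continuousM_fun.
  - by apply: (@continuous_integrable_itv _ (fun t => h2 t * D t)); exact: continuousM_fun.
  by apply: eq_Rintegral_itv => t _; ring.
move: k1 k2; set I1 := \int[leb]_(t in _) _; set I2 := \int[leb]_(t in _) _.
rewrite !ler_norml => /andP[? ?] /andP[? ?] ?; apply/andP; split; lra.
Qed.

(** C minus a primitive of g has vanishing weak derivative, hence is constant in the open interval,
    and by continuity up to the end points, which test functions do not see. *)
Lemma weak_derivative (T : R) (C g : R -> R) : 0 < T -> continuous C -> continuous g ->
  (forall psi zeta, test1 T psi zeta ->
    \int[leb]_(t in `[0, T]) (zeta t * C t) = - \int[leb]_(t in `[0, T]) (psi t * g t)) ->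
  forall t0 t, 0 <= t0 -> t0 <= t -> t <= T ->
  C t = C t0 + \int[leb]_(s in `[t0, t]) g s.
Proof.
move=> T0 cC cg H.
pose G (y : R) : R := \int[leb]_(s in `[-1, y]) g s.
have dG (y : R) : -1 < y -> is_derive y 1 G (g y) by exact: is_derive_Rintegral.
have cG (y : R) : -1 < y -> {for y, continuous G}.
  by move=> y1; apply/differentiable_continuous/derivable1_diffP; have [] := dG y y1.
(* The primitive [G] is controlled to the right of -1 only; clamping makes the difference continuous
   on the whole line. *)
pose D (y : R) : R := C (clamp 0 T y) - G (clamp 0 T y).
have clI (y : R) := clamp_itv y (ltW T0).
have cD : continuous D.
  move=> y; have /andP[c0 cT] := clI y; apply: cvgB.
    by apply: (@continuous_comp _ _ _ (clamp 0 T)); [exact: clamp_continuous|exact: cC].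
  by apply: (@continuous_comp _ _ _ (clamp 0 T)); [exact: clamp_continuous|apply: cG; lra].
have DE (y : R) : 0 <= y <= T -> D y = C y - G y by move=> yT; rewrite /D clamp_id.
have cGcl : continuous (fun y => G (clamp 0 T y)).
  move=> y; have /andP[c0 cT] := clI y.
  by apply: (@continuous_comp _ _ _ (clamp 0 T)); [exact: clamp_continuous|apply: cG; lra].
have D0 psi zeta : test1 T psi zeta -> \int[leb]_(t in `[0, T]) (zeta t * D t) = 0.
  move=> tp; have := H _ _ tp; have [sz dp [a [b [a0 bT supp]]]] := tp.
  have cz := sfun_continuous sz; have cp := is_derive_continuous dp.
  have -> : \int[leb]_(t in `[0, T]) (zeta t * D t) =
     \int[leb]_(t in `[0, T]) (zeta t * C t) - \int[leb]_(t in `[0, T]) (zeta t * G (clamp 0 T t)).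
    rewrite -RintegralB//; last 2 first.
    - by apply: (@continuous_integrable_itv _ (fun t => zeta t * C t)); exact: continuousM_fun.
    - by apply: (@continuous_integrable_itv _ (fun t => zeta t * G (clamp 0 T t))); exact: continuousM_fun.
    apply: eq_Rintegral_itv => t tT.
    by rewrite DE// (clamp_id tT) mulrBr.
  move=> ->.
  rewrite (@eq_Rintegral_itv (fun t => zeta t * G (clamp 0 T t)) (fun t => G t * zeta t)); last first.
    by move=> t tT; rewrite (clamp_id tT) mulrC.
  have p0 : psi 0 = 0 by apply: supp; rewrite in_itv/= negb_and -ltNge a0.
  have pT : psi T = 0 by apply: supp; rewrite in_itv/= negb_and -!ltNge bT orbT.
  rewrite (@Rintegration_by_parts _ G psi g zeta 0 T)//.
  - rewrite p0 pT !mulr0 subrr sub0r.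
    rewrite (@eq_Rintegral_itv (fun t => psi t * g t) (fun t => g t * psi t)) ?subrr//.
    by move=> t _; rewrite mulrC.
  - exact: continuous_subspaceT.
  - split.
    + by move=> y; rewrite in_itv/= => /andP[y0 _]; have [] := dG y ltac:(lra).
    + by apply: cvg_at_right_filter; apply: cG; lra.
    + by apply: cvg_at_left_filter; apply: cG; lra.
  - move=> y; rewrite in_itv/= => /andP[y0 _]; rewrite derive1E.
    by have [_ ->] := dG y ltac:(lra).
  - exact: continuous_subspaceT.
  - split.
    + by move=> y _; have [] := dp y.
    + exact/cvg_at_right_filter/cp.
    + exact/cvg_at_left_filter/cp.
  - by move=> y _; rewrite derive1E; have [_ ->] := dp y.
have Dc := du_bois_reymond cD D0.
have half : 0 < T / 2 < T by apply/andP; split; lra.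
have Dconst (y : R) : 0 <= y <= T -> D y = D (T / 2).
  move=> yT.
  have inner (s : R) : 0 < s < T -> D s = D (T / 2) by move=> sT; exact: Dc.
  (* These points lie on the segment from y to the midpoint T/2, hence inside (0, T) even if y is an
     end point. *)
  pose q (n : nat) : R := y + (T / 2 - y) * n.+1%:R^-1.
  have qI n : 0 < q n < T.
    have h0 : 0 < n.+1%:R^-1 :> R by rewrite invr_gt0.
    have h1 : n.+1%:R^-1 <= 1 :> R by rewrite invf_le1// ler1n.
    rewrite /q; set r := n.+1%:R^-1 in h0 h1 *.
    have y0 : 0 <= y by lra.
    have Ty : 0 <= T - y by lra.
    have T20 : 0 < T / 2 by lra.
    have : 0 <= y * (1 - r) by apply: mulr_ge0 => //; lra.
    have : 0 <= (T - y) * (1 - r) by apply: mulr_ge0 => //; lra.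
    have : 0 < T / 2 * r by apply: mulr_gt0.
    by move=> ? ? ?; apply/andP; split; nra.
  have qy : q @ \oo --> y.
    rewrite -[X in _ --> X]addr0 -(mulr0 (T / 2 - y)); apply: cvgD; first exact: cvg_cst.
    apply: cvgM; first exact: cvg_cst.
    exact: cvg_harmonic.
  have h1 : (D \o q) @ \oo --> D y by apply: continuous_cvg => //; exact: cD.
  have h2 : (D \o q) @ \oo --> D (T / 2).
    rewrite (_ : D \o q = cst (D (T / 2))); first exact: cvg_cst.
    by apply/funext => n /=; apply: inner.
  exact: (cvg_unique _ h1 h2).
move=> t0 t t00 t0t tT.
have e1 := Dconst t ltac:(by apply/andP; split; lra).
have e2 := Dconst t0 ltac:(by apply/andP; split; lra).
rewrite DE in e1; last by apply/andP; split; lra.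
rewrite DE in e2; last by apply/andP; split; lra.
have : G t = G t0 + \int[leb]_(s in `[t0, t]) g s by apply: Rintegral_split => //; lra.
lra.
Qed.

End weak_derivative.

(** * Test functions with one spatial mode, and the equation for a Fourier coefficient *)

Section test_functions.
Context {R : realType}.
Local Notation spacetime := (R * (R * R))%type.
Implicit Types (p : R -> R) (z v : spacetime).

Definition phase (w a b : R) z : R := w * z.1 + a * z.2.1 + b * z.2.2.

(** A directional derivative is that of a function of one variable at 0, where the one-dimensional
    chain and product rules apply. *)
Lemma is_derive_line (V : normedModType R) (f : V -> R) (v z : V) (d : R) :
  is_derive (0 : R) 1 (fun h => f (h *: v + z)) d -> is_derive z v f d.
Proof.
move=> [fd fe]; apply: (@DeriveDef _ _ _ z v f d).
  by have [_ h] := derivable1P f z v; exact: h.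
rewrite -fe /derive; set g1 := fun h => h^-1 *: _; set g2 := fun h => h^-1 *: _.
suff -> : g1 = g2 by [].
by apply/funext => h /=; rewrite /g1 /g2 /= addr0 scale0r add0r [_%:A]mulr1.
Qed.

Lemma is_derive_mode p p' w a b (c : R) v z : (forall t : R, is_derive t 1 p (p' t)) ->
  is_derive z v (fun z => p z.1 * cos (phase w a b z + c))
    (v.1 * p' z.1 * cos (phase w a b z + c) - phase w a b v * p z.1 * sin (phase w a b z + c)).
Proof.
move=> dp; apply: is_derive_line => /=.
have -> : (fun h : R => p (h * v.1 + z.1) * cos (phase w a b (h *: v + z) + c)) =
   (p \o (fun h => h * v.1 + z.1)) *
   (cos \o (fun h => h * phase w a b v + (phase w a b z + c))).
  apply/funext => h; rewrite fctE /= /phase /= /GRing.scale /=; congr (_ * cos _).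
  ring.
have aff (r s : R) : is_derive (0 : R) 1 (fun h : R => h * r + s) r.
  have -> : (fun h : R => h * r + s) = (r \*: id) + cst s.
    by apply/funext => h; rewrite !fctE /= /GRing.scale /= mulrC.
  by apply: is_derive_eq; rewrite addr0 /GRing.scale /= mulr1.
have d1 : is_derive (0 : R) 1 (p \o (fun h => h * v.1 + z.1)) (p' z.1 * v.1).
  apply: (@is_derive1_comp _ p (fun h => h * v.1 + z.1)).
  by rewrite mul0r add0r.
have d2 : is_derive (0 : R) 1 (cos \o (fun h => h * phase w a b v + (phase w a b z + c)))
    (- sin (phase w a b z + c) * phase w a b v).
  apply: (@is_derive1_comp _ cos (fun h => h * phase w a b v + (phase w a b z + c))).
  by rewrite mul0r add0r; exact: is_derive_cos.
have d3 := @is_deriveM _ _ _ _ (0 : R) 1 _ _ d1 d2.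
apply: (is_derive_eq d3).
rewrite /= !mul0r !add0r /GRing.scale /=; ring.
Qed.

(** The free shift c makes sines available as shifted cosines, so differentiation in any direction
    stays within the class. *)
Inductive tfun : (spacetime -> R) -> Prop :=
| tfun_mode p w a b c : sfun p -> tfun (fun z => p z.1 * cos (phase w a b z + c))
| tfunD f g : tfun f -> tfun g -> tfun (fun z => f z + g z).

Lemma tfun_derive f v : tfun f -> exists2 g, tfun g & forall z, is_derive z v f (g z).
Proof.
elim=> [p w a b c sp|{}f g _ [f' tf df] _ [g' tg dg]]; last first.
  by exists (fun z => f' z + g' z); [exact: tfunD|move=> z; exact: is_deriveD].
have [p' sp' dp] := sfun_derive sp.
exists (fun z => v.1 * p' z.1 * cos (phase w a b z + c) +
    phase w a b v * p z.1 * cos (phase w a b z + (c + pi / 2))).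
  apply: tfunD.
  - apply: (@tfun_mode (fun t => v.1 * p' t)); apply: sfunM => //; exact: sfun_cst.
  - apply: (@tfun_mode (fun t => phase w a b v * p t)); apply: sfunM => //; exact: sfun_cst.
move=> z; apply: is_derive_eq (@is_derive_mode p p' w a b c v z dp) _.
by rewrite addrA [cos (_ + pi / 2)]cosD cos_pihalf sin_pihalf mulr0 mulr1 sub0r mulrN.
Qed.

Lemma phase_continuous w a b c : continuous (fun z => phase w a b z + c).
Proof.
move=> z; apply: cvgD; last exact: cvg_cst.
apply: cvgD; first apply: cvgD; (apply: cvgM; first exact: cvg_cst).
- exact: cvg_fst.
- by apply: (@continuous_comp _ _ _ snd fst); [exact: cvg_snd|exact: cvg_fst].
- by apply: (@continuous_comp _ _ _ snd snd); exact: cvg_snd.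
Qed.

Lemma tfun_continuous f : tfun f -> continuous f.
Proof.
elim=> [p w a b c sp|{}f g _ cf _ cg] z; last by apply: cvgD; [exact: cf|exact: cg].
apply: cvgM.
  by apply: (@continuous_comp _ _ _ fst p); [exact: cvg_fst|exact: sfun_continuous].
apply: (@continuous_comp _ _ _ (fun z => phase w a b z + c) cos).
  exact: phase_continuous.
exact: continuous_cos.
Qed.

Lemma tfun_smooth f : tfun f -> smooth f.
Proof.
move=> tf vs; have [g tg ->] : exists2 g, tfun g & iter_derive vs f = g.
  elim: vs => [|v vs [g tg /= ->]]; first by exists f.
  have [g' tg' dg] := tfun_derive v tg; exists g' => //.
  by apply/funext => z; have [] := dg z.
split; first exact: tfun_continuous.
by move=> v z; have [g' _ dg] := tfun_derive v tg; have [] := dg z.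
Qed.

Definition cmode p w a b z : R[i] := (p z.1)%:C * cis (phase w a b z).

Lemma Re_cmode p w a b z : complex.Re (cmode p w a b z) = p z.1 * cos (phase w a b z + 0).
Proof. by rewrite addr0 [LHS]/= mul0r subr0. Qed.

Lemma Im_cmode p w a b z :
  complex.Im (cmode p w a b z) = p z.1 * cos (phase w a b z + - (pi / 2)).
Proof. by rewrite cosB cos_pihalf sin_pihalf mulr0 mulr1 add0r [LHS]/= mul0r addr0. Qed.

Lemma cderive_cmode p p' w a b v z : (forall t : R, is_derive t 1 p (p' t)) ->
  cderive v (cmode p w a b) z =
  ((v.1 * p' z.1)%:C + 'i%C * (phase w a b v * p z.1)%:C) * cis (phase w a b z).
Proof.
move=> dp; rewrite /cderive.
under eq_fun do rewrite Re_cmode.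
under [X in _ +i* 'D_v X z]eq_fun do rewrite Im_cmode.
have [_ ->] := @is_derive_mode p p' w a b 0 v z dp.
have [_ ->] := @is_derive_mode p p' w a b (- (pi / 2)) v z dp.
rewrite addr0 cosB sinB cos_pihalf sin_pihalf !mulr0 !mulr1 add0r sub0r.
apply: complexP => /=; ring.
Qed.

Lemma cderiveZ (c : R[i]) (f : spacetime -> R[i]) v z :
  derivable (fun z => complex.Re (f z)) z v -> derivable (fun z => complex.Im (f z)) z v ->
  cderive v (fun z => c * f z) z = c * cderive v f z.
Proof.
move=> d1 d2; apply: complexP; rewrite /cderive /=.
  under eq_fun do rewrite ReM.
  have e1 := derivableP d1; have e2 := derivableP d2.
  have := is_deriveB (is_deriveZ (complex.Re c) e1) (is_deriveZ (complex.Im c) e2).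
  by move=> [_ h]; rewrite ReM; exact: h.
under eq_fun do rewrite ImM.
have e1 := derivableP d1; have e2 := derivableP d2.
have := is_deriveD (is_deriveZ (complex.Re c) e2) (is_deriveZ (complex.Im c) e1).
by move=> [_ h]; rewrite ImM; exact: h.
Qed.

Lemma laplacian_cmode p w a b z : sfun p ->
  laplacian (cmode p w a b) z = - (a ^+ 2 + b ^+ 2)%:C * cmode p w a b z.
Proof.
move=> /sfun_derive[p' _ dp].
have key (v : spacetime) : v.1 = 0 -> cderive v (cderive v (cmode p w a b)) z =
    - (phase w a b v ^+ 2)%:C * cmode p w a b z.
  move=> v0.
  have E : cderive v (cmode p w a b) =
      (fun z => 'i%C * (phase w a b v)%:C * cmode p w a b z).
    apply/funext => y; rewrite (cderive_cmode _ _ _ _ _ dp) v0 mul0r /cmode.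
    by apply: complexP => /=; ring.
  rewrite E cderiveZ ?E; first by apply: complexP => /=; ring.
  - under eq_fun do rewrite Re_cmode.
    by have [] := is_derive_mode w a b 0 v z dp.
  - under eq_fun do rewrite Im_cmode.
    by have [] := is_derive_mode w a b (- (pi / 2)) v z dp.
rewrite /laplacian !key// /phase /= !(mulr0, mulr1, addr0, add0r).
by apply: complexP => /=; ring.
Qed.

Lemma dt_cmode p p' w a b z : (forall t : R, is_derive t 1 p (p' t)) ->
  dt (cmode p w a b) z = ((p' z.1)%:C + 'i%C * (w * p z.1)%:C) * cis (phase w a b z).
Proof.
move=> dp; rewrite /dt (cderive_cmode _ _ _ _ _ dp) /phase /= !mulr0 !addr0 mul1r mulr1.
by [].
Qed.

Lemma cmode_test (T : R) p w (k : int * int) : sfun p ->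
  (exists a b, [/\ 0 < a, b < T & forall t, t \notin `[a, b] -> p t = 0]) ->
  test_function T (cmode p w k.1%:~R k.2%:~R).
Proof.
move=> sp [a [b [a0 bT supp]]]; split.
- under eq_fun do rewrite Re_cmode; apply: tfun_smooth; exact: tfun_mode.
- under eq_fun do rewrite Im_cmode; apply: tfun_smooth; exact: tfun_mode.
- have per (n : int) (y : R) : cis (y + n%:~R * (2 * pi)) = cis y.
    by rewrite cisD {2}/cis cos_int2pi sin_int2pi mulr1.
  move=> t x y; rewrite /cmode /phase /=; split; congr (_ * _).
    by rewrite mulrDr addrA (addrAC _ _ (k.2%:~R * y)) per.
  by rewrite mulrDr addrA per.
- exists a, b; split=> // t x tab; rewrite /cmode supp//.
  by rewrite mul0r.
Qed.

Local Notation leb := (@lebesgue_measure R).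
Local Notation leb2 := (leb \x leb)%E.

Lemma cintegral_cmode p w k (f : R * R -> R[i]) t (z : R[i]) : cintble leb2 cell f ->
  cintegral leb2 cell (fun x => f x * (z * cis (phase w (- k.1%:~R) (- k.2%:~R) (t, x)))) =
  ((2 * pi) ^+ 2)%:C * (z * cis (w * t) * fourier f k).
Proof.
move=> fi; rewrite fourierE.
under eq_cintegral => x _.
  rewrite (_ : _ * _ = z * cis (w * t) * (f x * conjc (ek k x))); last first.
    rewrite /phase /ek -cisN /= (_ : _ + _ + _ = w * t + - (k.1%:~R * x.1 + k.2%:~R * x.2)).
      by rewrite cisD; ring.
    ring.
  over.
rewrite cintegralZ; [|exact: measurable_cell|exact: cintble_mul_ek].
set I := cintegral _ _ _.
have -> : ((2 * pi) ^+ 2)%:C * (z * cis (w * t) * (((2 * pi) ^- 2)%:C * I)) =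
    (((2 * pi) ^+ 2)%:C * ((2 * pi) ^- 2)%:C) * (z * cis (w * t) * I) by ring.
by rewrite -rmorphM /= divff ?pi2_neq0// mul1r.
Qed.

(* Writing [w = |k|^2], the test function is [psi(t) exp(i(w t - k.x))]. *)
Lemma NLS_mode (b : bool) (T : R) (u : R -> R * R -> R[i]) k (C F : R -> R[i]) :
  0 < T -> NLS_distr b T u -> ccont C -> ccont F ->
  (forall t, 0 <= t <= T -> [/\ cintble leb2 cell (u t), cintble leb2 cell (cub (u t)),
     C t = fourier (u t) k & F t = fourier (cub (u t)) k]) ->
  let w := k.1%:~R ^+ 2 + k.2%:~R ^+ 2 in
  forall t0 t, 0 <= t0 -> t0 <= t -> t <= T ->
  cis (w * t) * C t = cis (w * t0) * C t0 +
    cintegral leb `[t0, t] (fun s => - 'i%C * (-1) ^+ b * (cis (w * s) * F s)).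
Proof.
move=> T0 eqn cC cF uT w t0 t t00 t0t tT.
have cw : ccont (fun s => cis (w * s)).
  by apply: ccont_cis => s; apply: cvgM; [exact: cvg_cst|exact: cvg_id].
have cD : ccont (fun s => cis (w * s) * C s) by exact: ccontM.
have cG : ccont (fun s => - 'i%C * (-1) ^+ b * (cis (w * s) * F s)).
  by apply: ccontM; [exact: ccont_cst|exact: ccontM].
have key psi zeta : test1 T psi zeta ->
    cintegral leb `[0, T] (fun s => (zeta s)%:C * (cis (w * s) * C s)) =
    - cintegral leb `[0, T] (fun s => (psi s)%:C * (- 'i%C * (-1) ^+ b * (cis (w * s) * F s))).
  move=> [sz dp supp].
  have sp : sfun psi by exact: sfun_prim dp sz.
  have cz : ccont (fun s => (zeta s)%:C).
    by split; [exact: sfun_continuous|move=> s; exact: cvg_cst].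
  have cp : ccont (fun s => (psi s)%:C).
    by split; [exact: sfun_continuous|move=> s; exact: cvg_cst].
  have tst : test_function T (cmode psi w (- k.1%:~R) (- k.2%:~R)).
    by have := cmode_test w (- k.1, - k.2) sp supp; rewrite /= !mulrNz.
  have := eqn _ tst; rewrite /pairing.
  set pi2 : R[i] := ((2 * pi) ^+ 2)%:C.
  have -> : cintegral leb `[0, T] (fun s => cintegral leb2 cell
      (fun x => u s x * dt (cmode psi w (- k.1%:~R) (- k.2%:~R)) (s, x))) =
    cintegral leb `[0, T] (fun s => pi2 *
      (((zeta s)%:C + 'i%C * w%:C * (psi s)%:C) * (cis (w * s) * C s))).
    apply: eq_cintegral => s; rewrite inE/= in_itv/= => /uT[u1 _ -> _].
    have E x : dt (cmode psi w (- k.1%:~R) (- k.2%:~R)) (s, x) =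
        ((zeta s)%:C + 'i%C * (w * psi s)%:C) * cis (phase w (- k.1%:~R) (- k.2%:~R) (s, x)).
      by rewrite (dt_cmode _ _ _ _ dp).
    under eq_cintegral => x _ do rewrite E.
    by rewrite cintegral_cmode// rmorphM; ring.
  have -> : cintegral leb `[0, T] (fun s => cintegral leb2 cell
      (fun x => u s x * laplacian (cmode psi w (- k.1%:~R) (- k.2%:~R)) (s, x))) =
    cintegral leb `[0, T] (fun s => pi2 *
      ((- w%:C * (psi s)%:C) * (cis (w * s) * C s))).
    apply: eq_cintegral => s; rewrite inE/= in_itv/= => /uT[u1 _ -> _].
    have E x : laplacian (cmode psi w (- k.1%:~R) (- k.2%:~R)) (s, x) =
        (- w%:C * (psi s)%:C) * cis (phase w (- k.1%:~R) (- k.2%:~R) (s, x)).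
      by rewrite laplacian_cmode// !sqrrN /cmode mulrA.
    under eq_cintegral => x _ do rewrite E.
    by rewrite cintegral_cmode//; ring.
  have -> : cintegral leb `[0, T] (fun s => cintegral leb2 cell
      (fun x => cubic u s x * cmode psi w (- k.1%:~R) (- k.2%:~R) (s, x))) =
    cintegral leb `[0, T] (fun s => pi2 * ((psi s)%:C * (cis (w * s) * F s))).
    apply: eq_cintegral => s; rewrite inE/= in_itv/= => /uT[_ u1 _ ->].
    have E x : cubic u s x * cmode psi w (- k.1%:~R) (- k.2%:~R) (s, x) =
        cub (u s) x * ((psi s)%:C * cis (phase w (- k.1%:~R) (- k.2%:~R) (s, x))) by [].
    under eq_cintegral => x _ do rewrite E.
    by rewrite cintegral_cmode//; ring.
  have ccZ (z : R[i]) (f : R -> R[i]) : ccont f -> ccont (fun s => z * f s) by move=> ?; apply: ccontM => //; exact: ccont_cst.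
  have ci (f : R -> R[i]) : ccont f -> cintble leb `[0, T] f by move=> ?; exact: ccont_cintble.
  have cI (z : R[i]) (f : R -> R[i]) : ccont f -> cintegral leb `[0, T] (fun s => z * f s) = z * cintegral leb `[0, T] f.
    by move=> cf; rewrite cintegralZ//; exact: ci.
  have cpD := ccontM cp cD.
  have czD := ccontM cz cD.
  have cpF := ccontM cp (ccontM cw cF).
  have -> : (fun s => pi2 * (((zeta s)%:C + 'i%C * w%:C * (psi s)%:C) * (cis (w * s) * C s))) =
      (fun s => pi2 * ((zeta s)%:C * (cis (w * s) * C s) +
        'i%C * w%:C * ((psi s)%:C * (cis (w * s) * C s)))).
    by apply/funext => s; ring.
  have -> : (fun s => pi2 * (- w%:C * (psi s)%:C * (cis (w * s) * C s))) =
      (fun s => pi2 * (- w%:C * ((psi s)%:C * (cis (w * s) * C s)))).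
    by apply/funext => s; ring.
  have -> : (fun s => (psi s)%:C * (- 'i%C * (-1) ^+ b * (cis (w * s) * F s))) =
      (fun s => - 'i%C * (-1) ^+ b * ((psi s)%:C * (cis (w * s) * F s))).
    by apply/funext => s; ring.
  rewrite !cI//; last 2 first.
  - exact: ccZ.
  - by apply: ccontD => //; exact: ccZ.
  rewrite cintegralD//; [|exact: ci|by apply: ci; exact: ccZ].
  rewrite cI//.
  set Z := cintegral _ _ _; set W := cintegral _ _ _; set B := cintegral _ _ _ => eq0.
  have p0 : pi2 != 0 by rewrite /pi2 -(rmorph0 (real_complex R)) fmorph_eq0 pi2_neq0.
  have i2 : 'i%C * 'i%C = -1 :> R[i] by rewrite -expr2 sqr_i.
  (* The time frequency w is chosen so that its contribution cancels that of the Laplacian: the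
     terms with [W] carry the factor i^2 + 1. *)
  have {}eq0 : pi2 * (- 'i%C * Z - ('i%C * 'i%C + 1) * w%:C * W - (-1) ^+ b * B) = 0.
    by move/eqP: eq0; rewrite -subr_eq0 => /eqP <-; ring.
  move/eqP: eq0; rewrite mulf_eq0 (negbTE p0) /= i2 addNr !mul0r subr0 subr_eq0 => /eqP eq0.
  have : 'i%C * (- 'i%C * Z) = 'i%C * ((-1) ^+ b * B) by rewrite eq0.
  rewrite mulrA mulrN i2 opprK mul1r => ->.
  ring.
have Rr (r : R) (z : R[i]) : r * complex.Re z = complex.Re (r%:C * z).
  by case: z => ? ? /=; rewrite mul0r subr0.
have Ir (r : R) (z : R[i]) : r * complex.Im z = complex.Im (r%:C * z).
  by case: z => ? ? /=; rewrite mul0r addr0.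
apply: complexP.
  rewrite ReD; apply: (weak_derivative T0 cD.1 cG.1) => // psi zeta /key /(congr1 (@complex.Re _)).
  rewrite ReN => E.
  transitivity (complex.Re (cintegral leb `[0, T] (fun s => (zeta s)%:C * (cis (w * s) * C s)))).
    by apply: eq_Rintegral => s _; exact: Rr.
  by rewrite E; congr (- _); apply/esym/eq_Rintegral => s _; exact: Rr.
rewrite ImD; apply: (weak_derivative T0 cD.2 cG.2) => // psi zeta /key /(congr1 (@complex.Im _)).
rewrite ImN => E.
transitivity (complex.Im (cintegral leb `[0, T] (fun s => (zeta s)%:C * (cis (w * s) * C s)))).
  by apply: eq_Rintegral => s _; exact: Ir.
by rewrite E; congr (- _); apply/esym/eq_Rintegral => s _; exact: Ir.
Qed.

End test_functions.

(** * Solutions as bounded continuous curves satisfying Duhamel's formula *)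

Section time_continuity.
Context {R : realType}.
Local Notation leb := (@lebesgue_measure R).
Local Notation leb2 := (leb \x leb)%E.
Local Notation cell := (@cell R).
Implicit Types (f g : R * R -> R[i]) (k : int * int) (s : R).

Lemma in_L2_sqint f : in_L2 f -> sqint f.
Proof.
by move=> [m1 m2 ffin]; split => //; apply: cmeasTS; split.
Qed.

(** The base of the weight is at least 1, so the weight of order s dominates that of order 2/3. This
    comparison is where the exponent s enters. *)
Lemma Hs_norm_hbd s f (B : R) : 2 / 3 <= s -> sqint f -> 0 <= B ->
  (Hs_norm s f <= B%:E)%E -> hbd (B ^+ 2) f.
Proof.
move=> hs sf B0 fB; split=> // r ur.
pose a k : \bar R := ((1 + k.1%:~R ^+ 2 + k.2%:~R ^+ 2) `^ s * normc (fourier f k) ^+ 2)%:E.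
have a0 k : (0 <= a k)%E by rewrite lee_fin mulr_ge0 ?sqr_ge0 ?powR_ge0.
have E0 : (\esum_(k in setT) a k <= (B ^+ 2)%:E)%E.
  have h0 : (0 <= \esum_(k in setT) a k)%E by apply: esum_ge0 => *; exact: a0.
  by rewrite -(sqr_sqrte h0) EFin_expe expe2 expe2; apply: lee_pmul; rewrite ?sqrte_ge0.
rewrite -lee_fin; apply: le_trans E0; apply: (@le_trans _ _ (\sum_(k <- r) a k)%E).
  rewrite -sumEFin; apply: lee_sum => k _.
  by rewrite lee_fin ler_wpM2r ?sqr_ge0// ler_powR// wt_base_ge1.
rewrite fsbig_seq//; apply: esum_ge; exists [set` r] => //.
split => //; exact: finite_seq.
Qed.

(** The parameter e^2 in the second clause says that the Sobolev distance is at most e, since [hbd]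
    bounds squared norms. *)
Definition hcont M (U : R -> R * R -> R[i]) := (forall t, hbd M (U t)) /\
  forall t (e : R), 0 < e -> \forall t' \near t, hbd (e ^+ 2) (fun x => U t' x - U t x).

Lemma hbdD M1 M2 f g : hbd M1 f -> hbd M2 g -> hbd (2 * M1 + 2 * M2) (fun x => f x + g x).
Proof.
move=> [sf hf] [sg hg]; split; first exact: sqintD.
move=> r ur; apply: le_trans (lerD (ler_wpM2l _ (hf _ ur)) (ler_wpM2l _ (hg _ ur))) => //.
rewrite !mulr_sumr -big_split; apply: ler_sum => k _.
rewrite (fourierD k (sqint_cintble sf) (sqint_cintble sg)).
have w0 : 0 <= wt k :> R by rewrite (le_trans ler01)// wt_ge1.
set z := fourier f k; set y := fourier g k.
apply: (@le_trans _ _ (wt k * (2 * normc z ^+ 2 + 2 * normc y ^+ 2))); last first.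
  by rewrite mulrDr !(mulrCA (wt k)).
rewrite ler_wpM2l//.
have := normc_triangle z y; have := normc_ge0 z; have := normc_ge0 y; have := normc_ge0 (z + y).
have := sqr_ge0 (normc z - normc y).
move: (normc z) (normc y) (normc (z + y)) => p q r0 h1 h2 h3 h4 h5.
have : 0 <= (p + q - r0) * (p + q + r0) by apply: mulr_ge0; lra.
move: h1; rewrite !expr2; nra.
Qed.

Lemma in_C_Hs_hcont s (T : R) (u : R -> R * R -> R[i]) : 2 / 3 <= s -> 0 <= T -> in_C_Hs s T u ->
  exists M, hcont M (fun t => u (clamp 0 T t)).
Proof.
move=> hs T0 [uH uC].
have tI t : 0 <= t <= T -> t \in `[0, T] by rewrite in_itv.
have usq t : 0 <= t <= T -> sqint (u t) by move=> /tI/uH[_ /in_L2_sqint].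
have near_t t (e : R) : 0 <= t <= T -> 0 < e ->
    \forall t' \near t, 0 <= t' <= T -> hbd (e ^+ 2) (fun x => u t' x - u t x).
  move=> tT e0; have := uC _ (tI _ tT) => H.
  have : \forall t' \near within `[0, T]%classic (nbhs t),
      (Hs_norm s (fun x => u t' x - u t x)%R < e%:E)%E.
    apply: (H [set y | (y < e%:E)%E]); apply: open_nbhs_nbhs; split; last by rewrite /= lte_fin.
    exact: open_ereal_lt_ereal.
  move=> H2; apply: (@filterS _ (nbhs t) _ _ _ _ H2) => t' h t'T.
  apply: (Hs_norm_hbd hs) => //; [|exact: ltW|by apply/ltW/h; rewrite /= in_itv].
  by apply: sqintB; exact: usq.
have [M hM] : exists M : nat, forall t, 0 <= t <= T -> hbd M%:R (u t).
  (* Near each time the bound is that of one function plus a distance of at most 1; compactness of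
     [0, T] makes it uniform. *)
  have /compact_near_coveringP := @segment_compact R 0 T.
  move=> /(_ nat \oo (fun n t => 0 <= t <= T -> hbd n%:R (u t)) _) H.
  have [|N _ HN] := H _.
    move=> t; rewrite /= in_itv/= => tT.
    have [_ _ fin] := uH _ (tI _ tT).
    have [B B0 hB] : exists2 B : R, 0 <= B & (Hs_norm s (u t) <= B%:E)%E.
      exists (fine (Hs_norm s (u t))); first by rewrite fine_ge0// sqrte_ge0.
      by rewrite fineK// ge0_fin_numE// sqrte_ge0.
    have hu := Hs_norm_hbd hs (usq _ tT) B0 hB.
    have nt := near_t t 1 tT ltr01.
    exists ([set t' : R | 0 <= t' <= T -> hbd (1 ^+ 2) (fun x => u t' x - u t x)],
            [set n : nat | 2 * 1 ^+ 2 + 2 * B ^+ 2 <= n%:R]).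
      by split => //=; exact: nbhs_infty_ger.
    move=> [t' n] /= [h1 h2] t'T; apply: (hbd_le h2).
    have := hbdD (h1 t'T) hu; congr hbd.
    by apply/funext => x; rewrite subrK.
  by exists N => t tT; apply: (HN N (leqnn N) t) => //=; rewrite in_itv.
exists M%:R; split=> [t|t e e0]; first by apply: hM; exact: clamp_itv.
have H := @clamp_continuous R 0 T t _ (near_t _ _ (clamp_itv t T0) e0).
apply: (@filterS _ (nbhs t) _ _ _ _ H) => t' /=; apply; exact: clamp_itv.
Qed.

Lemma ccont_lip (c : R -> R[i]) (K : R) :
  (forall t (e : R), 0 < e -> \forall t' \near t, normc (c t' - c t) <= K * e) -> ccont c.
Proof.
move=> H.
have key t (h : R -> R) : (forall t', `|h t' - h t| <= normc (c t' - c t)) ->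
    h t' @[t' --> t] --> h t.
  move=> hc; apply/cvgrPdist_le => e e0.
  have K1 : 0 < `|K| + 1 by rewrite ltr_wpDl.
  have := H t (e / (`|K| + 1)) (divr_gt0 e0 K1); apply: filterS => t' ht'.
  rewrite distrC (le_trans (hc t'))// (le_trans ht')// mulrCA ger_pMr//.
  by rewrite ler_pdivrMr// mul1r (le_trans (ler_norm _))// lerDl.
split=> t; apply: key => t'; have := Re_le_normc (c t' - c t); have := Im_le_normc (c t' - c t).
  by rewrite ReD ReN.
by rewrite ImD ImN.
Qed.

Lemma hcont_fourier M U k : hcont M U -> ccont (fun t => fourier (U t) k).
Proof.
move=> [hU cU]; apply: (@ccont_lip _ 1) => t e e0; apply: filterS (cU t e e0) => t' h.
rewrite mul1r -fourierB; [|exact/sqint_cintble/hbd_sqint|exact/sqint_cintble/hbd_sqint].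
rewrite -(@ler_pXn2r _ 2)// ?nnegrE ?normc_ge0//; last exact: ltW.
have := hbd_sum h (isT : uniq [:: k]).
by rewrite big_seq1.
Qed.

Lemma hcont_cub M U k : hcont M U -> ccont (fun t => fourier (cub (U t)) k).
Proof.
move=> [hU cU]; have [K K0 HK] := cub_fourier_lip (hbd_ge0 (hU 0)).
apply: (@ccont_lip _ K) => t e e0; apply: filterS (cU t e e0) => t' h.
exact: (HK _ _ e).
Qed.

Definition k2 k : R := k.1%:~R ^+ 2 + k.2%:~R ^+ 2.

(** The coefficient in the interaction picture: the free evolution is undone, and only the
    nonlinearity moves it. *)
Definition profile (U : R -> R * R -> R[i]) k t := cis (k2 k * t) * fourier (U t) k.

Definition duhamel (b : bool) (T : R) (U : R -> R * R -> R[i]) :=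
  forall k t0 t, 0 <= t0 -> t0 <= t -> t <= T ->
  profile U k t = profile U k t0 +
    cintegral leb `[t0, t] (fun s => - 'i%C * (-1) ^+ b * (cis (k2 k * s) * fourier (cub (U s)) k)).

Lemma solution_hcont (b : bool) s (T : R) u0 u : 2 / 3 <= s -> 0 < T -> NLS_solution b s T u0 u ->
  exists M, hcont M (fun t => u (clamp 0 T t)) /\ duhamel b T (fun t => u (clamp 0 T t)).
Proof.
move=> hs T0 [uH eqn _]; have [M hM] := in_C_Hs_hcont hs (ltW T0) uH.
exists M; split=> // k t0 t t00 t0t tT.
apply: (NLS_mode T0 eqn (hcont_fourier k hM) (hcont_cub k hM)) => // r rT.
have := hM.1 r; rewrite /= (clamp_id rT) => h.
by split => //; [exact: (sqint_cintble (hbd_sqint h))|exact: cintble_cub h].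
Qed.

End time_continuity.

(** * Strichartz estimates for the blocks of a solution *)

Section block_strichartz.
Context {R : realType}.
Local Notation leb := (@lebesgue_measure R).
Local Notation leb2 := (leb \x leb)%E.
Local Notation cell := (@cell R).
Implicit Types (f g : R * R -> R[i]) (k : int * int) (M T : R).

(** Blocks are finite trigonometric sums, so a plain supremum can replace the essential one; along a
    solution it is continuous in time. *)
Definition bsup f j : R := sup [set normc (ublk f j x) | x in setT].

Lemma ublk_le_sum f j x : normc (ublk f j x) <= \sum_(k <- blk j) normc (fourier f k).
Proof.
rewrite (le_trans (normc_sum _ _ _))//; apply: ler_sum => k _.
by rewrite normcM normc_ek mulr1.
Qed.

Lemma bsup_le f j B : (forall x, normc (ublk f j x) <= B) -> bsup f j <= B.
Proof.
move=> fB; apply: ge_sup; first by exists (normc (ublk f j (0, 0))), (0, 0).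
by move=> _ [x _ <-].
Qed.

Lemma le_bsup f j x : normc (ublk f j x) <= bsup f j.
Proof.
apply: ub_le_sup; last by exists x.
by exists (\sum_(k <- blk j) normc (fourier f k)) => _ [y _ <-]; exact: ublk_le_sum.
Qed.

Lemma bsup_ge0 f j : 0 <= bsup f j.
Proof. exact: le_trans (normc_ge0 _) (le_bsup f j (0, 0)). Qed.

(** Half the supremum is reached at some point, which avoids showing that the maximum is attained;
    this is the origin of the factor 2 in [strichartz_integral]. *)
Lemma bsup_near f j : exists x, bsup f j <= 2 * normc (ublk f j x).
Proof.
have := bsup_ge0 f j; rewrite le_eqVlt => /predU1P[<-|s0].
  by exists (0, 0); rewrite mulr_ge0 ?normc_ge0.
have [||_ [x _ <-] lt] := @sup_adherent R [set normc (ublk f j x) | x in setT] (bsup f j / 2).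
- by rewrite divr_gt0.
- split; first by exists (normc (ublk f j (0, 0))), (0, 0).
  by exists (\sum_(k <- blk j) normc (fourier f k)) => _ [y _ <-]; exact: ublk_le_sum.
exists x; move: lt; rewrite -/(bsup f j); lra.
Qed.

Lemma bsup_sqr_le M f j : hbd M f -> bsup f j ^+ 2 <= 2 ^+ 18 * M * 2 ^+ (8 * j).
Proof.
move=> h; set B := _ * _.
have B0 : 0 <= B by exact: le_trans (sqr_ge0 _) (ublk_sup j (0, 0) h).
rewrite -(sqr_sqrtr B0) lerXn2r ?nnegrE ?bsup_ge0 ?sqrtr_ge0//.
apply: bsup_le => x; rewrite -(@ler_pXn2r _ 2)// ?nnegrE ?normc_ge0 ?sqrtr_ge0//.
by rewrite sqr_sqrtr// ublk_sup.
Qed.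

Lemma bsup_dist f g j :
  `|bsup f j - bsup g j| <= \sum_(k <- blk j) normc (fourier f k - fourier g k).
Proof.
suff key f' g' : bsup f' j <= bsup g' j + \sum_(k <- blk j) normc (fourier f' k - fourier g' k).
  have h1 := key f g; have h2 := key g f.
  rewrite (eq_bigr (fun k => normc (fourier f k - fourier g k))) in h2; last first.
    by move=> k _; rewrite normcB_sym.
  move: h1 h2; set S := \sum_(k <- _) _ => h1 h2.
  by clear key; apply/ler_normlP; split; [rewrite opprB lerBlDl; exact: h2|rewrite lerBlDl; exact: h1].
apply: bsup_le => x.
have -> : ublk f' j x = ublk g' j x + \sum_(k <- blk j) (fourier f' k - fourier g' k) * ek k x.
  by rewrite /ublk /trigp -big_split /=; apply: eq_bigr => k _; ring.
apply: (le_trans (normc_triangle _ _)); apply: lerD; first exact: le_bsup.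
rewrite (le_trans (normc_sum _ _ _))//; apply: ler_sum => k _.
by rewrite normcM normc_ek mulr1.
Qed.

Lemma bsup_continuous M U j : hcont M U -> continuous (fun t => bsup (U t) j).
Proof.
move=> hU t.
pose d (t' : R) : R := \sum_(k <- blk j) normc (fourier (U t) k - fourier (U t') k).
have cd : continuous d.
  apply: continuous_sum_fun => k; apply: ccont_normc; apply: ccontD; first exact: ccont_cst.
  under eq_fun do rewrite -mulN1r.
  by apply: ccontM; [exact: ccont_cst|exact: hcont_fourier hU].
have d0 : d t = 0.
  by rewrite /d big1// => k _; rewrite subrr normc0.
apply/cvgrPdist_le => e e0.
have := cd t => /cvgrPdist_le /(_ e e0); apply: filterS => t'.
rewrite d0 sub0r normrN => h; apply: le_trans (bsup_dist _ _ _) _.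
exact: le_trans (ler_norm _) h.
Qed.

Lemma sum_blk_cond (V : nmodType) j (F : int * int -> V) :
  \sum_(k <- box (sc j)) (if k \in blk j then F k else 0) = \sum_(k <- blk j) F k.
Proof.
rewrite -big_mkcond -big_filter; apply: perm_big; apply: uniq_perm.
- by rewrite filter_uniq// uniq_box.
- exact: uniq_blk.
by move=> k; rewrite mem_filter; case: (boolP (k \in blk j)) => //= /sub_blk.
Qed.

Lemma sqr_affine_le_pow j : ((12 * j).+1 ^ 2 <= 172 * 2 ^ j)%N.
Proof.
(* Doubling outruns the growth of the square only from j = 3 on, and the case j = 3, namely 1369 <=
   172 * 8 = 1376, dictates the constant. *)
case: j => [//|[//|[//|j]]]; elim: j => [//|j ih].
rewrite (expnS 2 j.+3); apply: (@leq_trans (2 * (12 * j.+3).+1 ^ 2)); last by rewrite mulnCA leq_mul2l.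
by rewrite !expnS !expn0; nia.
Qed.

(** The square of the logarithm of N is absorbed into 2^j, that is N^(1/12). *)
Lemma harm_sc j : harm (2 * sc j) ^+ 2 <= 172 * 2 ^+ j :> R.
Proof.
have -> : (2 * sc j = 2 ^ (12 * j).+1)%N by rewrite /sc expnS.
have h := @harm_pow2 R (12 * j).+1.
have h0 : 0 <= harm (2 ^ (12 * j).+1) :> R by rewrite sumr_ge0.
apply: (@le_trans _ _ ((12 * j).+1%:R ^+ 2)).
  by rewrite lerXn2r ?nnegrE.
by rewrite -!natrX -natrM ler_nat sqr_affine_le_pow.
Qed.

(** The data contribute 2^(-16 j) and the forcing 2^(-24 j) 2^(8 j), from the squared length and
    [cubic_bound]: the same power. The logarithms turn it into 2^(-15 j). *)
Lemma block_strichartz M b T U : 0 <= M -> hcont M U -> duhamel b T U ->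
  exists2 C : R, 0 <= C & forall j al be, 0 <= al -> al < be -> be <= T ->
    be - al <= (4 * (sc j)%:R)^-1 ->
    \int[leb]_(t in `[al, be]) (bsup (U t) j ^+ 2) <= C * 2 ^- (15 * j).
Proof.
move=> M0 hU dU; have [K K0 HK] := cubic_bound M0.
exists (112 * 172 * (2 ^+ 16 * M + K)).
  apply: mulr_ge0 => //; apply: addr_ge0 => //; apply: mulr_ge0 => //; exact: exprn_ge0.
move=> j al be al0 albe beT len.
(* The estimate is stated for a full box of frequencies; coefficients outside the block are set to
   0. *)
pose c k t : R[i] := if k \in blk j then profile U k t else 0.
pose G k (s : R) : R[i] := - 'i%C * (-1) ^+ b * (cis (k2 k * s) * fourier (cub (U s)) k).
pose g k s : R[i] := if k \in blk j then G k s else 0.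
have nG k s : normc (G k s) = normc (fourier (cub (U s)) k).
  rewrite /G !normcM normc_cis normcN normc_i normcX normcN normc1 expr1n.
  by rewrite !mul1r.
have cG k : ccont (G k).
  apply: ccontM; first exact: ccont_cst.
  apply: ccontM; last exact: hcont_cub hU.
  by apply: ccont_cis => s; apply: cvgM; [exact: cvg_cst|exact: cvg_id].
have sumsq (F : int * int -> R[i]) : \sum_(k <- box (sc j)) normc (if k \in blk j then F k else 0) ^+ 2 =
    \sum_(k <- blk j) normc (F k) ^+ 2.
  rewrite -sum_blk_cond; apply: eq_bigr => k _; case: ifP => // _.
  by rewrite normc0 expr0n.
have H := @strichartz_integral R (sc j) al be (K * 2 ^+ (8 * j)) c g (fun t => bsup (U t) j)
  (sc_gt0 j) albe len.
apply: (le_trans (H _ _ _ _ _ _)) => {H}.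
- by move=> k; rewrite /g; case: (k \in blk j); [exact: cG|exact: ccont_cst].
- move=> k t /andP[at_ tb]; rewrite /c /g; case: (k \in blk j); last first.
    by rewrite add0r; apply/esym; rewrite /cintegral Rintegral_cst// mul0r.
  by apply: dU => //; exact: le_trans tb beT.
- move=> s _; rewrite sumsq; under eq_bigr do rewrite nG.
  apply: (le_trans _ (HK _ (hU.1 s) j)).
  rewrite -sum_blk_cond; apply: ler_sum => k _; case: ifP => // _; exact: sqr_ge0.
- exact: bsup_continuous hU.
- by move=> t; exact: bsup_ge0.
- move=> t _; have [x hx] := bsup_near (U t) j; exists x.
  rewrite (le_trans hx)// (_ : \sum_(k <- _) _ = ublk (U t) j x)//.
  rewrite /ublk /trigp -sum_blk_cond; apply: eq_bigr => k _.
  rewrite /c; case: ifP => _; last by rewrite mul0r.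
  (* The phase in [profile] cancels the one in [schr], and the mode of U t itself remains. *)
  have E (p q z w : R[i]) : p * q = 1 -> q * z * (w * p) = z * w.
    by move=> pq; rewrite -[RHS]mul1r -pq; ring.
  by rewrite /profile /schr cisD /ek; apply: E; exact: cisNK.
rewrite (sumsq (fun k => profile U k al)).
have hb : \sum_(k <- blk j) normc (profile U k al) ^+ 2 <= 2 ^+ 16 * M * 2 ^- (16 * j).
  under eq_bigr do rewrite /profile normcM normc_cis mul1r.
  by rewrite ler_pdivlMr ?exprn_gt0// mulrC; exact: hbd_blk (hU.1 al).
have e12 : 0 < 2 ^+ (12 * j) :> R by rewrite exprn_gt0.
have hl : (be - al) ^+ 2 <= 2 ^- (24 * j).
  rewrite (_ : 24 * j = 12 * j * 2)%N; last by rewrite mulnAC.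
  rewrite exprM -exprVn lerXn2r ?nnegrE ?subr_ge0 ?(ltW albe) ?invr_ge0 ?(ltW e12)//.
  rewrite (le_trans len)// scR lef_pV2 ?posrE ?mulr_gt0// ler_peMl ?(ltW e12)//.
  by rewrite ler1n.
have hX : \sum_(k <- blk j) normc (profile U k al) ^+ 2 + (be - al) ^+ 2 * (K * 2 ^+ (8 * j)) <=
    (2 ^+ 16 * M + K) * 2 ^- (16 * j).
  rewrite mulrDl lerD// (_ : K * 2 ^- (16 * j) = 2 ^- (24 * j) * (K * 2 ^+ (8 * j))).
    by apply: ler_wpM2r => //; apply: mulr_ge0 => //; exact: exprn_ge0.
  rewrite (_ : 24 * j = 16 * j + 8 * j)%N; last by rewrite -mulnDl.
  by rewrite exprD; field; rewrite !expf_neq0.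
have X0 : 0 <= (2 ^+ 16 * M + K) * 2 ^- (16 * j).
  apply: mulr_ge0; last by rewrite invr_ge0 exprn_ge0.
  by apply: addr_ge0 => //; apply: mulr_ge0 => //; exact: exprn_ge0.
apply: (@le_trans _ _ (112 * (172 * 2 ^+ j) * ((2 ^+ 16 * M + K) * 2 ^- (16 * j)))).
  apply: ler_pM => //.
  - by apply: mulr_ge0 => //; exact: sqr_ge0.
  - apply: addr_ge0; first by apply: sumr_ge0 => k _; exact: sqr_ge0.
    by apply: mulr_ge0; [exact: sqr_ge0|apply: mulr_ge0 => //; exact: exprn_ge0].
  - by apply: ler_wpM2l => //; exact: harm_sc.
rewrite (_ : 16 * j = j + 15 * j)%N; last by rewrite -mulSn.
set c16 := 2 ^+ 16.
rewrite exprD le_eqVlt; apply/orP; left; apply/eqP; field.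
by rewrite !expf_neq0.
Qed.

(** An interval of length at most 1 splits into 4N admissible pieces, and 2^(12 j) 2^(-15 j) = 2^(-3
    j). *)
Lemma interval_strichartz M b T U : 0 <= M -> hcont M U -> duhamel b T U ->
  exists2 C : R, 0 <= C & forall j al be, 0 <= al -> al < be -> be <= T -> be - al <= 1 ->
    \int[leb]_(t in `[al, be]) (bsup (U t) j ^+ 2) <= C * 2 ^- (3 * j).
Proof.
move=> M0 hU dU; have [C C0 HC] := block_strichartz M0 hU dU.
exists (4 * C) => [|j al be al0 albe beT len]; first exact: mulr_ge0.
pose n := (4 * sc j)%N; have n0 : (0 < n)%N by rewrite muln_gt0 sc_gt0.
have nR : 0 < n%:R :> R by rewrite ltr0n.
pose tau := (be - al) / n%:R.
have tau0 : 0 < tau by rewrite divr_gt0// subr_gt0.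
have beE : be = al + n%:R * tau by rewrite /tau mulrCA divff ?gt_eqF// mulr1 addrC subrK.
have cs : continuous (fun t => bsup (U t) j ^+ 2) by apply: continuousX_fun; exact: bsup_continuous hU.
rewrite {1}beE (Rintegral_cells _ _ cs (ltW tau0)).
apply: (@le_trans _ _ (\sum_(m < n) C * 2 ^- (15 * j))); last first.
  rewrite sumr_const card_ord -[_ *+ n]mulr_natl /n natrM scR.
  rewrite (_ : 15 * j = 12 * j + 3 * j)%N; last by rewrite -mulnDl.
  rewrite exprD le_eqVlt; apply/orP; left; apply/eqP; field.
  by rewrite !expf_neq0.
apply: ler_sum => m _; apply: HC.
- by apply: addr_ge0 => //; apply: mulr_ge0 => //; exact: ltW.
- by rewrite ltrD2l ltr_pM2r// ltr_nat.
- apply: le_trans beT; rewrite [leRHS]beE lerD2l ler_pM2r// ler_nat; exact: ltn_ord.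
- rewrite [_ - _](_ : _ = tau); last by rewrite -natr1; ring.
  by rewrite /tau ler_pdivrMr// /n natrM mulVf// mulf_neq0// gt_eqF// ltr0n sc_gt0.
Qed.

End block_strichartz.

(** * The time-integrable function dominating both solutions *)

Section energy.
Context {R : realType}.
Local Notation leb := (@lebesgue_measure R).
Local Notation leb2 := (leb \x leb)%E.
Local Notation cell := (@cell R).
Local Notation plane := (measurableTypeR R * measurableTypeR R)%type.
Implicit Types (f g : R * R -> R[i]) (k : int * int) (M T : R) (U V : R -> R * R -> R[i]).

(** The weights 2^(j+1) are those of [bsq]; the decay 2^(-3 j) of [interval_strichartz] leaves 2^(-2
    j) after them. *)
Definition nterm U V j t : R := 2 ^+ j.+1 * (bsup (U t) j ^+ 2 + bsup (V t) j ^+ 2).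

(* Dominates [|U t|^2] and [|V t|^2] almost everywhere on the torus. *)
Definition nrg U V t : \bar R := (\sum_(0 <= j <oo) (nterm U V j t)%:E)%E.

Lemma nterm_ge0 U V j t : 0 <= nterm U V j t.
Proof. by apply: mulr_ge0; [exact: exprn_ge0|apply: addr_ge0; exact: sqr_ge0]. Qed.

Lemma nrg_ge0 U V t : (0 <= nrg U V t)%E.
Proof. by apply: nneseries_ge0 => j _ _; rewrite lee_fin nterm_ge0. Qed.

Lemma nterm_continuous M U V j : hcont M U -> hcont M V -> continuous (nterm U V j).
Proof.
move=> hU hV; apply: continuousM_fun; first exact: continuous_cst_fun.
by apply: continuousD_fun; apply: continuousX_fun; [exact: bsup_continuous hU|exact: bsup_continuous hV].
Qed.

Lemma nrg_measurable M U V D : measurable D -> hcont M U -> hcont M V -> measurable_fun D (nrg U V).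
Proof.
move=> mD hU hV.
apply: ge0_emeasurable_sum => [j t _ _|j _]; first by rewrite lee_fin nterm_ge0.
apply/measurable_EFinP; apply: measurable_funTS; apply: continuous_measurable_fun.
exact: nterm_continuous hU hV.
Qed.

Lemma EFin_Rintegral_itv (h : R -> R) a b : continuous h ->
  (\int[leb]_(t in `[a, b]) (h t)%:E = (\int[leb]_(t in `[a, b]) h t)%:E)%E.
Proof.
move=> ch; rewrite /Rintegral fineK//.
exact: (integrable_fin_num _ (continuous_integrable_itv _ _ ch)).
Qed.

Lemma exists_pow_half (x : R) : exists J, x * 2 ^- J <= 1.
Proof.
have [N xN] : exists N : nat, x <= N%:R.
  exists (Num.bound `|x|); rewrite (le_trans (ler_norm _))// ltW//.
  by apply: archi_boundP.
exists N; rewrite ler_pdivrMr ?exprn_gt0// mul1r (le_trans xN)// -natrX ler_nat.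
exact/ltnW/ltn_expl.
Qed.

(* The bound [X 4^-j] controls the tail of the series, uniformly over the
   interval; the bound proportional to the length controls the other terms. *)
Lemma nrg_small M b T U V (e : R) : 0 < e -> hcont M U -> hcont M V -> duhamel b T U -> duhamel b T V ->
  exists2 l : R, 0 < l & forall al be, 0 <= al -> al < be -> be <= T -> be - al <= l ->
    (\int[leb]_(t in `[al, be]) nrg U V t <= e%:E)%E.
Proof.
move=> e0 hU hV dU dV; have M0 := hbd_ge0 (hU.1 0).
have [C1 C10 H1] := interval_strichartz M0 hU dU.
have [C2 C20 H2] := interval_strichartz M0 hV dV.
pose X := 2 * (C1 + C2); pose Y := 2 ^+ 20 * M.
have Y0 : 0 <= Y by apply: mulr_ge0 => //; exact: exprn_ge0.
have [J HJ] := exists_pow_half (X * (2 / e)).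
(* The bound 1 is the length allowed by [interval_strichartz]. Writing [Y + 1] keeps the divisor
   positive, and 10 J is the 9 j of [uY] plus the j of the target bound in [ue]. *)
pose l := Num.min 1 (e / 2 / ((Y + 1) * 2 ^+ (10 * J))).
have Y1 : 0 < (Y + 1) * 2 ^+ (10 * J) by rewrite mulr_gt0 ?exprn_gt0// ltr_wpDl.
exists l; first by rewrite lt_min ltr01 !divr_gt0.
move=> al be al0 albe beT; rewrite le_min => /andP[len1 len2].
have cn j : continuous (nterm U V j) by exact: nterm_continuous hU hV.
have cs j : continuous (fun t => bsup (U t) j ^+ 2) by apply: continuousX_fun; exact: bsup_continuous hU.
have cs' j : continuous (fun t => bsup (V t) j ^+ 2) by apply: continuousX_fun; exact: bsup_continuous hV.
pose u j := \int[leb]_(t in `[al, be]) nterm U V j t.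
have u0 j : 0 <= u j by apply: Rintegral_ge0 => t _; exact: nterm_ge0.
have uE j : u j = 2 ^+ j.+1 * (\int[leb]_(t in `[al, be]) (bsup (U t) j ^+ 2) +
    \int[leb]_(t in `[al, be]) (bsup (V t) j ^+ 2)).
  rewrite /u /nterm RintegralZl//; last by apply: continuous_integrable_itv; exact: continuousD_fun.
  by rewrite RintegralD//; exact: continuous_integrable_itv.
have uX j : u j <= X * 2 ^- (2 * j).
  rewrite uE; apply: (@le_trans _ _ (2 ^+ j.+1 * (C1 * 2 ^- (3 * j) + C2 * 2 ^- (3 * j)))).
    by apply: ler_wpM2l; [exact: exprn_ge0|apply: lerD; [exact: H1|exact: H2]].
  rewrite (_ : 3 * j = j + 2 * j)%N; last by rewrite -mulSn.
  rewrite exprS exprD /X le_eqVlt; apply/orP; left; apply/eqP; field.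
  by rewrite !expf_neq0.
have uY j : u j <= Y * 2 ^+ (9 * j) * (be - al).
  rewrite -(Rintegral_itv_cst _ (ltW albe)); apply: Rintegral_le => //.
    exact: continuous_cst_fun.
  move=> t _; have h1 := bsup_sqr_le j (hU.1 t); have h2 := bsup_sqr_le j (hV.1 t).
  have -> : Y = 4 * (2 ^+ 18 * M).
    by rewrite /Y (_ : 20 = 2 + 18)%N// exprD mulrA; congr (_ * _ * _); rewrite expr2; ring.
  set c := 2 ^+ 18 * M in h1 h2 *.
  apply: (@le_trans _ _ (2 ^+ j.+1 * (c * 2 ^+ (8 * j) + c * 2 ^+ (8 * j)))).
    rewrite /nterm; apply: ler_wpM2l; first exact: exprn_ge0.
    exact: lerD h1 h2.
  rewrite (_ : 9 * j = j + 8 * j)%N; last by rewrite -mulSn.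
  by rewrite exprS !exprD le_eqVlt; apply/orP; left; apply/eqP; ring.
have ue j : u j <= e / 2 * 2 ^- j.
  have pj : 0 < 2 ^+ j :> R by rewrite exprn_gt0.
  case: (leqP J j) => Jj.
    apply: (le_trans (uX j)); rewrite mul2n -addnn exprD invfM mulrA ler_wpM2r ?invr_ge0 ?(ltW pj)//.
    have X0 : 0 <= X by apply: mulr_ge0 => //; exact: addr_ge0.
    apply: (@le_trans _ _ (X * 2 ^- J)).
      by rewrite ler_wpM2l// lef_pV2 ?posrE ?exprn_gt0// ler_weXn2l// ler1n.
    rewrite mulrAC -ler_pdivlMr ?divr_gt0// in HJ.
    by rewrite (le_trans HJ)// div1r invf_div.
  rewrite ler_pdivlMr//; apply: (le_trans (ler_wpM2r (ltW pj) (uY j))).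
  have -> : Y * 2 ^+ (9 * j) * (be - al) * 2 ^+ j = Y * 2 ^+ (10 * j) * (be - al).
    rewrite (_ : 10 * j = j + 9 * j)%N; last by rewrite -mulSn.
    by rewrite exprD; ring.
  have len0 : 0 <= be - al by rewrite subr_ge0 ltW.
  rewrite ler_pdivlMr// in len2; rewrite mulrC; apply: le_trans len2; rewrite ler_wpM2l//.
  apply: ler_pM; [exact: Y0|exact: exprn_ge0|by rewrite lerDl|].
  by apply: ler_weXn2l; [rewrite ler1n|rewrite leq_mul2l ltnW].
rewrite /nrg integral_nneseries//; last 2 first.
- by move=> j; apply/measurable_EFinP; apply: measurable_funTS; exact: continuous_measurable_fun.
- by move=> j t _; rewrite lee_fin nterm_ge0.
under eq_eseriesr => j _ do rewrite EFin_Rintegral_itv//.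
apply: nneseries_le_bound => // n.
apply: (@le_trans _ _ (\sum_(j < n) e / 2 * 2 ^- j)); first by apply: ler_sum => j _; exact: ue.
rewrite -mulr_sumr; have hS : \sum_(j < n) (2 ^- j : R) <= 2 by exact: sum_half_le.
have e2 : 0 <= e / 2 by rewrite divr_ge0// ltW.
by have := ler_wpM2l e2 hS; rewrite divfK.
Qed.

End energy.

(** * Contraction of the difference, and uniqueness *)

Section uniqueness.
Context {R : realType}.
Local Notation leb := (@lebesgue_measure R).
Local Notation leb2 := (leb \x leb)%E.
Local Notation cell := (@cell R).
Local Notation plane := (measurableTypeR R * measurableTypeR R)%type.
Implicit Types (f g : R * R -> R[i]) (k : int * int) (M T : R) (U V : R -> R * R -> R[i]).

(** Integration by parts of x times its derivative. The auxiliary [G] is a primitive started before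
    al and corrected by a constant: it agrees with x on the interval and is differentiable around
    al. *)
Lemma Rintegral_sqr (x y : R -> R) al be : continuous x -> continuous y ->
  (forall t, al <= t <= be -> x t = \int[leb]_(s in `[al, t]) y s) ->
  forall t, al <= t <= be -> x t ^+ 2 = \int[leb]_(s in `[al, t]) (2 * (x s * y s)).
Proof.
move=> cx cy xE t /andP[]; rewrite le_eqVlt => /predU1P[<-|alt] tb.
  rewrite set_itv1 Rintegral_set1 xE ?lexx//.
  by rewrite set_itv1 Rintegral_set1 expr0n.
pose G (v : R) : R := \int[leb]_(s in `[al - 1, v]) y s - \int[leb]_(s in `[al - 1, al]) y s.
have dG (v : R) : al - 1 < v -> is_derive v 1 G (y v).
  move=> av; have h1 := is_derive_Rintegral cy av.
  have := is_deriveB h1 (is_derive_cst (\int[leb]_(s in `[al - 1, al]) y s) v 1).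
  by rewrite subr0.
have cG (v : R) : al - 1 < v -> {for v, continuous G}.
  by move=> av; apply/differentiable_continuous/derivable1_diffP; have [] := dG v av.
have GE (v : R) : al <= v <= be -> G v = x v.
  move=> /andP[v1 v2]; rewrite xE ?v1// /G (Rintegral_split cy (_ : al - 1 <= al) v1) ?gerBl//.
  by rewrite addrAC subrr add0r.
have a1 : al - 1 < al by rewrite ltrBlDr ltrDl.
have tI : al <= t <= be by rewrite (ltW alt).
have aI : al <= al <= be by rewrite lexx (le_trans (ltW alt)).
have x0 : x al = 0 by rewrite xE// set_itv1 Rintegral_set1.
have E : \int[leb]_(s in `[al, t]) (x s * y s) = \int[leb]_(s in `[al, t]) (G s * y s).
  apply: eq_Rintegral => s; rewrite inE/= in_itv/= => /andP[s1 s2].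
  by rewrite GE// s1 (le_trans s2).
have dGo : derivable_oo_LRcontinuous G al t.
  split.
  - by move=> s; rewrite in_itv/= => /andP[s1 _]; have [] := dG s (lt_trans a1 s1).
  - by apply: cvg_at_right_filter; exact: cG.
  - by apply: cvg_at_left_filter; apply: cG; exact: lt_trans alt.
have dGe : {in `]al, t[, derive1 G =1 y}.
  move=> s; rewrite in_itv/= => /andP[s1 _]; rewrite derive1E.
  by have [_ ->] := dG s (lt_trans a1 s1).
have : \int[leb]_(s in `[al, t]) (G s * y s) =
    G t * G t - G al * G al - \int[leb]_(s in `[al, t]) (y s * G s).
  by apply: Rintegration_by_parts => //; exact: continuous_subspaceT.
rewrite !GE// x0 mulr0 subr0.
have -> : \int[leb]_(s in `[al, t]) (y s * G s) = \int[leb]_(s in `[al, t]) (G s * y s).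
  by apply: eq_Rintegral => s _; rewrite mulrC.
rewrite -E RintegralZl//; last by apply: continuous_integrable_itv; exact: continuousM_fun.
set I := \int[leb]_(s in _) _; rewrite expr2 => h; lra.
Qed.

Lemma sqr_le_nrg M U V s : hcont M U -> hcont M V ->
  forall m : R, (nrg U V s <= m%:E)%E ->
  {ae leb2, forall x : plane, cell x -> normc (U s x) ^+ 2 <= m /\ normc (V s x) ^+ 2 <= m}.
Proof.
move=> hU hV m nm.
have h1 := sqr_le_bsq_ae (hU.1 s); have h2 := sqr_le_bsq_ae (hV.1 s).
apply: filterS2 h1 h2 => x h1 h2 cx; rewrite -!lee_fin; split.
- apply: (le_trans (h1 cx)); apply: (le_trans _ nm); apply: lee_nneseries => [j _ _|j _].
    by rewrite lee_fin bsq_term_ge0.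
  rewrite lee_fin /nterm; apply: ler_wpM2l; first exact: exprn_ge0.
  apply: (@le_trans _ _ (bsup (U s) j ^+ 2)); last by rewrite lerDl sqr_ge0.
  by rewrite lerXn2r ?nnegrE ?normc_ge0 ?bsup_ge0// le_bsup.
- apply: (le_trans (h2 cx)); apply: (le_trans _ nm); apply: lee_nneseries => [j _ _|j _].
    by rewrite lee_fin bsq_term_ge0.
  rewrite lee_fin /nterm; apply: ler_wpM2l; first exact: exprn_ge0.
  apply: (@le_trans _ _ (bsup (V s) j ^+ 2)); last by rewrite lerDr sqr_ge0.
  by rewrite lerXn2r ?nnegrE ?normc_ge0 ?bsup_ge0// le_bsup.
Qed.

Lemma hbdB M1 M2 f g : hbd M1 f -> hbd M2 g -> hbd (2 * M1 + 2 * M2) (fun x => f x - g x).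
Proof.
move=> hf [sg hg]; apply: hbdD hf _; split; first exact: sqintN.
move=> r ur; apply: le_trans (hg r ur); apply: ler_sum => k _.
have E : (fun x => - g x) = (fun x => -1 * g x) by apply/funext => x; rewrite mulN1r.
rewrite (_ : fourier (fun x => - g x) k = - fourier g k) ?normcN//.
rewrite E !fourierE; under eq_cintegral do rewrite -mulrA.
by rewrite cintegralZ ?mulN1r ?mulrN//; [exact: measurable_cell|exact/cintble_mul_ek/sqint_cintble].
Qed.

Lemma pair_energy M U V s (Q : R) r : hcont M U -> hcont M V -> 0 < Q -> uniq r ->
  sq (fun x => U s x - V s x) <= Q ->
  ((normc (\sum_(k <- r) conjc (fourier (U s) k - fourier (V s) k) *
      (fourier (cub (U s)) k - fourier (cub (V s)) k)))%:E <=
  ((2 * pi) ^- 2 * 4 * Q)%:E * nrg U V s)%E.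
Proof.
move=> hU hV Q0 ur sQ.
have p0 : 0 < (2 * pi) ^- 2 :> R by rewrite invr_gt0 exprn_gt0// mulr_gt0 ?pi_gt0.
have c0 : 0 < (2 * pi) ^- 2 * 4 * Q by rewrite !mulr_gt0.
(* The dominating function may be infinite at some times. There the right-hand side is infinite too,
   because Q is strictly positive. *)
case nE : (nrg U V s) => [m| |]; last 2 first.
- by rewrite gt0_muley ?lte_fin// leey.
- by have := nrg_ge0 U V s; rewrite nE.
have m0 : 0 <= m by have := nrg_ge0 U V s; rewrite nE lee_fin.
rewrite -EFinM lee_fin.
have sm : (nrg U V s <= m%:E)%E by rewrite nE.
have := cub_energy (hU.1 s) (hV.1 s) m0 ur (sqr_le_nrg hU hV sm).
under eq_bigr => k _.
  rewrite (fourierB k (sqint_cintble (hbd_sqint (hU.1 s))) (sqint_cintble (hbd_sqint (hV.1 s)))).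
  over.
move=> H; apply: (le_trans H); rewrite mulrA -!(mulrA ((2 * pi) ^- 2)) ler_wpM2l ?(ltW p0)//.
by rewrite -!mulrA ler_wpM2l// mulrC ler_wpM2r.
Qed.

(** The squares of the profile differences, which vanish at al, are integrals of twice a real
    pairing. Summed over a box, [pair_energy] bounds the pairing by the dominating function times Q,
    uniformly in the box. With integral at most 1/16 the constants multiply to 2 * 4 / 16 = 1/2. *)
Lemma contraction M b T U V al be (Q : R) : hcont M U -> hcont M V -> duhamel b T U -> duhamel b T V ->
  0 <= al -> al < be -> be <= T -> (\int[leb]_(s in `[al, be]) nrg U V s <= (16^-1)%:E)%E ->
  (forall k, fourier (U al) k = fourier (V al) k) -> 0 < Q ->
  (forall t, al <= t <= be -> sq (fun x => U t x - V t x) <= Q) ->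
  forall t, al <= t <= be -> sq (fun x => U t x - V t x) <= Q / 2.
Proof.
move=> hU hV dU dV al0 albe beT small eq0 Q0 sQ t tI; have /andP[t1 t2] := tI.
pose d k s : R[i] := profile U k s - profile V k s.
pose G W k s : R[i] := - 'i%C * (-1) ^+ b * (cis (k2 k * s) * fourier (cub (W s)) k).
pose gam k s : R[i] := G U k s - G V k s.
have cB (f g : R -> R[i]) : ccont f -> ccont g -> ccont (fun s => f s - g s).
  move=> cf cg; under eq_fun do rewrite -mulN1r; apply: ccontD => //.
  by apply: ccontM => //; exact: ccont_cst.
have cis_c k : ccont (fun s => cis (k2 k * s)).
  by apply: ccont_cis => s; apply: cvgM; [exact: cvg_cst|exact: cvg_id].
have cG W k : hcont M W -> ccont (G W k).
  by move=> hW; apply: ccontM; [exact: ccont_cst|apply: ccontM => //; exact: hcont_cub hW].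
have cg k : ccont (gam k) by apply: cB; exact: cG.
have cd k : ccont (d k).
  by apply: cB; apply: ccontM => //; [exact: hcont_fourier hU|exact: hcont_fourier hV].
have dE k s : al <= s <= be -> d k s = cintegral leb `[al, s] (gam k).
  move=> /andP[s1 s2]; rewrite /gam cintegralB//; [|exact/ccont_cintble/cG..].
  rewrite /d (dU k al s)// ?(le_trans s2)// (dV k al s)// ?(le_trans s2)//.
  by rewrite /profile eq0 -/(G U k) -/(G V k) opprD addrACA subrr add0r.
pose q k s : R := 2 * (complex.Re (d k s) * complex.Re (gam k s)) +
  2 * (complex.Im (d k s) * complex.Im (gam k s)).
have qE k s : q k s = 2 * complex.Re (conjc (d k s) * gam k s).
  by rewrite ReM Re_conjc Im_conjc /q; ring.
have cq k : continuous (q k).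
  have c2 := @continuous_cst_fun R 2.
  apply: continuousD_fun; apply: continuousM_fun => //; apply: continuousM_fun.
  - exact: (cd k).1.
  - exact: (cg k).1.
  - exact: (cd k).2.
  - exact: (cg k).2.
have dsq k : normc (d k t) ^+ 2 = \int[leb]_(s in `[al, t]) q k s.
  rewrite sqr_normcE.
  rewrite (@Rintegral_sqr _ (fun s => complex.Re (gam k s)) al be (cd k).1 (cg k).1 _ t tI); last first.
    by move=> s sI; rewrite dE.
  rewrite (@Rintegral_sqr _ (fun s => complex.Im (gam k s)) al be (cd k).2 (cg k).2 _ t tI); last first.
    by move=> s sI; rewrite dE.
  rewrite /q RintegralD//; apply: continuous_integrable_itv; apply: continuousM_fun;
    (try exact: continuous_cst_fun); apply: continuousM_fun.
  - exact: (cd k).1.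
  - exact: (cg k).1.
  - exact: (cd k).2.
  - exact: (cg k).2.
have nd k : normc (d k t) = normc (fourier (fun x => U t x - V t x) k).
  rewrite (fourierB k (sqint_cintble (hbd_sqint (hU.1 t))) (sqint_cintble (hbd_sqint (hV.1 t)))).
  by rewrite /d /profile -mulrBr normcM normc_cis mul1r.
have p0 : 0 < (2 * pi) ^+ 2 :> R by rewrite exprn_gt0// mulr_gt0 ?pi_gt0.
apply: (plancherel_le (hbdB (hU.1 t) (hV.1 t))) => n.
pose h s : R := 2 * normc (\sum_(k <- box (sc n)) conjc (d k s) * gam k s).
have ch : continuous h.
  apply: continuousM_fun; first exact: continuous_cst_fun.
  by apply: ccont_normc; apply: ccont_sum => k; apply: ccontM => //; exact: ccont_conjc.
have h0 s : 0 <= h s by rewrite mulr_ge0// normc_ge0.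
(* The phase of a mode occurs once conjugated and once not, so it drops out and the pairing of
   [pair_energy] appears. *)
have hE s : h s = 2 * normc (\sum_(k <- box (sc n)) conjc (fourier (U s) k - fourier (V s) k) *
      (fourier (cub (U s)) k - fourier (cub (V s)) k)).
  rewrite /h; congr (2 * _).
  have -> : \sum_(k <- box (sc n)) conjc (d k s) * gam k s =
      (- 'i%C * (-1) ^+ b) * \sum_(k <- box (sc n)) conjc (fourier (U s) k - fourier (V s) k) *
      (fourier (cub (U s)) k - fourier (cub (V s)) k).
    rewrite mulr_sumr; apply: eq_bigr => k _.
    have E (p z w y : R[i]) : conjc p * p = 1 -> conjc (p * z) * (w * (p * y)) = w * (conjc z * y).
      by move=> pq; rewrite rmorphM -[RHS]mul1r -pq; ring.
    rewrite /d /gam /G /profile -!mulrBr; apply: E.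
    by rewrite -cisN cisNK.
  by rewrite normcM normcM normcN normc_i normcX normcN normc1 expr1n !mul1r.
set c := (2 * pi) ^- 2 * 4 * Q.
have c0 : 0 <= c.
  by apply: mulr_ge0; [apply: mulr_ge0 => //; rewrite invr_ge0 (ltW p0)|exact: ltW].
have phi : \sum_(k <- box (sc n)) normc (d k t) ^+ 2 <= 2 * c * 16^-1.
  under eq_bigr do rewrite dsq.
  rewrite -(Rintegral_sum_cont _ _ _ cq); apply: (@le_trans _ _ (\int[leb]_(s in `[al, t]) h s)).
    apply: Rintegral_le => //; first exact: continuous_sum_fun.
    move=> s _; under eq_bigr do rewrite qE.
    rewrite -mulr_sumr -Re_sum /h ler_wpM2l//.
    exact: le_trans (ler_norm _) (Re_le_normc _).
  rewrite -lee_fin -EFin_Rintegral_itv//.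
  have mn (a1 b1 : R) : measurable_fun `[a1, b1] (nrg U V) by apply: nrg_measurable hU hV.
  apply: (@le_trans _ _ (\int[leb]_(s in `[al, t]) ((2 * c)%:E * nrg U V s))%E).
    apply: ge0_le_integral => //.
    - by move=> s _; rewrite lee_fin.
    - by apply/measurable_EFinP; apply: measurable_funTS; exact: continuous_measurable_fun.
    - apply: measurable_funeM; exact: mn.
    - move=> s; rewrite /= in_itv/= => /andP[s1 s2].
      rewrite hE (EFinM _ c) (EFinM _ (normc _)) -muleA; apply: lee_wpmul2l; first by rewrite lee_fin.
      have sI : al <= s <= be by rewrite s1 (le_trans s2).
      exact: pair_energy hU hV Q0 (uniq_box _) (sQ s sI).
  rewrite ge0_integralZl_EFin;
    [|by []|by move=> s _; exact: nrg_ge0|exact: mn|exact: mulr_ge0].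
  rewrite [leRHS]EFinM; apply: lee_wpmul2l; first by rewrite lee_fin mulr_ge0.
  apply: le_trans small; apply: ge0_subset_integral => //.
  - exact: mn.
  - by move=> s _; exact: nrg_ge0.
  - by move=> s; rewrite /= !in_itv/= => /andP[-> s2]; rewrite (le_trans s2).
under eq_bigr do rewrite -nd.
apply: (le_trans (ler_wpM2l (ltW p0) phi)).
rewrite /c; have := lt0r_neq0 p0; set p := (2 * pi) ^+ 2 => pn.
rewrite le_eqVlt; apply/orP; left; apply/eqP; field.
exact: pn.
Qed.


(** The a priori bound on the difference is halved indefinitely by [contraction], hence the
    difference vanishes. *)
Lemma modes_agree M b T U V al be : hcont M U -> hcont M V -> duhamel b T U -> duhamel b T V ->
  0 <= al -> al < be -> be <= T -> (\int[leb]_(s in `[al, be]) nrg U V s <= (16^-1)%:E)%E ->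
  (forall k, fourier (U al) k = fourier (V al) k) ->
  forall t, al <= t <= be -> forall k, fourier (U t) k = fourier (V t) k.
Proof.
move=> hU hV dU dV al0 albe beT small eq0 t tI k.
(* The summand 1 makes the starting bound strictly positive, as [contraction] requires. *)
pose M' := 2 * M + 2 * M + 1.
have M0 := hbd_ge0 (hU.1 0).
have hW s : hbd M' (fun x => U s x - V s x).
  by apply: hbd_le (hbdB (hU.1 s) (hV.1 s)); rewrite lerDl.
pose Q0 : R := (2 * pi) ^+ 2 * M'.
have Q00 : 0 < Q0.
  by rewrite mulr_gt0// ?exprn_gt0 ?mulr_gt0 ?pi_gt0// ltr_wpDl// addr_ge0// mulr_ge0.
have bnd n : forall s, al <= s <= be -> sq (fun x => U s x - V s x) <= Q0 * 2 ^- n.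
  elim: n => [|n ih] s sI; first by rewrite expr0 invr1 mulr1; exact: sq_hbd (hW s).
  have := contraction hU hV dU dV al0 albe beT small eq0 _ ih sI.
  rewrite exprSr invfM mulrA; apply.
  by rewrite divr_gt0// exprn_gt0.
have sq0 : sq (fun x => U t x - V t x) <= 0.
  apply/ler_addgt0Pr => e e0; rewrite add0r.
  have [J HJ] := exists_pow_half (Q0 / e).
  apply: (le_trans (bnd J t tI)); move: HJ; rewrite mulrAC ler_pdivrMr// mul1r.
  by [].
have := bessel (hbd_sqint (hW t)) (isT : uniq [:: k]).
rewrite big_seq1 => h.
have p0 : 0 < (2 * pi) ^+ 2 :> R by rewrite exprn_gt0// mulr_gt0 ?pi_gt0.
have : normc (fourier (fun x => U t x - V t x) k) ^+ 2 <= 0.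
  by rewrite -(pmulr_rle0 _ p0); exact: le_trans h sq0.
rewrite (fourierB k (sqint_cintble (hbd_sqint (hU.1 t))) (sqint_cintble (hbd_sqint (hV.1 t)))).
move=> n0; apply/eqP; rewrite -subr_eq0; apply/eqP/eq0_normc/eqP.
by rewrite -sqrf_eq0 eq_le n0 sqr_ge0.
Qed.

Lemma torus_eq_fourier f g h k : sqint f -> sqint g -> torus_eq f h -> torus_eq g h ->
  fourier f k = fourier g k.
Proof.
move=> sf sg fh gh; apply: fourier_ae_eq; [exact: sf.1|exact: sg.1|].
have {}fh : {ae leb2, forall x : plane, cell x -> f x = h x} := fh.
have {}gh : {ae leb2, forall x : plane, cell x -> g x = h x} := gh.
by apply: filterS2 fh gh => x fh gh cx; rewrite fh// gh.
Qed.

Lemma fourier_inj f g : sqint f -> sqint g -> (forall k, fourier f k = fourier g k) ->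
  torus_eq f g.
Proof.
move=> sf sg fg.
have H : torus_eq (fun x => f x - g x) (fun=> 0).
  apply: fourier_uniqueness => [|k]; first exact/sqint_cintble/sqintB.
  by rewrite (fourierB k (sqint_cintble sf) (sqint_cintble sg)) fg subrr.
have {}H : {ae leb2, forall x : plane, cell x -> f x - g x = 0} := H.
suff : {ae leb2, forall x : plane, cell x -> f x = g x} by [].
by apply: filterS H => x h cx; apply/eqP; rewrite -subr_eq0 h.
Qed.

Lemma hcont_le M M' U : M <= M' -> hcont M U -> hcont M' U.
Proof. by move=> MM [h1 h2]; split=> // t; exact: hbd_le (h1 t). Qed.

(** The length [l] given by [nrg_small] does not depend on where the interval starts, so finitely
    many steps reach every time up to T. *)
Lemma uniqueness M b T U V : 0 < T -> hcont M U -> hcont M V -> duhamel b T U -> duhamel b T V ->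
  (forall k, fourier (U 0) k = fourier (V 0) k) ->
  forall t, 0 <= t <= T -> forall k, fourier (U t) k = fourier (V t) k.
Proof.
move=> T0 hU hV dU dV eq0.
have e0 : 0 < 16^-1 :> R by rewrite invr_gt0.
have [l l0 small] := nrg_small e0 hU hV dU dV.
suff key n : forall t, 0 <= t <= T -> t <= n%:R * l -> forall k, fourier (U t) k = fourier (V t) k.
  move=> t tT; apply: (key (Num.bound (t / l))) => //.
  rewrite -ler_pdivrMr// ltW// archi_boundP//.
  by rewrite divr_ge0 ?(ltW l0)//; case/andP: tT.
elim: n => [|n ih] t /andP[t0 tT].
  by rewrite mul0r => t0'; have -> : t = 0 by apply/eqP; rewrite eq_le t0 t0'.
case: (leP t (n%:R * l)) => [tn _|tn tn1]; first by apply: ih => //; rewrite t0.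
have nl0 : 0 <= n%:R * l by rewrite mulr_ge0// ltW.
apply: (modes_agree hU hV dU dV nl0 tn tT).
- by apply: small => //; rewrite lerBlDl; move: tn1; rewrite -natr1 mulrDl mul1r.
- by apply: ih => //; rewrite nl0 (le_trans (ltW tn)).
- by rewrite lexx ltW.
Qed.


End uniqueness.

Theorem theorem3p1 (R : realType) (s : R) (hs : 2 / 3 <= s) (b : bool)
    (T : R) (hT : 0 < T) (u0 : R * R -> R[i]) (hu0 : in_Hs s u0)
    (u v : R -> R * R -> R[i])
    (hu : NLS_solution b s T u0 u) (hv : NLS_solution b s T u0 v)
    (t : R) (ht0 : 0 <= t) (htT : t <= T) :
  torus_eq (u t) (v t).
Proof.
have [M1 [hU dU]] := solution_hcont hs hT hu.
have [M2 [hV dV]] := solution_hcont hs hT hv.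
have T0 := ltW hT.
have z0 : (0 : R) <= 0 <= T by apply/andP; split.
have tI : 0 <= t <= T by rewrite ht0.
have {}hU : hcont (Num.max M1 M2) (fun t => u (clamp 0 T t)).
  by apply: (hcont_le _ hU); rewrite le_max lexx.
have {}hV : hcont (Num.max M1 M2) (fun t => v (clamp 0 T t)).
  by apply: (hcont_le _ hV); rewrite le_max lexx orbT.
have su r : 0 <= r <= T -> sqint (u r).
  by move=> rT; have := hbd_sqint (hU.1 r); rewrite clamp_id.
have sv r : 0 <= r <= T -> sqint (v r).
  by move=> rT; have := hbd_sqint (hV.1 r); rewrite clamp_id.
have init k : fourier (u (clamp 0 T 0)) k = fourier (v (clamp 0 T 0)) k.
  have [_ _ hu1] := hu; have [_ _ hv1] := hv.
  by rewrite clamp_id//; exact: torus_eq_fourier (su 0 z0) (sv 0 z0) hu1 hv1.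
apply: fourier_inj (su t tI) (sv t tI) _ => k.
by have := uniqueness hT hU hV dU dV init tI k; rewrite clamp_id.
Qed.
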